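(* Let $\Omega\subseteq\mathbb{R}^n$ be an open set, $m\ge1$ a natural number, $p\in[1,\infty)$, $\mathcal{G}=\{\mathrm{id}_{\mathbb{R}^n}\}$ and $D\subseteq\mathbb{R}^n$ a bounded open set. Let $\alpha_p$ be a strong $p$-core functional with domain $L^p_{\mathrm{loc}}(\mathbb{R}^n;\mathbb{R}^m)\times\mathcal{G}^D(\mathbb{R}^n)$, let $\mathcal{P}$ be the linear subspace of $\mathbb{R}^{m\times n}$ appearing in the definition of strong $p$-core functional, with associated projection $\pi_{\mathcal{P}}$, and let $u\in L^p_{\mathrm{loc}}(\mathbb{R}^n;\mathbb{R}^m)$. Then, if $D_{\pi_{\mathcal{P}}}(u|_\Omega)\in L^p(\Omega;\mathbb{R}^{m\times n})$, $$\lim_{\varepsilon\to0^+}G^{\alpha_p}_\varepsilon(u,\Omega)=\int_\Omega\psi_{\alpha_p}\big(D_{\pi_{\mathcal{P}}}(u|_\Omega)\big)\,\mathrm{d}x.\qquad(\ast)$$ Moreover, if $u|_\Omega\in W^{\pi_{\mathcal{P}},p}_{\mathrm{loc}}(\Omega;\mathbb{R}^m)$ and $\psi_{\alpha_p}\not\equiv0$, then $(\ast)$ still holds.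
   Context: Notation. $|\cdot|_2$ is the Euclidean norm on $\mathbb{R}^d$; for a matrix $A$, $|A|_2=\sup\{|Ax|_2:|x|_2\le1\}$; $l^A(x)=Ax$; $Q=(-\frac12,\frac12)^n$. With $\mathcal{G}=\{\mathrm{id}_{\mathbb{R}^n}\}$, $\Gamma^{\mathcal{G}}$ is the group of all maps $x\mapsto\varepsilon x+h$ with $\varepsilon>0$, $h\in\mathbb{R}^n$; $\mathcal{G}^D_\varepsilon(\Omega)$ is the class of all sets $\varepsilon D+h$ ($h\in\mathbb{R}^n$) contained in $\Omega$; $\mathcal{G}^D(\Omega)=\bigcup_{\varepsilon>0}\mathcal{G}^D_\varepsilon(\Omega)$. $p$-core functional. A function $\alpha_p:L^p_{\mathrm{loc}}(\mathbb{R}^n;\mathbb{R}^m)\times\mathcal{G}^D(\mathbb{R}^n)\to[0,+\infty)$ is a $p$-core functional (with reference set $D$, subordinated to $\Gamma^{\mathcal{G}}$) if, for all $D'\in\mathcal{G}^D(\mathbb{R}^n)$ and $u,v\in L^p_{\mathrm{loc}}(\mathbb{R}^n;\mathbb{R}^m)$: (i) $\alpha_p(u,D')=\alpha_p(v,D')$ whenever $u|_{D'}=v|_{D'}$; (ii) $\alpha_p(\cdot,D')$ is convex; (iii) $\alpha_p(tu,D')=|t|^p\alpha_p(u,D')$ for all $t\in\mathbb{R}$; (iv) $\alpha_p(u+h,D')=\alpha_p(u,D')$ for all $h\in\mathbb{R}^m$; (v) $\alpha_p(u\circ F,D')=\alpha_p(u,F(D'))$ for all $F\in\Gamma^{\mathcal{G}}$;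 (vi) there is $c_1>0$ such that $\alpha_p(u,D)\le c_1\int_D|\nabla u|_2^p\,\mathrm{d}x$ for all $u\in L^p_{\mathrm{loc}}(\mathbb{R}^n;\mathbb{R}^m)$ with $u|_D\in W^{1,p}(D;\mathbb{R}^m)$. BMO-type seminorm. $G^{\alpha_p}_\varepsilon(u,\Omega)=\varepsilon^{n-p}\sup_{\mathcal{G}_\varepsilon}\sum_{D'\in\mathcal{G}_\varepsilon}\alpha_p(u,D')$, the supremum being over all families $\mathcal{G}_\varepsilon$ of pairwise disjoint elements of $\mathcal{G}^D_\varepsilon(\Omega)$ (an empty family contributes $0$). Further, $\psi_{\alpha_p}(A)=\lim_{\varepsilon\to0^+}G^{\alpha_p}_\varepsilon(l^A,Q)$ for $A\in\mathbb{R}^{m\times n}$ (the limit exists in $[0,\infty)$), and $\mathcal{N}_{\psi_{\alpha_p}}=\{A:\psi_{\alpha_p}(A)=0\}$, which is a linear subspace of $\mathbb{R}^{m\times n}$. The operators $D_{\mathfrak{L}}$. For a linear map $\mathfrak{L}:\mathbb{R}^{m\times n}\to\mathbb{R}^{m\times n}$ and $u\in L^1_{\mathrm{loc}}(\Omega;\mathbb{R}^m)$, $D_{\mathfrak{L}}u$ is the $m\times n$ matrix of distributions $\langle(D_{\mathfrak{L}}u)_{ij},\phi\rangle=-\int_\Omega\mathfrak{L}(u\otimes\nabla\phi)_{ij}\,\mathrm{d}x$, $\phi\in C^\infty_c(\Omega)$ (so $D_{\mathfrak{L}}u=\mathfrak{L}(\nabla u)$ for Sobolev $u$). $W^{\mathfrak{L},p}(\Omega;\mathbb{R}^m)=\{u\in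 L^p:D_{\mathfrak{L}}u\in L^p(\Omega;\mathbb{R}^{m\times n})\}$ and $W^{\mathfrak{L},p}_{\mathrm{loc}}(\Omega;\mathbb{R}^m)=\{u\in L^p_{\mathrm{loc}}:D_{\mathfrak{L}}u\in L^p_{\mathrm{loc}}(\Omega;\mathbb{R}^{m\times n})\}$. Strong $p$-core functional. A $p$-core functional $\alpha_p$ is strong if there is a linear subspace $\mathcal{P}\subseteq\mathbb{R}^{m\times n}$ with $\mathbb{R}^{m\times n}=\mathcal{P}\oplus\mathcal{N}_{\psi_{\alpha_p}}$ and a constant $c_3>0$ such that, $\pi_{\mathcal{P}}$ denoting the projection onto $\mathcal{P}$ along $\mathcal{N}_{\psi_{\alpha_p}}$, $\alpha_p(u,D)\le c_3\int_D|D_{\pi_{\mathcal{P}}}u|_2^p\,\mathrm{d}x$ for all $u\in L^p_{\mathrm{loc}}(\mathbb{R}^n;\mathbb{R}^m)$ with $u|_D\in W^{\pi_{\mathcal{P}},p}(D;\mathbb{R}^m)$. *)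

(* Defs.v *)
From HB Require Import structures.
From mathcomp Require Import all_boot all_order all_algebra.
From mathcomp Require Import all_classical all_reals all_analysis.
From mathcomp Require Import measurable_realfun.

Set Implicit Arguments.
Unset Strict Implicit.
Unset Printing Implicit Defensive.

Import Order.TTheory GRing.Theory Num.Theory.
Import numFieldNormedType.Exports.

Local Open Scope classical_set_scope.
Local Open Scope ring_scope.

(* R^n is represented by columns ['cV[R]_n], and m x n matrices carry the
   topology of the maximum norm. *)
Definition mx_borel_display : measure_display. Proof. exact: default_measure_display. Qed.

Section mx_borel.
Context {R : realType} (m n : nat).

Definition mx_borel : set (set 'M[R]_(m, n)) := <<s [set U | open U] >>.

Let mx_borel0 : mx_borel set0.
Proof. exact: sigma_algebra0. Qed.

Let mx_borelC A : mx_borel A -> mx_borel (~` A).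
Proof. exact: sigma_algebraC. Qed.

Let mx_borel_bigcup (F : (set 'M[R]_(m, n))^nat) :
  (forall i, mx_borel (F i)) -> mx_borel (\bigcup_i (F i)).
Proof. exact: sigma_algebra_bigcup. Qed.

HB.instance Definition _ := @isMeasurable.Build mx_borel_display
  'M[R]_(m, n) mx_borel mx_borel0 mx_borelC mx_borel_bigcup.

Lemma mx_open_measurable (U : set 'M[R]_(m, n)) : open U -> measurable U.
Proof. exact: sub_gen_smallest. Qed.

(* Every open set of matrices is a countable union of open boxes with rational
   centre and rational radius, so measurability is checked entrywise. *)
Lemma measurable_fun_mxE d (T : measurableType d) (f : T -> 'M[R]_(m, n)) :
  (forall i j, measurable_fun [set: T] (fun t => f t i j)) ->
  measurable_fun [set: T] f.
Proof.
move=> mf; apply: (measurability [set U : set 'M[R]_(m, n) | open U]) => //.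
move=> _ [U oU <-]; rewrite setTI.
pose box (qk : 'M[rat]_(m, n) * nat) : set 'M[R]_(m, n) :=
  [set M | forall i j, ball (ratr (qk.1 i j) : R) (qk.2.+1%:R^-1) (M i j)].
have -> : U = \bigcup_(qk in [set qk | box qk `<=` U]) box qk.
  apply/seteqP; split=> [M UM|M [qk /= + ]]; last exact.
  have /nbhs_ballP[e /= e0 eU] : nbhs M U by exact: open_nbhs_nbhs.
  have [k ke] : exists k : nat, k.+1%:R^-1 < e / 2.
    have e20 : 0 < e / 2 by rewrite divr_gt0.
    exists (Num.truncn (e / 2)^-1).
    rewrite -[ltRHS]invrK ltf_pV2 ?posrE ?invr_gt0// truncnS_gt//.
  have qP i j : exists q : rat, ball (ratr q : R) (k.+1%:R^-1) (M i j).
    have : M i j - k.+1%:R^-1 < M i j + k.+1%:R^-1.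
      by rewrite ltrBlDr -addrA ltrDl addr_gt0.
    move=> /rat_in_itvoo[q]; rewrite in_itv/= => /andP[q1 q2].
    exists q; rewrite /ball/= ltr_distl.
    by rewrite ltrBlDr q2/= -ltrBlDr q1.
  pose r i j := sval (cid (qP i j)).
  have rP i j : `|ratr (r i j) - M i j| < k.+1%:R^-1 := svalP (cid (qP i j)).
  exists (\matrix_(i, j) r i j, k) => /=; last first.
    by move=> i j; rewrite /= mxE; exact: rP.
  move=> N qN; apply: eU; split => // i j.
  have := qN i j; rewrite /= mxE /ball/= => rN.
  rewrite (le_lt_trans (ler_distD (ratr (r i j)) _ _))// [ltRHS]splitr ltrD//.
    by rewrite distrC (lt_trans (rP i j)).
  by rewrite (lt_trans rN).
rewrite preimage_bigcup bigcup_mkcond.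
apply: countable_bigcupT_measurable => // qk; case: ifPn => // _.
have -> : f @^-1` box qk = \bigcap_(ij in [set: 'I_m * 'I_n])
    (fun t => f t ij.1 ij.2) @^-1` ball (ratr (qk.1 ij.1 ij.2) : R) qk.2.+1%:R^-1.
  apply/seteqP; split=> [t tbox [i j] _|t tbox i j]; first exact: tbox.
  exact: (tbox (i, j)).
apply: fin_bigcap_measurable; first exact: finite_finset.
move=> [i j] _; rewrite -[X in measurable X]setTI; apply: mf => //.
by apply: open_measurable; exact: ball_open.
Qed.

End mx_borel.

(* [vcons (t, x)] is the column with first entry [t] and remaining entries [x];
   it identifies [R * R^n] with [R^(n+1)]. *)
Definition vcons {R : realType} {n} (z : R * 'cV[R]_n) : 'cV[R]_n.+1 :=
  \col_i if unlift ord0 i is Some j then z.2 j 0 else z.1.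

Definition vuncons {R : realType} {n} (v : 'cV[R]_n.+1) : R * 'cV[R]_n :=
  (v ord0 0, \col_i v (lift ord0 i) 0).

Section lebesgue_step.
Context {R : realType} (n : nat).

Lemma measurable_mxE m k (i : 'I_m) (j : 'I_k) :
  measurable_fun [set: 'M[R]_(m, k)] (fun M => M i j).
Proof.
apply: (measurability _ (RGenOpens.measurableE R)) => //.
move=> _ [_ [a [b ->]] <-]; rewrite setTI; apply: mx_open_measurable.
apply: open_comp => [M _|]; first exact: coord_continuous.
exact: interval_open.
Qed.

Lemma measurable_vcons :
  measurable_fun [set: measurableTypeR R * 'cV[R]_n] (@vcons R n).
Proof.
apply: measurable_fun_mxE => i j; rewrite ord1.
under eq_fun do rewrite mxE.
case: (unlift ord0 i) => [k|].
  exact: (measurableT_comp (measurable_mxE k 0) measurable_snd).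
exact: measurable_fst.
Qed.

Lemma measurable_vuncons : measurable_fun [set: 'cV[R]_n.+1]
  (@vuncons R n : _ -> measurableTypeR R * 'cV[R]_n).
Proof.
apply/measurable_fun_pairP; split; first exact: measurable_mxE.
apply: measurable_fun_mxE => i j /=; rewrite /vuncons /=.
by under eq_fun do rewrite mxE; exact: measurable_mxE.
Qed.

Lemma vconsK : cancel (@vcons R n) vuncons.
Proof.
move=> [t x]; congr pair; first by rewrite mxE unlift_none.
by apply/colP => i; rewrite !mxE liftK.
Qed.

Local Open Scope ereal_scope.
Variable mu : {sigma_finite_measure set 'cV[R]_n -> \bar R}.

Definition lebesgue_vcons : set 'cV[R]_n.+1 -> \bar R :=
  pushforward (@lebesgue_measure R \x mu) (@vcons R n).

HB.instance Definition _ := Measure.copy lebesgue_vcons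
  (measure_function_pushforward__canonical__measure_function_Measure
     (@lebesgue_measure R \x mu) measurable_vcons).

Let lebesgue_vcons_sigma_finite : sigma_finite setT lebesgue_vcons.
Proof.
have /sigma_finiteP[F [FT ndF Foo]] := sigma_finiteT (@lebesgue_measure R).
have /sigma_finiteP[G [GT ndG Goo]] := sigma_finiteT mu.
exists (fun k => vuncons @^-1` (F k `*` G k)) => [|k].
  apply/seteqP; split=> // v _.
  have [i _ Fi] : (\bigcup_k F k) (vuncons v).1 by rewrite -FT.
  have [j _ Gj] : (\bigcup_k G k) (vuncons v).2 by rewrite -GT.
  exists (maxn i j) => //; split.
    by move: Fi; exact/subsetPset/ndF/leq_maxl.
  by move: Gj; exact/subsetPset/ndG/leq_maxr.
have [mF Fk] := Foo k; have [mG Gk] := Goo k; split.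
  rewrite -[X in measurable X]setTI.
  by apply: measurable_vuncons => //; exact: measurableX.
rewrite /lebesgue_vcons /pushforward.
have -> : vcons @^-1` (vuncons @^-1` (F k `*` G k)) = F k `*` G k.
  by rewrite -comp_preimage (_ : _ \o _ = id)//; exact/funext/vconsK.
by rewrite product_measure1E// lte_mul_pinfty// ge0_fin_numE.
Qed.

HB.instance Definition _ := @Measure_isSigmaFinite.Build _ _ _
  lebesgue_vcons lebesgue_vcons_sigma_finite.

End lebesgue_step.

Fixpoint lebesgue_rn {R : realType} (n : nat) :
    {sigma_finite_measure set 'cV[R]_n -> \bar R} :=
  if n is k.+1 then lebesgue_vcons (lebesgue_rn k) else \d_(0 : 'cV[R]_0).

Lemma lebesgue_rn_box {R : realType} (n : nat) (B : 'I_n -> set R) :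
  (forall i, measurable (B i)) ->
  lebesgue_rn n [set x : 'cV[R]_n | forall i, B i (x i 0)] =
    (\prod_(i < n) @lebesgue_measure R (B i))%E.
Proof.
elim: n B => [|n IH] B mB.
  rewrite big_ord0 /= diracE (_ : [set x | _] = [set: 'cV[R]_0]) ?in_setT//.
  by apply/seteqP; split=> // x _ [].
rewrite big_ord_recl -IH; last by move=> i; exact: mB.
rewrite /= /lebesgue_vcons /pushforward -product_measure1E; last 2 first.
- exact: mB.
- rewrite (_ : [set x | _] = \bigcap_(i in [set: 'I_n])
      (fun x : 'cV[R]_n => x i 0) @^-1` B (lift ord0 i)); last first.
    by apply/seteqP; split=> [x xB i _|x xB i]; [exact: xB|exact: (xB i)].
  apply: fin_bigcap_measurable => [|i _]; first exact: finite_finset.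
  by rewrite -[X in measurable X]setTI; exact: (measurable_mxE i 0).
congr (product_measure1 _ _ _); apply/seteqP; split=> -[t x] /=.
  move=> vB; split=> [|i]; first by have := vB ord0; rewrite mxE unlift_none.
  by have := vB (lift ord0 i); rewrite mxE liftK.
by move=> [tB xB] i; rewrite mxE; case: unliftP => [j ->|->].
Qed.

Section spaces.
Context {R : realType}.

Definition enorm {d} (x : 'cV[R]_d) : R := Num.sqrt (\sum_i x i 0 ^+ 2).

Definition opnorm {m n} (A : 'M[R]_(m, n)) : R :=
  sup [set enorm (A *m x) | x in [set x | enorm x <= 1]].

Context {n : nat}.
Implicit Types (E Omega : set 'cV[R]_n) (p : R).

(* [R^m]-valued functions are the case [l = 1], where [opnorm] is [enorm].
   Functions are total, so that [f|_E \in L^p(E)] only constrains [f] on [E].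
   Elements of [L^p] are given by Borel representatives. *)
Definition in_Lp p E {k l} (f : 'cV[R]_n -> 'M[R]_(k, l)) : Prop :=
  measurable_fun E f /\
  (\int[lebesgue_rn n]_(x in E) (opnorm (f x) `^ p)%:E < +oo)%E.

Definition in_Lploc p Omega {k l} (f : 'cV[R]_n -> 'M[R]_(k, l)) : Prop :=
  forall K, compact K -> K `<=` Omega -> in_Lp p K f.

Definition partial (f : 'cV[R]_n -> R) (j : 'I_n) : 'cV[R]_n -> R :=
  fun x => 'D_(delta_mx j 0) f x.

Definition smooth (f : 'cV[R]_n -> R) : Prop :=
  forall s : seq 'I_n, let g := foldl partial f s in
    continuous g /\ forall x j, derivable g x (delta_mx j 0).

Definition test_function Omega (phi : 'cV[R]_n -> R) : Prop :=
  let supp := closure [set x | phi x != 0] in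
  [/\ smooth phi, compact supp & supp `<=` Omega].

Definition grad (f : 'cV[R]_n -> R) (x : 'cV[R]_n) : 'cV[R]_n :=
  \col_j partial f j x.

Context {m : nat}.
Implicit Types (L : 'M[R]_(m, n) -> 'M[R]_(m, n)) (u : 'cV[R]_n -> 'cV[R]_m)
  (V : 'cV[R]_n -> 'M[R]_(m, n)).

(* The matrix of distributions [D_L (u|_Omega)], evaluated at [phi]. *)
Definition DL L Omega u (phi : 'cV[R]_n -> R) : 'M[R]_(m, n) :=
  \matrix_(i, j)
    - \int[lebesgue_rn n]_(x in Omega) L (u x *m (grad phi x)^T) i j.

Definition distribution_of Omega V (phi : 'cV[R]_n -> R) : 'M[R]_(m, n) :=
  \matrix_(i, j) \int[lebesgue_rn n]_(x in Omega) (V x i j * phi x).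

(* [D_L (u|_Omega)] is the (class of the) function [V]. *)
Definition DL_eq L Omega u V : Prop :=
  forall phi, test_function Omega phi ->
    DL L Omega u phi = distribution_of Omega V phi.

(* [u|_Omega] is in [W^{L,p}(Omega)] and [D_L (u|_Omega) = V]; for [L = id]
   this is the Sobolev space [W^{1,p}], with [V] the gradient of [u]. *)
Definition in_WLp L p Omega u V : Prop :=
  [/\ in_Lp p Omega u, in_Lp p Omega V & DL_eq L Omega u V].

Definition in_WLploc L p Omega u V : Prop :=
  [/\ in_Lploc p Omega u, in_Lploc p Omega V & DL_eq L Omega u V].

End spaces.

Section core.
Context {R : realType} {n m : nat}.
Implicit Types (D E Omega : set 'cV[R]_n) (p e : R)
  (u v : 'cV[R]_n -> 'cV[R]_m).

Definition homothety e (h x : 'cV[R]_n) : 'cV[R]_n := e *: x + h.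

Definition copies_at D e Omega : set (set 'cV[R]_n) :=
  [set E | E `<=` Omega /\ exists h, E = homothety e h @` D].

Definition copies D Omega : set (set 'cV[R]_n) :=
  \bigcup_(e in [set e | 0 < e]) copies_at D e Omega.

Definition functional := ('cV[R]_n -> 'cV[R]_m) -> set 'cV[R]_n -> R.

(* Only the values [alpha u E] with [u] in [L^p_loc] and [E] in
   [copies D setT] are meaningful. Elements of [L^p_loc] being classes, the
   equality of restrictions in [core_local] is an equality almost everywhere. *)
Record p_core p D (alpha : functional) : Prop := {
  core_ge0 : forall u E, in_Lploc p setT u -> copies D setT E ->
    0 <= alpha u E;
  core_local : forall u v E, in_Lploc p setT u -> in_Lploc p setT v ->
    copies D setT E ->
    {ae lebesgue_rn n, forall x, E x -> u x = v x} -> alpha u E = alpha v E;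
  core_convex : forall u v E (t : R), in_Lploc p setT u -> in_Lploc p setT v ->
    copies D setT E -> 0 <= t <= 1 ->
    alpha (fun x => t *: u x + (1 - t) *: v x) E <=
      t * alpha u E + (1 - t) * alpha v E;
  core_homogeneous : forall u E (t : R), in_Lploc p setT u ->
    copies D setT E -> alpha (fun x => t *: u x) E = `|t| `^ p * alpha u E;
  core_translation : forall u E (h : 'cV[R]_m), in_Lploc p setT u ->
    copies D setT E -> alpha (fun x => u x + h) E = alpha u E;
  core_equivariant : forall u E e (h : 'cV[R]_n), in_Lploc p setT u ->
    copies D setT E -> 0 < e ->
    alpha (u \o homothety e h) E = alpha u (homothety e h @` E);
  core_bound : exists2 c1 : R, 0 < c1 & forall u V,
    in_Lploc p setT u -> in_WLp idfun p D u V ->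
    ((alpha u D)%:E <=
      c1%:E * \int[lebesgue_rn n]_(x in D) (opnorm (V x) `^ p)%:E)%E
}.

Definition disjoint_families D e Omega : set (set (set 'cV[R]_n)) :=
  [set F | F `<=` copies_at D e Omega /\ trivIset F id].

Definition G p D (alpha : functional) e u Omega : \bar R :=
  ((e `^ (n%:R - p))%:E *
   ereal_sup [set \esum_(E in F) (alpha u E)%:E
             | F in disjoint_families D e Omega])%E.

Definition Q : set 'cV[R]_n := [set x | forall i, - 2^-1 < x i 0 < 2^-1].

Definition psi p D (alpha : functional) (A : 'M[R]_(m, n)) : \bar R :=
  lim (G p D alpha e (mulmx A) Q @[e --> 0^'+]).

(* [P] is a complement, as in the definition of strong p-core functionals, of
   the subspace [N] where [psi] vanishes; [daddv_pi P N] is then the projection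
   onto [P] along [N]. *)
Definition strong_p_core_with p D (alpha : functional)
    (P N : {vspace 'M[R]_(m, n)}) : Prop :=
  [/\ p_core p D alpha,
      forall A, A \in N <-> psi p D alpha A = 0%E,
      (P + N = fullv)%VS,
      (P :&: N = 0)%VS
    & exists2 c3 : R, 0 < c3 & forall u V,
        in_Lploc p setT u -> in_WLp (daddv_pi P N) p D u V ->
        ((alpha u D)%:E <=
          c3%:E * \int[lebesgue_rn n]_(x in D) (opnorm (V x) `^ p)%:E)%E].

End core.

(* Main.v *)
Require Import Defs.
From HB Require Import structures.
From mathcomp Require Import all_boot all_order all_algebra finmap.
From mathcomp Require Import all_classical all_reals all_analysis.
From mathcomp Require Import measurable_realfun lra ring.

Set Implicit Arguments.
Unset Strict Implicit.
Unset Printing Implicit Defensive.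

Import Order.TTheory GRing.Theory Num.Theory.
Import numFieldNormedType.Exports.
Local Open Scope classical_set_scope.
Local Open Scope ring_scope.

(** The seminorm of a linear map [l^A] is explicit. On a copy [e D + h] the
    functional takes the value [e ^ p * alpha (l^A) D], so [G (l^A)] is
    [alpha (l^A) D] times a normalised packing number of [D]. Packings of the
    cells of a grid combine, hence the packing density of the unit cube has a
    limit ([dens_cvg]). Thus [psi A] is [alpha (l^A) D] times that density,
    written [lim_lin A], and [G (l^A)] on a cube of side [r] tends to
    [psi A * r ^ n] ([psiE], [G_cube_cvg]).

    Convexity and homogeneity give, for every [y > 1], a constant [C] with
    [alpha (u + v) <= y * alpha u + C * alpha v] ([core_split]). The bound in the
    definition of strong functionals, rescaled to the copies of [D] and summed
    over a packing, bounds [G u] on [X] by the integral over [X] of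
    [|D_pi u| ^ p] ([core_energy], [G_energy]). Since [D_pi (l^A)] is the
    constant [pi A] ([DL_mulmx]), [G u] and [G (l^A)] are comparable on a cube
    where [V = D_pi u] is close in [L^p] to a constant [A] of [P] ([G_compare]).

    A field [V] in [L^p] is close to a constant on each of finitely many
    disjoint cubes, up to a remainder of small energy which may be chosen to
    contain thin layers along the faces ([step_approx]). For small [e] a copy
    of [e D] either lies in one of the cubes or in this remainder, so [G u] on
    the open set is at most the sum of its values on the cubes plus a small
    error ([G_cover]); it is at least that sum, because packings of disjoint
    sets combine ([G_superadd]). The integral of [psi V] is comparable with the
    same sum over the cubes ([integral_bigcup_cubes_le], [sum_cubes_le]).
    Letting the errors vanish and [y] tend to [1] gives the limit
    ([strong_limit]).

    The field [V] may be replaced by [pi V], extended by zero: [psi] is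
    invariant under [pi] ([lim_lin_pi]) and [D_pi u] is a field with values in
    [P] ([DL_eq_idem]). When [V] is only locally in [L^p], either the integral
    of [psi V] is finite, and then [pi V] is in [L^p] because [psi] is bounded
    below by a multiple of [|pi A| ^ p] ([lim_lin_coercive]), or it is infinite,
    and then [G u] is large already on relatively compact open subsets
    ([strong_limit_loc]). If [D] is empty, both sides vanish ([G_set0_cvg]). *)

(** * Norms *)

Section norms.
Context {R : realType}.

Lemma sqr_enorm d (x : 'cV[R]_d) : enorm x ^+ 2 = \sum_i x i 0 ^+ 2.
Proof. by rewrite sqr_sqrtr// sumr_ge0// => i _; exact: sqr_ge0. Qed.

Lemma enorm_ge0 d (x : 'cV[R]_d) : 0 <= enorm x.
Proof. exact: sqrtr_ge0. Qed.

Lemma enorm0 d : enorm (0 : 'cV[R]_d) = 0.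
Proof. by rewrite /enorm big1 ?sqrtr0// => i _; rewrite mxE expr0n. Qed.

Lemma enorm_coord d (x : 'cV[R]_d) i : `|x i 0| <= enorm x.
Proof.
rewrite -sqrtr_sqr ler_sqrt ?sumr_ge0//; last by move=> j _; exact: sqr_ge0.
by rewrite (bigD1 i)//= lerDl sumr_ge0// => j _; exact: sqr_ge0.
Qed.

Lemma enorm_le_sum d (x : 'cV[R]_d) : enorm x <= \sum_i `|x i 0|.
Proof.
have s0 : 0 <= \sum_i `|x i 0| by rewrite sumr_ge0.
rewrite -(ler_pXn2r (ltn0Sn 1)) ?nnegrE ?enorm_ge0// sqr_enorm expr2 mulr_sumr.
apply: ler_sum => i _; rewrite -real_normK ?num_real// expr2 ler_wpM2r//.
by rewrite (bigD1 i)//= lerDl sumr_ge0.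
Qed.

(** Cauchy-Schwarz from [0 <= \sum_i (x_i |y| - y_i |x|)^2]. *)
Lemma enorm_dot d (x y : 'cV[R]_d) :
  \sum_i x i 0 * y i 0 <= enorm x * enorm y.
Proof.
set s := \sum_i _; set a := enorm x; set b := enorm y.
have a0 : 0 <= a := enorm_ge0 x; have b0 : 0 <= b := enorm_ge0 y.
have : 0 <= \sum_i (x i 0 * b - y i 0 * a) ^+ 2.
  by rewrite sumr_ge0// => i _; exact: sqr_ge0.
under eq_bigr => i _.
  rewrite (_ : _ ^+ 2 = x i 0 ^+ 2 * b ^+ 2 + y i 0 ^+ 2 * a ^+ 2
    - (x i 0 * y i 0) * (a * b *+ 2)); last by ring.
  over.
rewrite sumrB big_split/= -!mulr_suml -!sqr_enorm -/a -/b -/s => h.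
have [ab0|ab0] := eqVneq (a * b) 0.
  rewrite ab0; move/eqP: ab0; rewrite mulf_eq0 => /orP[] /eqP e0.
  - rewrite le_eqVlt; apply/orP; left; rewrite /s big1// => i _.
    by have := enorm_coord x i; rewrite -/a e0 normr_le0 => /eqP ->; rewrite mul0r.
  - rewrite le_eqVlt; apply/orP; left; rewrite /s big1// => i _.
    by have := enorm_coord y i; rewrite -/b e0 normr_le0 => /eqP ->; rewrite mulr0.
have abp : 0 < a * b *+ 2.
  by rewrite pmulrn_lgt0// lt0r ab0 mulr_ge0.
rewrite -(ler_pM2r abp) -subr_ge0 (le_trans h)// le_eqVlt; apply/orP; left.
by apply/eqP; ring.
Qed.

Lemma enormD d (x y : 'cV[R]_d) : enorm (x + y) <= enorm x + enorm y.
Proof.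
rewrite -(ler_pXn2r (ltn0Sn 1)) ?nnegrE ?addr_ge0 ?enorm_ge0//.
rewrite sqr_enorm sqrrD !sqr_enorm.
under eq_bigr do rewrite mxE sqrrD.
rewrite 2!big_split/= lerD2r lerD2l sumrMnl lerMn2r/=.
exact: enorm_dot.
Qed.

Lemma enormZ d c (x : 'cV[R]_d) : enorm (c *: x) = `|c| * enorm x.
Proof.
rewrite /enorm; under eq_bigr do rewrite mxE exprMn.
by rewrite -mulr_sumr sqrtrM ?sqr_ge0// sqrtr_sqr.
Qed.

Context {m n : nat}.
Implicit Types A B : 'M[R]_(m, n).

Lemma enorm_mulmx A (x : 'cV[R]_n) :
  enorm x <= 1 -> enorm (A *m x) <= \sum_i \sum_j `|A i j|.
Proof.
move=> x1; apply: (le_trans (enorm_le_sum _)); apply: ler_sum => i _.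
rewrite mxE (le_trans (ler_norm_sum _ _ _))//; apply: ler_sum => j _.
by rewrite normrM ler_piMr// (le_trans (enorm_coord _ _)).
Qed.

Lemma opnorm_has_sup A :
  has_sup [set enorm (A *m x) | x in [set x | enorm x <= 1]].
Proof.
split; first by exists (enorm (A *m 0)), 0 => //=; rewrite enorm0.
by exists (\sum_i \sum_j `|A i j|) => _ [x x1 <-]; exact: enorm_mulmx.
Qed.

Lemma enorm_le_opnorm A (x : 'cV[R]_n) : enorm x <= 1 -> enorm (A *m x) <= opnorm A.
Proof.
by move=> x1; apply: ub_le_sup; [case: (opnorm_has_sup A)|exists x].
Qed.

Lemma opnorm_leP A c :
  (forall x : 'cV[R]_n, enorm x <= 1 -> enorm (A *m x) <= c) -> opnorm A <= c.
Proof.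
move=> Ac; apply: ge_sup; first by case: (opnorm_has_sup A).
by move=> _ [x x1 <-]; exact: Ac.
Qed.

Lemma opnorm_ge0 A : 0 <= opnorm A.
Proof. by rewrite (le_trans (enorm_ge0 (A *m 0)))// enorm_le_opnorm// enorm0. Qed.

Lemma opnormD A B : opnorm (A + B) <= opnorm A + opnorm B.
Proof.
apply: opnorm_leP => x x1; rewrite mulmxDl (le_trans (enormD _ _))//.
by rewrite lerD// enorm_le_opnorm.
Qed.

Lemma opnormZ c A : opnorm (c *: A) = `|c| * opnorm A.
Proof.
have le c' A' : opnorm (c' *: A') <= `|c'| * opnorm A'.
  apply: opnorm_leP => x x1; rewrite -scalemxAl enormZ ler_wpM2l//.
  exact: enorm_le_opnorm.
apply/eqP; rewrite eq_le le /=.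
have [->|c0] := eqVneq c 0; first by rewrite normr0 mul0r opnorm_ge0.
rewrite -ler_pdivlMl ?normr_gt0//.
by have := le c^-1 (c *: A); rewrite scalerA mulVf// scale1r normfV.
Qed.

Lemma opnormN A : opnorm (- A) = opnorm A.
Proof. by rewrite -scaleN1r opnormZ normrN1 mul1r. Qed.

Lemma opnorm_le_sum A : opnorm A <= \sum_i \sum_j `|A i j|.
Proof. by apply: opnorm_leP => x; exact: enorm_mulmx. Qed.

Lemma opnorm0 : opnorm (0 : 'M[R]_(m, n)) = 0.
Proof. by rewrite -(scale0r 0) opnormZ normr0 mul0r. Qed.

Lemma entry_le_opnorm A i j : `|A i j| <= opnorm A.
Proof.
have e1 : enorm (delta_mx j 0 : 'cV[R]_n) <= 1.
  rewrite /enorm (bigD1 j)//= mxE !eqxx big1 ?addr0 ?expr1n ?sqrtr1//.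
  by move=> k kj; rewrite mxE (negbTE kj) expr0n.
apply: le_trans (enorm_le_opnorm _ e1); rewrite -colE.
by apply: le_trans (enorm_coord _ i); rewrite mxE.
Qed.

Lemma opnorm_le_norm A : opnorm A <= (m * n)%:R * `|A|.
Proof.
apply: (le_trans (opnorm_le_sum A)); rewrite natrM -mulrA.
have h i j : `|A i j| <= `|A|.
  by rewrite [leRHS]/Num.norm /= mx_normrE; apply: (le_bigmax _ _ (i, j)).
have h1 i : \sum_j `|A i j| <= n%:R * `|A|.
  by rewrite (le_trans (ler_sum _ (fun j _ => h i j)))// sumr_const card_ord mulr_natl.
rewrite (le_trans (ler_sum _ (fun i _ => h1 i)))//.
by rewrite sumr_const card_ord [leRHS]mulr_natl.
Qed.

Lemma opnorm_continuous : continuous (@opnorm R m n).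
Proof.
have lip A B : `|opnorm A - opnorm B| <= (m * n)%:R * `|A - B|.
  apply: le_trans (opnorm_le_norm _); rewrite ler_norml; apply/andP; split.
    rewrite lerNl opprB lerBlDr -(opnormN (A - B)) opprB.
    by rewrite -[leLHS](congr1 (@opnorm R m n) (subrK A B)) opnormD.
  by rewrite lerBlDr -[leLHS](congr1 (@opnorm R m n) (subrK B A)) opnormD.
move=> A s /= /(nbhs_ballP (opnorm A)) [e /= e0 es].
apply/nbhs_ballP; exists (e / ((m * n)%:R + 1)); first by rewrite /= divr_gt0.
move=> B /= AB; apply: es; apply: (le_lt_trans (lip A B)).
move: AB; rewrite -ball_normE /ball_ /= ltr_pdivlMr// => AB; apply: le_lt_trans AB.
by rewrite mulrC ler_wpM2l// lerDl.
Qed.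

End norms.

(** * Lebesgue measure on columns *)

Section lebesgue_columns.
Context {R : realType} {n : nat}.
Implicit Types (h x c : 'cV[R]_n) (e : R).

Definition box (B : 'I_n -> set R) : set 'cV[R]_n :=
  [set x | forall i, B i (x i 0)].

Lemma measurable_box (B : 'I_n -> set R) :
  (forall i, measurable (B i)) -> measurable (box B).
Proof.
move=> mB; rewrite (_ : box B = \bigcap_(i in [set: 'I_n])
    (fun x : 'cV[R]_n => x i 0) @^-1` B i); last first.
  by apply/seteqP; split=> [x xB i _|x xB i]; [exact: xB|exact: (xB i)].
apply: fin_bigcap_measurable => [|i _]; first exact: finite_finset.
by rewrite -[X in measurable X]setTI; exact: (measurable_mxE i 0).
Qed.

Lemma boxI (B C : 'I_n -> set R) :
  box B `&` box C = box (fun i => B i `&` C i).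
Proof.
apply/seteqP; split=> [x [xB xC] i|x xBC]; first by split; [exact: xB|exact: xC].
by split=> i; have [] := xBC i.
Qed.

Definition measurable_boxes : set (set 'cV[R]_n) :=
  [set box B | B in [set B | forall i, measurable (B i)]].

(** The identity is measurable from the sigma-algebra generated by the boxes,
    because its coordinates are. *)
Lemma measurable_boxesE : @measurable _ 'cV[R]_n = <<s measurable_boxes >>.
Proof.
apply/seteqP; split; last first.
  apply: smallest_sub; first exact: sigma_algebra_measurable.
  by move=> _ [B mB <-]; exact: measurable_box.
move=> A mA.
pose T := g_sigma_algebraType measurable_boxes.
have mid : measurable_fun [set: T] (fun x : T => (x : 'cV[R]_n)).
  apply: measurable_fun_mxE => i j; rewrite ord1 => _ Y mY; rewrite setTI.
  apply: sub_sigma_algebra; exists (fun k => if k == i then Y else setT) => /=.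
    by move=> k; case: ifP.
  apply/seteqP; split=> [x /(_ i)|x xY k]; first by rewrite eqxx.
  by case: ifPn => [/eqP ->|].
by have := mid measurableT A mA; rewrite setTI.
Qed.

Lemma bigcup_box_itv :
  \bigcup_k box (fun=> `](- k.+1%:R), k.+1%:R[%classic) = [set: 'cV[R]_n].
Proof.
apply/seteqP; split=> // x _.
exists (Num.truncn `|x|) => // i /=; rewrite in_itv/= -ltr_norml.
apply: (@le_lt_trans _ _ `|x|); last exact: truncnS_gt.
by rewrite [leRHS]/Num.norm /= mx_normrE; apply: (le_bigmax _ _ (i, 0)).
Qed.

Lemma lebesgue_rn_box_lty (B : 'I_n -> set R) : (forall i, measurable (B i)) ->
  (forall i, lebesgue_measure (B i) < +oo)%E -> (lebesgue_rn n (box B) < +oo)%E.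
Proof.
move=> mB Boo; rewrite lebesgue_rn_box//.
suff : (\prod_(i < n) lebesgue_measure (B i))%E \is a fin_num.
  by rewrite fin_numElt => /andP[].
by apply: prode_fin_num => i _; rewrite ge0_fin_numE.
Qed.

(** The boxes form a pi-system which generates the Borel sets. *)
Lemma lebesgue_rn_unique (mu : {measure set 'cV[R]_n -> \bar R}) :
  (forall B, (forall i, measurable (B i)) ->
    mu (box B) = lebesgue_rn n (box B)) ->
  forall A, measurable A -> mu A = lebesgue_rn n A.
Proof.
move=> muB A mA; apply/esym.
apply: (measure_unique measurable_boxes
  (fun k => box (fun=> `](- k.+1%:R), k.+1%:R[%classic))) => //.
- exact: measurable_boxesE.
- move=> _ _ [B mB <-] [C mC <-]; rewrite boxI.
  by exists (fun i => B i `&` C i) => // i; exact: measurableI.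
- by move=> k; exists (fun=> `](- k.+1%:R), k.+1%:R[%classic).
- exact: bigcup_box_itv.
- by move=> _ [B mB <-]; rewrite muB.
- move=> k; apply: lebesgue_rn_box_lty => // i.
  by rewrite lebesgue_measure_itv/= lte_fin; case: ifP; rewrite ?ltry.
Qed.

Lemma lebesgue_measure_affine e (a : R) (B : set R) : 0 < e -> measurable B ->
  lebesgue_measure ((fun t => e * t + a) @^-1` B) = (e^-1%:E * lebesgue_measure B)%E.
Proof.
move=> e0 mB.
have maff : measurable_fun [set: R] (fun t : measurableTypeR R => e * t + a : measurableTypeR R).
  by apply: measurable_funD => //; exact: measurable_funM.
pose nu := mscale (NngNum (ltW e0)) (measure_function_pushforward__canonical__measure_function_Measure
  (@lebesgue_measure R) maff).
have := @lebesgue_measure_unique R nu _ B mB.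
rewrite /nu /mscale/= /pushforward => ->.
  by rewrite muleA -EFinM mulVf ?gt_eqF// mul1e.
move=> _ [[x y] _ <-].
rewrite /mscale /= /pushforward.
rewrite [X in (_ * lebesgue_measure X)%E](_ : _ = `](e^-1 * (x - a)), (e^-1 * (y - a))]%classic); last first.
  apply/seteqP; split=> t /=; rewrite !in_itv/= ltr_pdivrMl// ler_pdivlMl//;
  by rewrite ltrBlDr lerBrDr.
rewrite !lebesgue_measure_itv/= !lte_fin ltr_pM2l ?invr_gt0// ltrD2r.
case: ifPn => _; last by rewrite mule0.
by rewrite -!EFinD -EFinM; congr EFin; rewrite -mulrBr mulrA mulfV ?gt_eqF// mul1r; ring.
Qed.

Lemma homothetyE e h x i : homothety e h x i 0 = e * x i 0 + h i 0.
Proof. by rewrite /homothety !mxE. Qed.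

Lemma measurable_homothety e h : measurable_fun [set: 'cV[R]_n] (homothety e h).
Proof.
apply: measurable_fun_mxE => i j; rewrite ord1.
under eq_fun do rewrite homothetyE.
by apply: measurable_funD => //; apply: measurable_funM => //; exact: measurable_mxE.
Qed.

(** It suffices to compare both sides on boxes, where they are products of
    one-dimensional measures. *)
Lemma lebesgue_rn_homothety e h A : 0 < e -> measurable A ->
  lebesgue_rn n (homothety e h @^-1` A) = ((e ^- n)%:E * lebesgue_rn n A)%E.
Proof.
move=> e0 mA; have en0 : 0 < e ^+ n by exact: exprn_gt0.
pose nu := mscale (NngNum (ltW en0)) (measure_function_pushforward__canonical__measure_function_Measure
  (lebesgue_rn n) (@measurable_homothety e h)).
have := @lebesgue_rn_unique nu _ A mA.
rewrite /nu /mscale/= /pushforward => <-.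
  by rewrite muleA -EFinM mulVf ?gt_eqF// mul1e.
move=> B mB; rewrite /mscale /= /pushforward.
have -> : homothety e h @^-1` box B = box (fun i => (fun t => e * t + h i 0) @^-1` B i).
  by apply/seteqP; split=> x xB i; have := xB i; rewrite /= homothetyE.
rewrite !lebesgue_rn_box//; last first.
  move=> i; rewrite -[X in measurable X]setTI.
  by apply: measurable_funD => //; exact: measurable_funM.
under eq_bigr do rewrite lebesgue_measure_affine//.
rewrite big_split/= prodEFin prodr_const card_ord muleA -EFinM exprVn mulfV ?mul1e//.
by rewrite gt_eqF.
Qed.

Lemma measurable_homothety_preimage e h A :
  measurable A -> measurable (homothety e h @^-1` A).
Proof.
by move=> mA; rewrite -[X in measurable X]setTI; exact: (@measurable_homothety e h).
Qed.

Lemma ge0_integral_homothety e h (E : set 'cV[R]_n) (f : 'cV[R]_n -> \bar R) :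
  0 < e -> measurable E -> measurable_fun E f -> (forall x, 0 <= f x)%E ->
  (\int[lebesgue_rn n]_(x in homothety e h @^-1` E) f (homothety e h x) =
   (e ^- n)%:E * \int[lebesgue_rn n]_(x in E) f x)%E.
Proof.
move=> e0 mE mf f0; have en0 : 0 < e ^- n by rewrite invr_gt0 exprn_gt0.
rewrite -(@ge0_integral_pushforward _ _ _ _ _ _ (@measurable_homothety e h) (lebesgue_rn n) E f)//.
rewrite -[X in (X%:E * _)%E]/((NngNum (ltW en0))%:num) -ge0_integral_mscale//.
pose nu := measure_function_pushforward__canonical__measure_function_Measure
  (lebesgue_rn n) (@measurable_homothety e h).
rewrite -[LHS]/(\int[nu]_(x in E) f x)%E.
apply: eq_measure_integral => A mA _; exact: lebesgue_rn_homothety.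
Qed.

Lemma integral_homothety e h (f : 'cV[R]_n -> \bar R) :
  0 < e -> measurable_fun [set: _] f ->
  (\int[lebesgue_rn n]_x f (homothety e h x) =
   (e ^- n)%:E * \int[lebesgue_rn n]_x f x)%E.
Proof.
move=> e0 mf; rewrite integralE [in RHS]integralE.
have en0 : 0 < e ^- n by rewrite invr_gt0 exprn_gt0.
have := @ge0_integral_homothety e h setT (f^\+)%E e0 measurableT.
rewrite preimage_setT => fp.
have := @ge0_integral_homothety e h setT (f^\-)%E e0 measurableT.
rewrite preimage_setT => fn.
rewrite -[X in integral _ _ (X^\+)%E]/(f \o homothety e h) -[X in integral _ _ (X^\-)%E]/(f \o homothety e h).
rewrite funepos_comp funeneg_comp /=.
rewrite fp ?fn//; [|exact: measurable_funeneg|exact: measurable_funepos].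
have P0 : (0 <= \int[lebesgue_rn n]_x (f^\+ x))%E by exact: integral_ge0.
have N0 : (0 <= \int[lebesgue_rn n]_x (f^\- x))%E by exact: integral_ge0.
have dist (a b : \bar R) : (0 <= a -> 0 <= b ->
    (e ^- n)%:E * a - (e ^- n)%:E * b = (e ^- n)%:E * (a - b))%E.
  case: a b => [a| |] [b| |] //= _ _.
  - by congr EFin; rewrite mulrBr.
  - by rewrite mulry gtr0_sg// mul1e mulrNy gtr0_sg// mul1e.
  - by rewrite mulry gtr0_sg// mul1e.
  - by rewrite mulry gtr0_sg// mul1e mulrNy gtr0_sg// mul1e.
exact: dist.
Qed.

Lemma Rintegral_homothety e h (f : 'cV[R]_n -> R) :
  0 < e -> measurable_fun [set: _] f ->
  \int[lebesgue_rn n]_x f (homothety e h x) = e ^- n * \int[lebesgue_rn n]_x f x.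
Proof.
move=> e0 mf; rewrite /Rintegral (@integral_homothety e h (EFin \o f))//; last exact/measurable_EFinP.
have en0 : 0 < e ^- n by rewrite invr_gt0 exprn_gt0.
case: (\int[_]_x _)%E => [r| |]//=.
  by rewrite mulry gtr0_sg// mul1e mulr0.
by rewrite mulrNy gtr0_sg// mul1e mulr0.
Qed.

End lebesgue_columns.

(** * Cubes and homotheties *)

Section mx_topology.
Context {R : realType} {m n : nat}.
Implicit Types A B : 'M[R]_(m, n).

Lemma entry_le_norm A i j : `|A i j| <= `|A|.
Proof. by rewrite [leRHS]/Num.norm /= mx_normrE; apply: (le_bigmax _ _ (i, j)). Qed.

Lemma norm_le_entries A c : 0 <= c -> (forall i j, `|A i j| <= c) -> `|A| <= c.
Proof.
by move=> c0 Ac; rewrite [leLHS]/Num.norm /= mx_normrE; apply/bigmax_leP; split.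
Qed.

Lemma cvg_mxE (T : Type) (F : set_system T) {FF : Filter F} (f : T -> 'M[R]_(m, n)) A :
  (forall i j, f x i j @[x --> F] --> A i j) -> f @ F --> A.
Proof.
move=> fA; apply/cvg_ballP => e e0.
have h : \forall x \near F, forall i j, ball (A i j) e (f x i j).
  apply: filter_forall => i; apply: filter_forall => j.
  by have /cvg_ballP/(_ e e0) := fA i j.
by apply: filterS h => x fx; split.
Qed.

Lemma continuous_mxE (T : topologicalType) (f : T -> 'M[R]_(m, n)) :
  (forall i j, continuous (fun x => f x i j)) -> continuous f.
Proof.
by move=> fc x; apply: (@cvg_mxE _ (nbhs x) (nbhs_filter x)) => i j; exact: fc.
Qed.

(** Heine-Borel for row vectors, transported through [vec_mx]. *)
Lemma mx_bounded_closed_compact (X : set 'M[R]_(m, n)) :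
  bounded_set X -> closed X -> compact X.
Proof.
move=> [M [Mreal XM]] Xcl.
have cM : compact [set v : 'rV[R]_(m * n) | forall i, `[- (M + 1), M + 1]%classic (v ord0 i)].
  by apply: (@rV_compact _ _ (fun=> `[- (M + 1), M + 1]%classic)) => _; exact: segment_compact.
have cvec : continuous (@vec_mx R m n).
  apply: continuous_mxE => i j.
  by under eq_fun do rewrite mxE; exact: coord_continuous.
have := continuous_compact (continuous_subspaceT cvec) cM.
move=> /(subclosed_compact Xcl); apply => A XA.
have AM : `|A| <= M + 1 by apply: XM => //; rewrite ltrDl.
exists (mxvec A); last exact: mxvecK.
move=> k /=; case/mxvec_indexP: k => i j; rewrite mxvecE in_itv/= -ler_norml.
exact: le_trans (entry_le_norm _ _ _) AM.
Qed.

End mx_topology.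

Section cubes.
Context {R : realType} {n : nat}.
Implicit Types (h x c : 'cV[R]_n) (e r : R) (A E : set 'cV[R]_n).

Lemma homothetyK e h : 0 < e -> cancel (homothety e h) (homothety e^-1 (- (e^-1 *: h))).
Proof.
move=> e0 x; rewrite /homothety scalerDr scalerA mulVf ?gt_eqF// scale1r.
by rewrite addrK.
Qed.

Lemma homothetyVK e h : 0 < e -> cancel (homothety e^-1 (- (e^-1 *: h))) (homothety e h).
Proof.
move=> e0 x; rewrite /homothety scalerDr scalerN !scalerA mulfV ?gt_eqF// !scale1r.
by rewrite subrK.
Qed.

Lemma homothety_image e h A : 0 < e ->
  homothety e h @` A = homothety e^-1 (- (e^-1 *: h)) @^-1` A.
Proof.
move=> e0; apply/seteqP; split=> [_ [x Ax <-] /=|x /= Ax].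
  by rewrite homothetyK.
by exists (homothety e^-1 (- (e^-1 *: h)) x) => //; rewrite homothetyVK.
Qed.

Lemma homothety_preimage_image e h A : 0 < e ->
  homothety e h @^-1` (homothety e h @` A) = A.
Proof.
move=> e0; apply/seteqP; split=> [x [y Ay /(can_inj (homothetyK h e0)) <-]//|x Ax].
by exists x.
Qed.

Lemma homothety_comp e h r c :
  homothety e h \o homothety r c = homothety (e * r) (e *: c + h).
Proof. by apply/funext => x; rewrite /homothety/= scalerDr scalerA addrA. Qed.

Lemma homothety_image_comp e h r c A :
  homothety e h @` (homothety r c @` A) = homothety (e * r) (e *: c + h) @` A.
Proof. by rewrite image_comp homothety_comp. Qed.

Lemma homothety10 : homothety 1 0 = id :> ('cV[R]_n -> 'cV[R]_n).
Proof. by apply/funext => x; rewrite /homothety scale1r addr0. Qed.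

Lemma homothety_continuous e h : continuous (homothety e h).
Proof.
apply: continuous_mxE => i j; rewrite ord1; under eq_fun do rewrite homothetyE.
move=> x; apply: (@continuousD R R^o 'cV[R]_n); last exact: cst_continuous.
by apply: continuousM; [exact: cst_continuous|exact: coord_continuous].
Qed.

Lemma open_homothety e h A : 0 < e -> open A -> open (homothety e h @` A).
Proof.
move=> e0 oA; rewrite homothety_image//; apply: open_comp => // x _.
exact: homothety_continuous.
Qed.

Definition cube e c : set 'cV[R]_n := homothety e c @` Q.

Lemma in_cube e c x : 0 < e -> cube e c x <-> forall i, `|x i 0 - c i 0| < e / 2.
Proof.
move=> e0; rewrite /cube homothety_image//= /Q /=.
have E i : (- 2^-1 < homothety e^-1 (- (e^-1 *: c)) x i 0 < 2^-1) = (`|x i 0 - c i 0| < e / 2).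
  rewrite homothetyE !mxE -mulrBr -ltr_norml normrM (gtr0_norm (_ : 0 < e^-1)) ?invr_gt0//.
  by rewrite ltr_pdivrMl.
by split=> h i; have := h i; rewrite E.
Qed.

Lemma cube_box e c : 0 < e ->
  cube e c = box (fun i => `](c i 0 - e / 2), (c i 0 + e / 2)[%classic).
Proof.
move=> e0; apply/seteqP; split=> x.
  by move=> /(in_cube c x e0) xc i /=; rewrite in_itv/= -ltr_distl.
by move=> xc; apply/in_cube => // i; have := xc i; rewrite /= in_itv/= -ltr_distl.
Qed.

Lemma open_box (B : 'I_n -> set R) : (forall i, open (B i)) -> open (box B).
Proof.
move=> oB; rewrite openE => x xB.
have h i : nbhs x ((fun y : 'cV[R]_n => y i 0) @^-1` B i).
  apply: (@coord_continuous _ _ _ i 0 x); apply: open_nbhs_nbhs; split; [exact: oB|exact: xB].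
exact: (@filter_forall _ _ (fun i (y : 'cV[R]_n) => B i (y i 0)) (nbhs x) (nbhs_filter x) h).
Qed.

Lemma open_cube e c : 0 < e -> open (cube e c).
Proof. by move=> e0; rewrite cube_box//; apply: open_box => i; exact: interval_open. Qed.

Lemma measurable_cube e c : 0 < e -> measurable (cube e c).
Proof. by move=> e0; apply: mx_open_measurable; exact: open_cube. Qed.

Lemma lebesgue_rn_cube e c : 0 < e -> lebesgue_rn n (cube e c) = (e ^+ n)%:E.
Proof.
move=> e0; rewrite cube_box// lebesgue_rn_box//.
under eq_bigr => i _.
  rewrite lebesgue_measure_itv/= lte_fin ifT; last by rewrite ltrD2l gtrN// divr_gt0.
  rewrite -EFinD (_ : _ - _ = e); last by rewrite opprB addrC addrA subrK -splitr.
  over.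
by rewrite prodEFin prodr_const card_ord.
Qed.

Lemma Q_cube : Q = cube 1 0 :> set 'cV[R]_n.
Proof. by rewrite /cube homothety10 image_id. Qed.

Lemma center_cube e c : 0 < e -> cube e c c.
Proof. by move=> e0; apply/in_cube => // i; rewrite subrr normr0 divr_gt0. Qed.

Lemma ball_cube x e : 0 < e -> ball x e = cube (2 * e) x.
Proof.
move=> e0; have e20 : 0 < 2 * e by rewrite mulr_gt0.
have e2 : 2 * e / 2 = e by rewrite mulrAC mulfV ?mul1r.
apply/seteqP; split=> y.
  move=> [_ xy]; apply/in_cube => // i; rewrite e2 distrC.
  by have := xy i 0; rewrite -ball_normE.
move=> /(in_cube x y e20) xy; split=> // i j; rewrite ord1.
by have := xy i; rewrite e2 distrC -ball_normE.
Qed.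

Lemma open_cube_sub A x : open A -> A x -> exists2 e, 0 < e & cube e x `<=` A.
Proof.
move=> oA Ax; have /nbhs_ballP[e /= e0 eA] : nbhs x A by exact: open_nbhs_nbhs.
by exists (2 * e); [rewrite mulr_gt0|rewrite -ball_cube].
Qed.

Lemma bounded_cube_sub A : bounded_set A -> exists2 e, 0 < e & A `<=` cube e 0.
Proof.
move=> [M [Mreal AM]]; pose L := `|M| + 1.
have L0 : 0 < L by rewrite ltr_wpDl.
have ML : M < L by rewrite (le_lt_trans (ler_norm M))// ltrDl.
exists (4 * L); first by rewrite mulr_gt0.
move=> x Ax; apply/in_cube => [|i]; first by rewrite mulr_gt0.
rewrite mxE subr0 (le_lt_trans (entry_le_norm _ _ _))//.
by rewrite (le_lt_trans (AM L ML _ Ax))//; lra.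
Qed.

Lemma bounded_set_cube e c : bounded_set (cube e c).
Proof.
exists (`|e| + `|c|); split; first exact: num_real.
move=> M eM _ [x Qx <-]; rewrite /= /homothety (le_trans (ler_normD _ _))//.
rewrite (le_trans _ (ltW eM))// lerD2r normrZ ler_piMr//.
apply: norm_le_entries => // i j; rewrite ord1.
have := Qx i; rewrite -ltr_norml => /ltW /le_trans; apply.
by rewrite invf_le1// ler1n.
Qed.

Lemma bounded_lebesgue_rn_lty A : measurable A -> bounded_set A ->
  (lebesgue_rn n A < +oo)%E.
Proof.
move=> mA /bounded_cube_sub[e e0 Ae].
apply: (@le_lt_trans _ _ (lebesgue_rn n (cube e 0))).
  by apply: le_measure => //; rewrite inE//; exact: measurable_cube.
by rewrite lebesgue_rn_cube// ltry.
Qed.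

Lemma mx_compact_measurable A : compact A -> measurable A.
Proof.
move=> cA; rewrite -(setCK A); apply: measurableC; apply: mx_open_measurable.
rewrite openC; apply: compact_closed => //; exact: norm_hausdorff.
Qed.

Lemma open_lebesgue_rn_gt0 A : open A -> A !=set0 -> (0 < lebesgue_rn n A)%E.
Proof.
move=> oA [x Ax]; have [e e0 eA] := open_cube_sub oA Ax.
apply: (@lt_le_trans _ _ (lebesgue_rn n (cube e x))).
  by rewrite lebesgue_rn_cube// lte_fin exprn_gt0.
apply: le_measure => //; rewrite inE; [exact: measurable_cube|exact: mx_open_measurable].
Qed.

Lemma bounded_homothety e h A : bounded_set A -> bounded_set (homothety e h @` A).
Proof.
move=> [M [Mr AM]]; exists (`|e| * (`|M| + 1) + `|h|); split; first exact: num_real.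
move=> K MK _ [x Ax <-]; rewrite /= /homothety (le_trans _ (ltW MK))// (le_trans (ler_normD _ _))//.
rewrite lerD2r normrZ ler_wpM2l// AM//.
by rewrite (le_lt_trans (ler_norm M))// ltrDl.
Qed.

Lemma closed_cube_compact e c : compact (closure (cube e c)).
Proof.
apply: mx_bounded_closed_compact; last exact: closed_closure.
have [M [Mr cM]] := bounded_set_cube e c.
exists M; split => // K MK x.
have cl : closed [set y : 'cV[R]_n | `|y| <= K].
  have -> : [set y : 'cV[R]_n | `|y| <= K] = Num.norm @^-1` [set r | r <= K] by [].
  by apply: closed_comp => [y _|]; [exact: norm_continuous|exact: closed_le].
move=> xc; suff : closure [set y : 'cV[R]_n | `|y| <= K] x by rewrite -(closure_id _).1.
by apply: closureS xc => y; exact: cM.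
Qed.

End cubes.

(** * The [p]-energy of a matrix field *)

Section pmass.
Context {R : realType} {n : nat}.
Implicit Types (p c : R) (E : set 'cV[R]_n).

Lemma measurable_fun_entry {E k l} (f : 'cV[R]_n -> 'M[R]_(k, l)) i j :
  measurable E -> measurable_fun E f -> measurable_fun E (fun x => f x i j).
Proof.
move=> mE mf; exact: (measurableT_comp (measurable_mxE i j) mf).
Qed.

Lemma continuous_measurable_mx {k l k' l'} (f : 'M[R]_(k, l) -> 'M[R]_(k', l')) :
  continuous f -> measurable_fun [set: _] f.
Proof.
move=> cf; apply: (measurability [set U : set 'M[R]_(k', l') | open U]) => //.
move=> _ [U oU <-]; rewrite setTI; apply: mx_open_measurable.
by apply: open_comp => // x _; exact: cf.
Qed.

Lemma continuous_measurable_mxR {k l} (f : 'M[R]_(k, l) -> R) :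
  continuous f -> measurable_fun [set: _] f.
Proof.
move=> cf; apply: (measurability _ (RGenOpens.measurableE R)) => //.
move=> _ [_ [a [b ->]] <-]; rewrite setTI; apply: mx_open_measurable.
apply: open_comp => [x _|]; first exact: cf.
exact: interval_open.
Qed.

Lemma measurable_opnorm {k l} : measurable_fun [set: 'M[R]_(k, l)] (@opnorm R k l).
Proof. by apply: continuous_measurable_mxR; exact: opnorm_continuous. Qed.

(** The sum is at most twice the larger term. *)
Lemma powRD_le p (a b : R) : 0 <= p -> 0 <= a -> 0 <= b ->
  (a + b) `^ p <= 2 `^ p * (a `^ p + b `^ p).
Proof.
move=> p0; wlog ab : a b / a <= b => [H a0 b0|a0 b0].
  have [|/ltW] := leP a b; first by move=> ab; exact: H.
  by move=> ba; rewrite addrC [X in _ <= _ * X]addrC; exact: H.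
rewrite (@le_trans _ _ ((2 * b) `^ p))//.
  by apply: ge0_ler_powR; rewrite ?nnegrE ?addr_ge0 ?mulr_ge0// mulr_natl mulr2n lerD2r.
by rewrite powRM// ler_wpM2l ?powR_ge0// lerDr powR_ge0.
Qed.

Lemma powR_le_id p (a : R) : 1 <= p -> 0 <= a -> a <= 1 -> a `^ p <= a.
Proof.
move=> p1 a0 a1; have pgt0 : 0 < p by exact: lt_le_trans p1.
rewrite -[leRHS]powRr1//.
have [->|a0'] := eqVneq a 0; first by rewrite !powR0 ?gt_eqF.
rewrite /powR (negbTE a0') ler_expR; apply: ler_wnM2r; last exact: p1.
exact: ln_le0.
Qed.

Section fields.
Context {k l : nat}.
Implicit Types f g : 'cV[R]_n -> 'M[R]_(k, l).

Definition pmass p E f : \bar R :=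
  (\int[lebesgue_rn n]_(x in E) (opnorm (f x) `^ p)%:E)%E.

Lemma pmass_ge0 p E f : (0 <= pmass p E f)%E.
Proof. by apply: integral_ge0 => x _; rewrite lee_fin powR_ge0. Qed.

Lemma measurable_pmass p {E} f : measurable E -> measurable_fun E f ->
  measurable_fun E (fun x => (opnorm (f x) `^ p)%:E).
Proof.
move=> mE mf; apply/measurable_EFinP; apply: (measurableT_comp (measurable_powR p)).
exact: (measurableT_comp measurable_opnorm mf).
Qed.

Hint Resolve measurable_pmass : core.

Lemma subset_pmass p (A E : set 'cV[R]_n) f : measurable A -> measurable E ->
  measurable_fun E f -> A `<=` E -> (pmass p A f <= pmass p E f)%E.
Proof.
move=> mA mE mf AE; apply: ge0_subset_integral => //; first exact: measurable_pmass.
by move=> x _; rewrite lee_fin powR_ge0.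
Qed.

Lemma measurable_mxD f g : measurable_fun [set: _] f -> measurable_fun [set: _] g ->
  measurable_fun [set: _] (fun x => f x + g x).
Proof.
move=> mf mg; apply: measurable_fun_mxE => i j; under eq_fun do rewrite mxE.
by apply: measurable_funD; exact: measurable_fun_entry.
Qed.

Lemma measurable_mxZ c f : measurable_fun [set: _] f ->
  measurable_fun [set: _] (fun x => c *: f x).
Proof.
move=> mf; apply: measurable_fun_mxE => i j; under eq_fun do rewrite mxE.
by apply: measurable_funM => //; exact: measurable_fun_entry.
Qed.

Lemma pmass_bounded p E f M : 0 <= p -> measurable E -> measurable_fun E f ->
  (forall x, E x -> opnorm (f x) <= M) ->
  (pmass p E f <= (M `^ p)%:E * lebesgue_rn n E)%E.
Proof.
move=> p0 mE mf fM; have [->|/set0P[x Ex]] := eqVneq E set0.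
  by rewrite /pmass integral_set0 measure0 mule0.
have M0 : 0 <= M by rewrite (le_trans (opnorm_ge0 (f x)))// fM.
have <- : (\int[lebesgue_rn n]_(x in E) (cst (M `^ p)%:E) x = (M `^ p)%:E * lebesgue_rn n E)%E.
  exact: integral_cst.
rewrite /pmass; apply: ge0_le_integral; first exact: mE.
- by move=> y _; rewrite lee_fin powR_ge0.
- exact: measurable_pmass.
- exact: measurable_cst.
- move=> y Ey; rewrite lee_fin; apply: ge0_ler_powR => //; rewrite ?nnegrE ?opnorm_ge0//.
  exact: fM.
Qed.

Lemma pmassD p E f g : 0 <= p -> measurable E ->
  measurable_fun [set: _] f -> measurable_fun [set: _] g ->
  (pmass p E (fun x => f x + g x)%R <= (2 `^ p)%:E * (pmass p E f + pmass p E g))%E.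
Proof.
move=> p0 mE mf mg.
have mfE : measurable_fun E f by exact: measurable_funTS.
have mgE : measurable_fun E g by exact: measurable_funTS.
rewrite /pmass -ge0_integralD//; try exact: measurable_pmass; last 2 first.
  by move=> x _; rewrite lee_fin powR_ge0.
  by move=> x _; rewrite lee_fin powR_ge0.
rewrite -ge0_integralZl ?lee_fin ?powR_ge0//; last 2 first.
- exact: emeasurable_funD (measurable_pmass p mE mfE) (measurable_pmass p mE mgE).
- by move=> x _; rewrite -EFinD lee_fin addr_ge0// powR_ge0.
apply: ge0_le_integral => //.
- by move=> y _; rewrite lee_fin powR_ge0.
- by apply: measurable_pmass => //; apply: measurable_funTS; exact: measurable_mxD.
- apply: measurable_funeM; exact: emeasurable_funD (measurable_pmass p mE mfE) (measurable_pmass p mE mgE).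
- move=> x _; rewrite -EFinD -EFinM lee_fin.
  apply: le_trans (powRD_le p0 (opnorm_ge0 _) (opnorm_ge0 _)).
  by apply: ge0_ler_powR => //; rewrite ?nnegrE ?addr_ge0 ?opnorm_ge0// opnormD.
Qed.

Lemma pmass_homothety p E f e h : 0 < e -> measurable E ->
  measurable_fun [set: _] f ->
  pmass p E (f \o homothety e h) = ((e ^- n)%:E * pmass p (homothety e h @` E) f)%E.
Proof.
move=> e0 mE mf; rewrite /pmass.
rewrite -{1}(@homothety_preimage_image _ _ e h E e0).
have mE' : measurable (homothety e h @` E).
  by rewrite homothety_image//; exact: measurable_homothety_preimage.
rewrite -(@ge0_integral_homothety _ _ e h)//; first by apply: measurable_pmass => //; exact: measurable_funTS.
by move=> x; rewrite lee_fin powR_ge0.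
Qed.

End fields.

Lemma pmass_le {k l k' l'} p E (f : 'cV[R]_n -> 'M[R]_(k, l))
    (g : 'cV[R]_n -> 'M[R]_(k', l')) K : 0 <= p -> 0 <= K -> measurable E ->
  measurable_fun E f -> measurable_fun E g ->
  (forall x, E x -> opnorm (f x) <= K * opnorm (g x)) ->
  (pmass p E f <= (K `^ p)%:E * pmass p E g)%E.
Proof.
move=> p0 K0 mE mf mg fg; rewrite /pmass -ge0_integralZl ?lee_fin ?powR_ge0//; last 2 first.
- exact: measurable_pmass.
- by move=> x _; rewrite lee_fin powR_ge0.
apply: ge0_le_integral => //.
- by move=> y _; rewrite lee_fin powR_ge0.
- exact: measurable_pmass.
- by apply: measurable_funeM; exact: measurable_pmass.
- move=> x Ex; rewrite -EFinM lee_fin -powRM ?opnorm_ge0//.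
  by apply: ge0_ler_powR; rewrite ?nnegrE ?mulr_ge0 ?opnorm_ge0// fg.
Qed.

Section lploc.
Context {k l : nat}.
Implicit Types f g : 'cV[R]_n -> 'M[R]_(k, l).

(** The space is a countable union of compact cubes. *)
Lemma Lploc_measurable p f : in_Lploc p setT f -> measurable_fun [set: _] f.
Proof.
move=> lf; have cover : \bigcup_i closure (cube i.+1%:R 0) = [set: 'cV[R]_n].
  apply/seteqP; split=> // x _.
  have bx : bounded_set [set x].
    by exists `|x|; split; [exact: num_real|move=> M xM _ ->; exact: ltW].
  have [e e0 xe] := bounded_cube_sub bx.
  exists (Num.truncn e) => //; apply: subset_closure; apply/in_cube => // i.
  have /in_cube/(_ i) : cube e 0 x by exact: xe.
  move=> /(_ e0) /lt_trans; apply; rewrite ltr_pM2r//; exact: truncnS_gt.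
rewrite -cover; apply/measurable_fun_bigcup => [i|i].
  by apply: mx_compact_measurable; exact: closed_cube_compact.
by have [] := lf _ (@closed_cube_compact R n i.+1%:R 0).
Qed.

Lemma bounded_sub_compact E : bounded_set E -> exists2 K, compact K & E `<=` K.
Proof.
move=> /bounded_cube_sub[e e0 Ee]; exists (closure (cube e 0)).
  exact: closed_cube_compact.
by apply: subset_trans Ee _; exact: subset_closure.
Qed.

Lemma Lploc_pmass p f E : in_Lploc p setT f -> bounded_set E -> measurable E ->
  (pmass p E f < +oo)%E.
Proof.
move=> lf /bounded_sub_compact[K cK EK] mE; have [mf] := lf K cK (@subsetT _ _).
apply: le_lt_trans; apply: subset_pmass => //; exact: mx_compact_measurable.
Qed.

Lemma LplocI p f : measurable_fun [set: _] f ->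
  (forall K, compact K -> (pmass p K f < +oo)%E) -> in_Lploc p setT f.
Proof.
move=> mf fK K cK _; split; last exact: fK.
exact: measurable_funTS.
Qed.

Lemma LplocD p f g : 0 <= p -> in_Lploc p setT f -> in_Lploc p setT g ->
  in_Lploc p setT (fun x => f x + g x).
Proof.
move=> p0 lf lg; have mf := Lploc_measurable lf; have mg := Lploc_measurable lg.
apply: LplocI => [|K cK]; first exact: measurable_mxD.
have [_ fK] := lf K cK (@subsetT _ _); have [_ gK] := lg K cK (@subsetT _ _).
apply: le_lt_trans (pmassD p0 (mx_compact_measurable cK) mf mg) _.
apply: lte_mul_pinfty; [by rewrite lee_fin powR_ge0|by []|].
exact: (lte_add_pinfty fK gK).
Qed.

Lemma LplocZ p c f : 0 <= p -> in_Lploc p setT f ->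
  in_Lploc p setT (fun x => c *: f x).
Proof.
move=> p0 lf; have mf := Lploc_measurable lf.
apply: LplocI => [|K cK]; first exact: measurable_mxZ.
have [_ fK] := lf K cK (@subsetT _ _).
apply: (@le_lt_trans _ _ ((`|c| `^ p)%:E * pmass p K f)%E).
  apply: pmass_le => //; first exact: mx_compact_measurable.
  - by apply: measurable_funTS; exact: measurable_mxZ.
  - exact: measurable_funTS.
  - by move=> x _; rewrite opnormZ.
apply: lte_mul_pinfty; [by rewrite lee_fin powR_ge0|by []|exact: fK].
Qed.

Lemma Lploc_continuous p f : 0 <= p -> continuous f -> in_Lploc p setT f.
Proof.
move=> p0 cf; have mf := continuous_measurable_mx cf.
apply: LplocI => // K cK.
have cof : continuous (@opnorm R k l \o f).
  by move=> x; apply: continuous_comp; [exact: cf|exact: opnorm_continuous].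
have := continuous_compact (continuous_subspaceT cof) cK.
move=> /compact_bounded[M [Mr fM]].
have le := @pmass_bounded k l p K f (`|M| + 1) p0 (mx_compact_measurable cK).
apply: le_lt_trans (le _ _) _.
- exact: measurable_funTS.
- move=> x Kx; apply: le_trans (ler_norm _) _.
  apply: (fM (`|M| + 1)); last by exists x.
  by rewrite (le_lt_trans (ler_norm M))// ltrDl.
- rewrite lte_mul_pinfty ?lee_fin ?powR_ge0//.
  by apply: bounded_lebesgue_rn_lty; [exact: mx_compact_measurable|exact: compact_bounded].
Qed.

Lemma Lploc_homothety p f e h : 0 < e -> in_Lploc p setT f ->
  in_Lploc p setT (f \o homothety e h).
Proof.
move=> e0 lf; have mf := Lploc_measurable lf; apply: LplocI => [|K cK].
  exact: (measurableT_comp mf (measurable_homothety e h)).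
have mK := mx_compact_measurable cK.
rewrite pmass_homothety// lte_mul_pinfty ?lee_fin ?invr_ge0 ?exprn_ge0// ?ltW//.
apply: Lploc_pmass => //; first by apply: bounded_homothety; exact: compact_bounded.
by rewrite homothety_image//; exact: measurable_homothety_preimage.
Qed.

Lemma pmass_setT_Lploc p f : measurable_fun [set: _] f -> (pmass p setT f < +oo)%E ->
  in_Lploc p setT f.
Proof.
move=> mf fT; apply: LplocI => // K cK; apply: le_lt_trans fT.
by apply: subset_pmass => //; exact: mx_compact_measurable.
Qed.

End lploc.

Lemma linear_opnorm_bound {k l k' l'} (L : {linear 'M[R]_(k, l) -> 'M[R]_(k', l')}) :
  exists2 K, 0 <= K & forall A, opnorm (L A) <= K * opnorm A.
Proof.
exists (\sum_i \sum_j opnorm (L (delta_mx i j))).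
  by apply: sumr_ge0 => i _; apply: sumr_ge0 => j _; exact: opnorm_ge0.
move=> A; rewrite {1}(matrix_sum_delta A) linear_sum mulr_suml.
have big (I : finType) (F : I -> 'M[R]_(k', l')) : opnorm (\sum_i F i) <= \sum_i opnorm (F i).
  elim/big_ind2 : _ => [|a b c d ba dc|//]; first by rewrite opnorm0.
  exact: le_trans (opnormD _ _) (lerD ba dc).
apply: le_trans (big _ _) _; apply: ler_sum => i _.
rewrite linear_sum mulr_suml; apply: le_trans (big _ _) _; apply: ler_sum => j _.
by rewrite linearZ/= opnormZ mulrC ler_wpM2l ?opnorm_ge0// entry_le_opnorm.
Qed.

Lemma linear_mx_continuous {k l k' l'} (L : {linear 'M[R]_(k, l) -> 'M[R]_(k', l')}) :
  continuous L.
Proof.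
apply: continuous_mxE => i j.
have -> : (fun A => L A i j) = (fun A => \sum_a \sum_b A a b * L (delta_mx a b) i j).
  apply/funext => A; rewrite {1}(matrix_sum_delta A) linear_sum summxE.
  apply: eq_bigr => a _; rewrite linear_sum summxE; apply: eq_bigr => b _.
  by rewrite linearZ mxE.
have sumc (I : finType) (F : I -> 'M[R]_(k, l) -> R) :
    (forall a, continuous (F a)) -> continuous (fun A => \sum_a F a A).
  move=> Fc; apply: (@continuous_big R I +%R 0 xpredT) => [|a _]; last exact: Fc.
  exact: add_continuous.
apply: (sumc _) => a; apply: (sumc _) => b A.
by apply: (@cvgMr_tmp R _ (nbhs A) _ (fun M : 'M[R]_(k, l) => M a b) (A a b) (L (delta_mx a b) i j)); exact: (@coord_continuous R _ _ a b A).
Qed.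

Section Lploc_examples.
Context {p : R} (p1 : 1 <= p).

Let p0 : 0 <= p. Proof. exact: le_trans p1. Qed.

Lemma Lploc_id : in_Lploc p setT (fun x : 'cV[R]_n => x).
Proof. by apply: Lploc_continuous => // x; exact: cvg_id. Qed.

Lemma Lploc_mulmx {m} (A : 'M[R]_(m, n)) : in_Lploc p setT (mulmx A : 'cV[R]_n -> 'cV[R]_m).
Proof. by apply: Lploc_continuous => //; exact: linear_mx_continuous. Qed.

Lemma Lploc_cst {k l} (A : 'M[R]_(k, l)) : in_Lploc p setT (fun _ : 'cV[R]_n => A).
Proof. by apply: Lploc_continuous => //; exact: (@cst_continuous _ _ A). Qed.

End Lploc_examples.

Lemma measurable_linear {k l k' l'} (L : {linear 'M[R]_(k, l) -> 'M[R]_(k', l')}) E V :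
  measurable_fun E V -> measurable_fun E (fun x : 'cV[R]_n => L (V x)).
Proof.
move=> mV; apply: measurableT_comp mV; apply: continuous_measurable_mx.
exact: linear_mx_continuous.
Qed.

End pmass.

Section zero_extension.
Context {R : realType} {n k l : nat}.
Implicit Types (E : set 'cV[R]_n) (V : 'cV[R]_n -> 'M[R]_(k, l)).

(** Turns a field on an open set into one on the whole space, where local
    integrability and approximation by step fields are available. *)
Definition zext E V : 'cV[R]_n -> 'M[R]_(k, l) := fun x => if x \in E then V x else 0.

Lemma zextE E V x : E x -> zext E V x = V x.
Proof. by move=> Ex; rewrite /zext mem_set. Qed.

Lemma measurable_zext E V : measurable E -> measurable_fun E V ->
  measurable_fun setT (zext E V).
Proof.
move=> mE mV; apply: measurable_fun_mxE => i j.
have -> : (fun x => zext E V x i j) = (fun x => V x i j) \_ E.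
  by apply/funext => x; rewrite /zext /patch; case: ifP => // _; rewrite mxE.
by apply: (measurable_restrictT _ mE).1; exact: measurable_fun_entry.
Qed.

Lemma pmass_zext p E V : 0 < p -> pmass p setT (zext E V) = pmass p E V.
Proof.
move=> p0; rewrite /pmass [RHS]integral_mkcond; apply: eq_integral => x _.
rewrite /zext /patch; case: ifP => // _.
by rewrite opnorm0 powR0// gt_eqF.
Qed.

End zero_extension.

(** * Test functions and the operators [D_L] *)

Section test_functions.
Context {R : realType} {n : nat}.
Implicit Types (f phi : 'cV[R]_n -> R) (Om : set 'cV[R]_n) (e r t : R) (c h x : 'cV[R]_n).

Definition supp phi : set 'cV[R]_n := closure [set x | phi x != 0].

Lemma supp0 phi x : ~ supp phi x -> phi x = 0.
Proof. by apply: contra_notP => /eqP px; exact: subset_closure. Qed.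

Lemma smooth_continuous phi : smooth phi -> continuous phi.
Proof. by move=> sm; have [] := sm [::]. Qed.

Lemma smooth_derivable phi x j : smooth phi -> derivable phi x (delta_mx j 0).
Proof. by move=> sm; have [_] := sm [::]; exact. Qed.

Lemma smooth_partial phi j : smooth phi -> smooth (partial phi j).
Proof. by move=> sm s; exact: (sm (j :: s)). Qed.

Lemma partial_supp0 phi j x : ~ supp phi x -> partial phi j x = 0.
Proof.
move=> nx; rewrite /partial.
have oN : open (~` supp phi) by rewrite openC; exact: closed_closure.
have nbx : \forall y \near x, phi y = cst 0 y.
  have : nbhs x (~` supp phi) by apply: open_nbhs_nbhs.
  by apply: filterS => y /supp0.
by rewrite (near_eq_derive _ nbx) ?derive_cst//; exact/eqP/negP.
Qed.

Lemma derivable_line phi x v s : derivable phi (s *: v + x) v ->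
  is_derive s 1 (fun a : R => phi (a *: v + x)) ('D_v phi (s *: v + x)).
Proof.
move=> dphi.
have E : (fun a : R => a^-1 *: (((fun a : R => phi (a *: v + x)) \o shift s) (a *: (1 : R))
    - phi (s *: v + x))) =
    (fun a => a^-1 *: ((phi \o shift (s *: v + x)) (a *: v) - phi (s *: v + x))).
  by apply/funext => a /=; rewrite [a *: 1]mulr1 scalerDl addrA.
by apply: DeriveDef; rewrite /derivable /derive E.
Qed.

Lemma continuous_line (f : 'cV[R]_n -> R) x v : continuous f ->
  continuous (fun a : R => f (a *: v + x)).
Proof.
move=> cf a; apply: (@continuous_comp _ _ _ (fun a : R => a *: v + x) f); last exact: cf.
apply: (@continuousD R 'cV[R]_n R); last exact: cst_continuous.
exact: scalel_continuous.
Qed.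

Lemma mvt_line phi v M x t : (forall y, derivable phi y v) -> continuous phi ->
  (forall y, `|'D_v phi y| <= M) -> 0 <= t -> `|phi (t *: v + x) - phi x| <= M * t.
Proof.
move=> dphi cphi DM t0.
have [c _] := @MVT_segment R (fun a : R => phi (a *: v + x))
  (fun a => 'D_v phi (a *: v + x)) 0 t t0
  (fun s _ => derivable_line (dphi _)) (continuous_subspaceT (@continuous_line _ x v cphi)).
rewrite scale0r add0r subr0 => ->.
by rewrite normrM (ger0_norm t0) ler_wpM2r.
Qed.

Lemma cvg_dnbhs_scale r : r != 0 -> (fun a : R => r * a) @ (0 : R)^' --> (0 : R)^'.
Proof.
move=> r0 A /= A0.
have cr : {for 0, continuous (fun a : R => r * a)}.
  by apply: continuousM; [exact: cst_continuous|exact: cvg_id].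
have A0' : nbhs (r * 0) (fun y : R => y != 0 -> A y) by rewrite mulr0.
have B : nbhs (0 : R) (fun a => r * a != 0 -> A (r * a)) := cr _ A0'.
apply: (@filterS _ (nbhs (0 : R)) _ _ _ _ B) => a Ara a0.
by apply: Ara; rewrite mulf_neq0.
Qed.

Lemma is_derive_homothety phi r c x v : r != 0 -> derivable phi (homothety r c x) v ->
  is_derive x v (phi \o homothety r c) (r * 'D_v phi (homothety r c x)).
Proof.
move=> r0 dphi; set y := homothety r c x in dphi *.
pose q b : R := b^-1 *: ((phi \o shift y) (b *: v) - phi y).
have E : (fun a : R => a^-1 *: (((phi \o homothety r c) \o shift x) (a *: v)
    - (phi \o homothety r c) x)) = (fun a => r * q (r * a)).
  apply/funext => a /=; rewrite /q /=.
  have -> : homothety r c (a *: v + x) = (r * a) *: v + y.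
    by rewrite /y /homothety scalerDr scalerA addrA.
  rewrite [LHS]/GRing.scale /= [in RHS]/GRing.scale /= -/y.
  have [->|a0] := eqVneq a 0; first by rewrite mulr0 invr0 !mul0r mulr0.
  by rewrite mulrA invfM mulrA mulfV// mul1r.
have qc : q @ 0^' --> 'D_v phi y by exact: dphi.
have rq : (fun a => r * q (r * a)) @ 0^' --> r * 'D_v phi y.
  apply: (@cvgMl_tmp R _ _ _ (fun a => q (r * a))).
  exact: cvg_trans (cvg_app q (cvg_dnbhs_scale r0)) qc.
apply: DeriveDef; first by rewrite /derivable E; apply/cvg_ex; exists (r * 'D_v phi y).
by rewrite /derive E; apply/cvg_lim.
Qed.

Lemma is_derive_homothetyZ phi a r c x v : r != 0 -> derivable phi (homothety r c x) v ->
  is_derive x v (fun x => a * phi (homothety r c x)) (a * (r * 'D_v phi (homothety r c x))).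
Proof.
move=> r0 dphi; have h := is_derive_homothety r0 dphi.
exact: (@is_deriveZ R _ _ (phi \o homothety r c) a _ _ _ h).
Qed.

(** Every iterated partial derivative of [phi \o homothety r c] is the one of
    [phi], composed with the homothety, times a power of [r]. *)
Lemma smooth_homothety phi r c : r != 0 -> smooth phi -> smooth (phi \o homothety r c).
Proof.
move=> r0 sm s.
have E : forall s (f : 'cV[R]_n -> R) a, smooth f ->
    foldl partial (fun x => a * f (homothety r c x)) s =
    (fun x => a * r ^+ size s * foldl partial f s (homothety r c x)).
  elim=> [f a _|j s' IH f a smf] /=; first by rewrite expr0 mulr1.
  rewrite (_ : partial _ _ = fun x => (a * r) * partial f j (homothety r c x)).
    by rewrite IH; [rewrite exprS mulrA|exact: smooth_partial].
  apply/funext => x; have [_ De] := is_derive_homothetyZ a r0 (@smooth_derivable f (homothety r c x) j smf).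
  by rewrite /partial De mulrA.
have -> : phi \o homothety r c = (fun x => 1 * phi (homothety r c x)).
  by apply/funext => x; rewrite mul1r.
rewrite E//=; have [ct dr] := sm s; split.
  move=> x; apply: (@continuousM R _ (cst (1 * r ^+ size s)) (foldl partial phi s \o homothety r c)).
    exact: cst_continuous.
  by apply: continuous_comp; [exact: homothety_continuous|exact: ct].
move=> x j; have [] := is_derive_homothetyZ (1 * r ^+ size s) r0 (dr (homothety r c x) j).
by [].
Qed.

Lemma supp_homothety phi e h : 0 < e ->
  supp (phi \o homothety e^-1 (- (e^-1 *: h))) = homothety e h @` supp phi.
Proof.
move=> e0; rewrite homothety_image//.
apply/seteqP; split=> x.
  move=> xs A nA.
  have : nbhs x (homothety e^-1 (- (e^-1 *: h)) @^-1` A) by exact: homothety_continuous.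
  by move=> /xs[y [ys yA]]; exists (homothety e^-1 (- (e^-1 *: h)) y).
move=> xs A nA.
have : nbhs (homothety e^-1 (- (e^-1 *: h)) x) (homothety e h @^-1` A).
  by apply: homothety_continuous; rewrite homothetyVK.
move=> /xs[y [/= ys yA]]; exists (homothety e h y); split=> //=.
by rewrite homothetyK.
Qed.

Lemma test_homothety Om phi e h : 0 < e -> test_function Om phi ->
  test_function (homothety e h @` Om) (phi \o homothety e^-1 (- (e^-1 *: h))).
Proof.
move=> e0 [sm cs sO]; rewrite /test_function -/(supp _) supp_homothety//; split.
- by apply: smooth_homothety => //; rewrite invr_neq0// gt_eqF.
- apply: continuous_compact => //; apply: continuous_subspaceT; exact: homothety_continuous.
- exact: image_subset.
Qed.

Lemma test_sub Om Om' phi : Om `<=` Om' -> test_function Om phi -> test_function Om' phi.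
Proof. by move=> OO' [sm cs sO]; split=> //; exact: subset_trans OO'. Qed.

Lemma compact_support_bounded (f : 'cV[R]_n -> R) K : compact K -> continuous f ->
  (forall x, ~ K x -> f x = 0) -> exists2 M, 0 <= M & forall x, `|f x| <= M.
Proof.
move=> cK cf f0.
have := continuous_compact (continuous_subspaceT cf) cK.
move=> /compact_bounded[M [Mr fM]]; exists (`|M| + 1); first by rewrite addr_ge0.
move=> x; have [Kx|/f0 ->] := pselect (K x); last by rewrite normr0 addr_ge0.
apply: (fM (`|M| + 1)); last by exists x.
by rewrite (le_lt_trans (ler_norm M))// ltrDl.
Qed.

End test_functions.

Section distributions.
Context {R : realType} {n : nat}.
Local Notation mu := (lebesgue_rn n).
Implicit Types (f g phi : 'cV[R]_n -> R) (Om D : set 'cV[R]_n) (p e : R) (h : 'cV[R]_n).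

Lemma integrable_bigsum (I : Type) (s : seq I) (F : I -> 'cV[R]_n -> R) :
  (forall i, mu.-integrable setT (EFin \o F i)) ->
  mu.-integrable setT (EFin \o (fun x => \sum_(i <- s) F i x)).
Proof.
move=> iF; rewrite (_ : EFin \o _ = fun x => (\sum_(i <- s) (F i x)%:E)%E).
  by apply: integrable_sum => // i _; exact: iF.
by apply/funext => x /=; rewrite sumEFin.
Qed.

Lemma Rintegral_bigsum (I : Type) (s : seq I) (F : I -> 'cV[R]_n -> R) :
  (forall i, mu.-integrable setT (EFin \o F i)) ->
  \int[mu]_x (\sum_(i <- s) F i x) = \sum_(i <- s) \int[mu]_x F i x.
Proof.
move=> iF; elim: s => [|a s IH].
  by rewrite big_nil; under eq_Rintegral do rewrite big_nil; rewrite Rintegral_cst// mul0r.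
rewrite big_cons -IH -RintegralD//; last exact: integrable_bigsum.
by under eq_Rintegral do rewrite big_cons.
Qed.

Lemma le1D_powR (a p : R) : 0 <= a -> 1 <= p -> a <= 1 + a `^ p.
Proof.
move=> a0 p1; have [a1|/ltW a1] := leP a 1; first by rewrite (le_trans a1)// lerDl powR_ge0.
by have := ler_powR a1 p1; rewrite powRr1// => /le_trans; apply; rewrite lerDr.
Qed.

Lemma integrable_pmass {k l} p E (F : 'cV[R]_n -> 'M[R]_(k, l)) :
  measurable E -> measurable_fun E F -> (pmass p E F < +oo)%E ->
  mu.-integrable E (fun x => (opnorm (F x) `^ p)%:E).
Proof.
move=> mE mF Foo; apply/integrableP; split; first exact: measurable_pmass.
by under eq_integral do rewrite gee0_abs ?lee_fin ?powR_ge0//.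
Qed.

(** On the support of [g] an entry of [F] is at most [1 + opnorm F ^ p], and
    [g] is bounded. *)
Lemma integrable_test {k l} p K (F : 'cV[R]_n -> 'M[R]_(k, l)) g i j : 1 <= p ->
  compact K -> in_Lploc p setT F -> continuous g ->
  (forall x, ~ K x -> g x = 0) ->
  mu.-integrable setT (fun x => (F x i j * g x)%:E).
Proof.
move=> p1 cK lF cg g0; have mF := Lploc_measurable lF.
have mK := mx_compact_measurable cK.
have [M M0 gM] := compact_support_bounded cK cg g0.
have FK : (pmass p K F < +oo)%E by apply: Lploc_pmass => //; exact: compact_bounded.
have E : (fun x => (F x i j * g x)%:E) = (fun x => (F x i j * g x)%:E) \_ K.
  apply/funext => x; rewrite patchE; case: ifPn => //.
  by move=> /negP xK; rewrite g0 ?mulr0// => Kx; apply: xK; rewrite inE.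
rewrite E; apply: (integrable_mkcond _ mK).1.
have mfg : measurable_fun K (fun x => (F x i j * g x)%:E).
  apply/measurable_EFinP; apply: measurable_funTS; apply: measurable_funM.
    exact: measurable_fun_entry.
  exact: continuous_measurable_mxR.
have ib : mu.-integrable K (fun x => M%:E * (cst 1 x + (opnorm (F x) `^ p)%:E))%E.
  apply: integrableZl => //; apply: integrableD => //.
    apply/integrableP; split; first exact: measurable_cst.
    under eq_integral do rewrite /cst abse1.
    rewrite integral_cst// mul1e; apply: bounded_lebesgue_rn_lty => //.
    exact: compact_bounded.
  by apply: integrable_pmass => //; exact: measurable_funTS.
apply: (le_integrable mK mfg _ ib) => x Kx.
rewrite -EFinD -EFinM !abse_EFin lee_fin (normrM (F x i j)).
rewrite [leRHS]ger0_norm ?mulr_ge0 ?addr_ge0 ?powR_ge0// [leLHS]mulrC.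
apply: ler_pM; [by []|by []|exact: gM|].
by rewrite (le_trans (entry_le_opnorm _ _ _))// le1D_powR// opnorm_ge0.
Qed.

Lemma integrable_test_fun phi Om : test_function Om phi -> mu.-integrable setT (EFin \o phi).
Proof.
move=> [sm cs _].
have := integrable_test 0 0 (lexx 1) cs (@Lploc_cst R n 1 (lexx 1) 1 1 1%:M)
  (smooth_continuous sm) (@supp0 _ _ phi).
by apply: eq_integrable => // x _ /=; rewrite mxE mul1r.
Qed.

Lemma translation_shift k t :
  homothety 1 (t *: delta_mx k 0) = (fun x : 'cV[R]_n => t *: delta_mx k 0 + x).
Proof. by apply/funext => x; rewrite /homothety scale1r addrC. Qed.

(** The difference quotients [(phi (x + t e_k) - phi x) / t] integrate against
    [x_j] to [- delta_jk \int phi], by translation invariance; they converge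
    boundedly to the partial derivative. *)
Lemma integral_coord_partial phi j k : test_function setT phi ->
  \int[mu]_x (x j 0 * partial phi k x) = - (j == k)%:R * \int[mu]_x phi x.
Proof.
move=> tphi; have [sm cs _] := tphi; pose v : 'cV[R]_n := delta_mx k 0.
have cphi := smooth_continuous sm.
have cpart := smooth_continuous (smooth_partial k sm).
have lid : in_Lploc 1 setT (fun x : 'cV[R]_n => x) := @Lploc_id R n 1 (lexx 1).
pose t_ (i : nat) : R := i.+1%:R^-1.
have t0 i : 0 < t_ i by rewrite invr_gt0.
have t1 i : t_ i <= 1 by rewrite invf_le1// ler1n.
have [M M0 DM] := compact_support_bounded cs cpart (@partial_supp0 _ _ phi k).
have [r r0 sr] := bounded_cube_sub (compact_bounded cs).
(* contains the support of every [phi (t_ i *: v + _)], as [t_ i <= 1] *)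
pose K : set 'cV[R]_n := closure (cube (r + 2) 0).
have cK : compact K by exact: closed_cube_compact.
have mK := mx_compact_measurable cK.
have r20 : 0 < r + 2 by rewrite addr_gt0.
pose q i (x : 'cV[R]_n) : R := (t_ i)^-1 * (phi (t_ i *: v + x) - phi x).
have shiftc i : continuous (fun x : 'cV[R]_n => phi (t_ i *: v + x)).
  rewrite -/v -[X in continuous X]/(phi \o (fun x : 'cV[R]_n => t_ i *: v + x)) -translation_shift.
  by move=> x; apply: continuous_comp; [exact: homothety_continuous|exact: cphi].
have qc i : continuous (q i).
  move=> x; apply: (@cvgMl_tmp R _ (nbhs x)).
  by apply: (@cvgB R R _ (nbhs x)); [exact: shiftc|exact: cphi].
have q0 i x : ~ K x -> q i x = 0.
  move=> Kx; have nin (y : 'cV[R]_n) : (forall a, `|y a 0 - x a 0| <= 1) -> phi y = 0.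
    move=> yx; apply: supp0 => /sr /(in_cube 0 y r0) yr; apply: Kx; apply: subset_closure.
    apply/in_cube => // a; have := yr a; have := yx a; rewrite mxE !subr0 => h1 h2.
    rewrite -[x a 0](subrK (y a 0)) (le_lt_trans (ler_normD _ _))// distrC; lra.
  rewrite /q !nin ?subrr ?mulr0// => a; first by rewrite subrr normr0 ler01.
  rewrite !mxE addrK eqxx andbT; case: (a == k); rewrite ?mulr1 ?mulr0 ?normr0 ?ler01//.
  by rewrite gtr0_norm.
have qM i x : `|q i x| <= M.
  rewrite /q normrM normfV (gtr0_norm (t0 i)) ler_pdivrMl// mulrC.
  by apply: mvt_line => //; [move=> y; exact: smooth_derivable|exact: ltW].
have quot i : mu.-integrable setT (fun x : 'cV[R]_n => (x j 0 * q i x)%:E).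
  exact: (integrable_test j 0 (lexx 1) cK lid (qc i) (q0 i)).
have iphi := integrable_test_fun tphi.
have ixphi : mu.-integrable setT (EFin \o (fun x : 'cV[R]_n => x j 0 * phi x)).
  apply: (integrable_test j 0 (lexx 1) cs lid cphi) => x; exact: supp0.
have quotE i : \int[mu]_x (x j 0 * q i x) = - (j == k)%:R * \int[mu]_x phi x.
  pose g (y : 'cV[R]_n) := y j 0 * phi y - t_ i * (j == k)%:R * phi y.
  have ig : mu.-integrable setT (EFin \o g).
    have := integrableB measurableT ixphi (integrableZl measurableT (t_ i * (j == k)%:R) iphi).
    by apply: eq_integrable.
  have E (x : 'cV[R]_n) : x j 0 * q i x = (t_ i)^-1 * (g (homothety 1 (t_ i *: v) x) - x j 0 * phi x).
    rewrite translation_shift /q /g !mxE eqxx andbT; ring.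
  under eq_Rintegral do rewrite E.
  have mg : measurable_fun setT g by apply/measurable_EFinP; have /integrableP[] := ig.
  have igs : mu.-integrable setT (EFin \o (g \o homothety 1 (t_ i *: v))).
    have := integrableD measurableT (integrableZl measurableT (t_ i) (quot i)) ixphi.
    apply: eq_integrable => // x _ /=; rewrite -EFinM -EFinD; congr EFin.
    by rewrite E mulrA mulfV ?gt_eqF// mul1r subrK.
  rewrite RintegralZl//; last by apply: (integrableB measurableT igs ixphi).
  rewrite RintegralB// Rintegral_homothety// expr1n invr1 mul1r.
  rewrite /g RintegralB// ?RintegralZl//; last exact: (integrableZl measurableT (t_ i * (j == k)%:R) iphi).
  rewrite addrAC subrr sub0r mulrN -(mulrA (t_ i)) mulKf ?mulNr//.
  by rewrite gt_eqF.
pose G := (fun x : 'cV[R]_n => (M%:E * (opnorm x `^ 1)%:E)%E) \_ K.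
have iG : mu.-integrable setT G.
  apply: (integrable_mkcond _ mK).1; apply: integrableZl => //.
  have [mid idK] := lid _ cK (@subsetT _ _).
  exact: integrable_pmass.
have t_cvg : t_ @ \oo --> (0 : R)^'.
  move=> A A0; have B : nbhs (0 : R) (fun y => y != 0 -> A y) := A0.
  have C : \oo (fun i => t_ i != 0 -> A (t_ i)) := @cvg_harmonic R _ B.
  by apply: (@filterS _ \oo _ _ _ _ C) => i; apply; exact: (lt0r_neq0 (t0 i)).
have qcvg (x : 'cV[R]_n) : (x j 0 * q i x)%:E @[i --> \oo] --> (x j 0 * partial phi k x)%:E.
  apply: cvg_EFin; first by near=> i.
  rewrite (_ : _ \o _ = fun i => x j 0 * q i x)//.
  apply: (@cvgMl_tmp R _ \oo).
  exact: cvg_trans (cvg_app _ t_cvg) (smooth_derivable (x := x) (j := k) sm).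
have qG (x : 'cV[R]_n) i : (`| (x j 0 * q i x)%:E | <= G x)%E.
  rewrite /G patchE; case: ifPn => [_|/negP xK].
    rewrite abse_EFin -EFinM lee_fin normrM mulrC; apply: ler_pM => //.
    by rewrite powRr1 ?opnorm_ge0// entry_le_opnorm.
  by rewrite q0 ?mulr0 ?abse0// => Kx; apply: xK; rewrite inE.
have mpart : measurable_fun setT (fun x : 'cV[R]_n => (x j 0 * partial phi k x)%:E).
  apply/measurable_EFinP; apply: measurable_funM; first exact: measurable_mxE.
  exact: continuous_measurable_mxR.
have [_ _ cvgq] := dominated_convergence measurableT
  (fun i => measurable_int _ (quot i)) mpart (aeW _ (fun x _ => qcvg x)) iG
  (aeW _ (fun x i _ => qG x i)).
have : (\int[mu]_x (x j 0 * partial phi k x)%:E = (- (j == k)%:R * \int[mu]_x phi x)%:E)%E.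
  apply: cvg_unique cvgq _ => //.
  rewrite (_ : [sequence _]_i = cst (- (j == k)%:R * \int[mu]_x phi x)%:E); first exact: cvg_cst.
  apply/funext => i /=; rewrite -(quotE i) /Rintegral fineK//.
  exact: integrable_fin_num (quot i).
by rewrite /Rintegral => ->.
Unshelve. all: by end_near. Qed.

End distributions.

Section DL_lemmas.
Context {R : realType} {m n : nat}.
Local Notation mu := (lebesgue_rn n).
Variable L : {linear 'M[R]_(m, n) -> 'M[R]_(m, n)}.
Implicit Types (phi : 'cV[R]_n -> R) (Om D : set 'cV[R]_n) (p e : R) (h : 'cV[R]_n)
  (u v : 'cV[R]_n -> 'cV[R]_m) (V W : 'cV[R]_n -> 'M[R]_(m, n)).

Lemma linear_entry (M : 'M[R]_(m, n)) i j :
  L M i j = \sum_(c : 'I_m * 'I_n) M c.1 c.2 * L (delta_mx c.1 c.2) i j.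
Proof.
rewrite -(pair_bigA _ (fun a b => M a b * L (delta_mx a b) i j))/=.
rewrite {1}(matrix_sum_delta M) linear_sum summxE; apply: eq_bigr => a _.
by rewrite linear_sum summxE; apply: eq_bigr => b _; rewrite linearZ mxE.
Qed.

Lemma DLE Om u phi i j :
  DL L Om u phi i j = - \int[mu]_(x in Om) L (u x *m (grad phi x)^T) i j.
Proof. by rewrite mxE. Qed.

Lemma distribution_ofE Om V phi i j :
  distribution_of Om V phi i j = \int[mu]_(x in Om) (V x i j * phi x).
Proof. by rewrite mxE. Qed.

Lemma tensor_entry u phi x (c : 'I_m * 'I_n) :
  (u x *m (grad phi x)^T) c.1 c.2 = u x c.1 0 * partial phi c.2 x.
Proof. by rewrite mxE big_ord1 !mxE. Qed.

Lemma integral_off Om f : (forall x : 'cV[R]_n, ~ Om x -> f x = 0 :> R) ->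
  \int[mu]_(x in Om) f x = \int[mu]_x f x.
Proof.
move=> f0; rewrite Rintegral_mkcond; congr (Rintegral _ _ _); apply/funext => x.
by rewrite patchE; case: ifPn => // /negP xO; rewrite f0// => Ox; apply: xO; rewrite inE.
Qed.

(** The integrands vanish outside the support of [phi]. *)
Lemma DL_setT Om u phi : test_function Om phi -> DL L Om u phi = DL L setT u phi.
Proof.
move=> [_ _ sO]; apply/matrixP => i j; rewrite !mxE; congr (- _); apply: integral_off.
move=> x Ox; rewrite (_ : _ *m _ = 0) ?linear0 ?mxE//.
apply/matrixP => a b; rewrite (tensor_entry u phi x (a, b)) mxE partial_supp0 ?mulr0//.
by move=> /sO.
Qed.

Lemma distribution_setT Om V phi : test_function Om phi ->
  distribution_of Om V phi = distribution_of setT V phi.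
Proof.
move=> [_ _ sO]; apply/matrixP => i j; rewrite !mxE; apply: integral_off.
by move=> x Ox; rewrite supp0 ?mulr0// => /sO.
Qed.

Lemma DL_eq_sub_dom Om Om' u V : Om' `<=` Om -> DL_eq L Om u V -> DL_eq L Om' u V.
Proof.
move=> OO' uV phi tphi; have tphi' := test_sub OO' tphi.
by have := uV _ tphi'; rewrite (DL_setT u tphi') (distribution_setT V tphi')
  -(DL_setT u tphi) -(distribution_setT V tphi).
Qed.

Lemma DL_eq_ext Om u V W : (forall x, Om x -> V x = W x) -> DL_eq L Om u V -> DL_eq L Om u W.
Proof.
move=> VW uV phi tphi; rewrite uV//; apply/matrixP => i j; rewrite !mxE.
by apply: eq_Rintegral => x /[!inE] Ox; rewrite VW.
Qed.

Section lploc.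
Variables (p : R) (p1 : 1 <= p).

Lemma integrable_tensor u phi (c : 'I_m * 'I_n) : in_Lploc p setT u -> test_function setT phi ->
  mu.-integrable setT (EFin \o (fun x => (u x *m (grad phi x)^T) c.1 c.2)).
Proof.
move=> lu [sm cs _].
have := integrable_test c.1 0 p1 cs lu (smooth_continuous (smooth_partial c.2 sm))
  (@partial_supp0 _ _ phi c.2).
by apply: eq_integrable => // x _ /=; rewrite tensor_entry.
Qed.

Lemma integrable_Ltensor u phi i j : in_Lploc p setT u -> test_function setT phi ->
  mu.-integrable setT (EFin \o (fun x => L (u x *m (grad phi x)^T) i j)).
Proof.
move=> lu tphi.
have := @integrable_bigsum R n _ (index_enum _)
  (fun (c : 'I_m * 'I_n) x => L (delta_mx c.1 c.2) i j * (u x *m (grad phi x)^T) c.1 c.2)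
  (fun c => integrableZl measurableT _ (integrable_tensor c lu tphi)).
apply: eq_integrable => // x _; congr EFin; rewrite linear_entry.
by apply: eq_bigr => c _; rewrite mulrC.
Qed.

Lemma integrable_Vphi V phi i j : in_Lploc p setT V -> test_function setT phi ->
  mu.-integrable setT (EFin \o (fun x => V x i j * phi x)).
Proof.
move=> lV [sm cs _].
exact: (integrable_test i j p1 cs lV (smooth_continuous sm) (@supp0 _ _ phi)).
Qed.

Lemma DL_entry u phi i j : in_Lploc p setT u -> test_function setT phi ->
  DL L setT u phi i j = - \sum_(c : 'I_m * 'I_n)
    L (delta_mx c.1 c.2) i j * \int[mu]_x (u x c.1 0 * partial phi c.2 x).
Proof.
move=> lu tphi; rewrite mxE; congr (- _).
under eq_Rintegral do rewrite linear_entry.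
rewrite Rintegral_bigsum; last first.
  move=> c; have := integrableZl measurableT (L (delta_mx c.1 c.2) i j)
    (integrable_tensor c lu tphi).
  by apply: eq_integrable => // x _ /=; rewrite -EFinM mulrC.
apply: eq_bigr => c _; rewrite -RintegralZl//.
  by apply: eq_Rintegral => x _; rewrite tensor_entry mulrC.
have := integrable_tensor c lu tphi.
by apply: eq_integrable => // x _ /=; rewrite tensor_entry.
Qed.

(** Integration by parts against each coordinate function
    ([integral_coord_partial]). *)
Lemma DL_mulmx A phi : test_function setT phi ->
  DL L setT (mulmx A) phi = distribution_of setT (fun=> L A) phi.
Proof.
move=> tphi.
have lA : in_Lploc p setT (mulmx A : 'cV[R]_n -> 'cV[R]_m) := @Lploc_mulmx R n p p1 m A.
have lid : in_Lploc p setT (fun x : 'cV[R]_n => x) := @Lploc_id R n p p1.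
have [sm cs _] := tphi.
have iphi := integrable_test_fun tphi.
apply/matrixP => i j; rewrite (DL_entry i j lA tphi) mxE RintegralZl//.
rewrite linear_entry mulr_suml -sumrN; apply: eq_bigr => -[a b] _ /=.
have -> : \int[mu]_x ((A *m x) a 0 * partial phi b x) = - (A a b * \int[mu]_x phi x).
  under eq_Rintegral do rewrite mxE mulr_suml.
  rewrite Rintegral_bigsum; last first.
    move=> c; have := integrableZl measurableT (A a c)
      (integrable_test c 0 p1 cs lid (smooth_continuous (smooth_partial b sm)) (@partial_supp0 _ _ phi b)).
    by apply: eq_integrable => // x _ /=; rewrite -EFinM mulrA.
  under eq_bigr => c _.
    under eq_Rintegral do rewrite -mulrA.
    rewrite RintegralZl//; last first.
      exact: (integrable_test c 0 p1 cs lid (smooth_continuous (smooth_partial b sm)) (@partial_supp0 _ _ phi b)).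
    rewrite (integral_coord_partial c b tphi).
    over.
  rewrite (bigD1 b)//= eqxx big1 ?addr0; first by rewrite mulN1r mulrN.
  by move=> c /negbTE ->; rewrite oppr0 mul0r mulr0.
by rewrite mulrN opprK mulrCA mulrA.
Qed.

(** Used on the cubes where [V] is close to [L A]. *)
Lemma DL_eq_affine Om u V A : in_Lploc p setT u -> in_Lploc p setT V -> DL_eq L Om u V ->
  DL_eq L Om (fun x => u x - A *m x) (fun x => V x - L A).
Proof.
move=> lu lV uV phi tphi; have tphi' := test_sub (@subsetT _ _) tphi.
have lA : in_Lploc p setT (mulmx A : 'cV[R]_n -> 'cV[R]_m) := @Lploc_mulmx R n p p1 m A.
have lLA : in_Lploc p setT (fun _ : 'cV[R]_n => L A) := @Lploc_cst R n p p1 m n (L A).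
rewrite (DL_setT _ tphi) (distribution_setT _ tphi).
have := uV phi tphi; rewrite (DL_setT _ tphi) (distribution_setT _ tphi).
have := DL_mulmx A tphi'.
move=> /matrixP EA /matrixP EV; apply/matrixP => i j.
have := EA i j; have := EV i j; rewrite !mxE => Vij Aij.
under [RHS]eq_Rintegral do rewrite !mxE mulrBl.
rewrite [RHS]RintegralB//; last 2 first.
- exact: integrable_Vphi.
- exact: (integrable_Vphi i j lLA tphi').
rewrite -Vij -Aij opprK.
under eq_Rintegral do rewrite mulmxBl linearB mxE [X in _ + X]mxE.
rewrite RintegralB//; first by rewrite opprB addrC.
- exact: integrable_Ltensor.
- exact: (integrable_Ltensor i j lA tphi').
Qed.

Lemma partial_homothety phi e h j x : 0 < e -> smooth phi ->
  partial (phi \o homothety e h) j x = e * partial phi j (homothety e h x).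
Proof.
move=> e0 sm; have [_ De] := is_derive_homothety (lt0r_neq0 e0) (@smooth_derivable _ _ phi (homothety e h x) j sm).
exact: De.
Qed.

(** Change of variables in both integrals, for the test function
    [phi \o (homothety e h)^-1]. *)
Lemma DL_eq_homothety D e h u V : 0 < e -> in_Lploc p setT u -> in_Lploc p setT V ->
  DL_eq L (homothety e h @` D) u V ->
  DL_eq L D (u \o homothety e h) (fun x => e *: V (homothety e h x)).
Proof.
move=> e0 lu lV uV phi tphi; pose H := homothety e h.
pose psi := phi \o homothety e^-1 (- (e^-1 *: h)).
have tpsi : test_function (H @` D) psi by exact: test_homothety.
have tpsi' := test_sub (@subsetT _ _) tpsi.
have psiE : phi = psi \o H by apply/funext => x; rewrite /psi /= homothetyK.
have [sm _ _] := tpsi.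
rewrite (DL_setT _ tphi) (distribution_setT _ tphi).
have := uV _ tpsi; rewrite (DL_setT _ tpsi) (distribution_setT _ tpsi).
move=> E; apply/matrixP => i j.
have Eij : - (\int[mu]_x L (u x *m (grad psi x)^T) i j) = \int[mu]_x (V x i j * psi x).
  have := congr1 (fun M : 'M[R]_(m, n) => M i j) E.
  by rewrite DLE distribution_ofE.
rewrite DLE.
rewrite distribution_ofE.
have itens := integrable_Ltensor i j lu tpsi'.
have iV := integrable_Vphi i j lV tpsi'.
have RE : \int[mu]_x ((e *: V (homothety e h x)) i j * phi x) =
    e ^- n * (e * \int[mu]_x (V x i j * psi x)).
  transitivity (\int[mu]_x ((fun y => e * (V y i j * psi y)) (homothety e h x))).
    by apply: eq_Rintegral => x _; rewrite mxE {1}psiE /= mulrA.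
  rewrite (@Rintegral_homothety _ _ e h (fun y => e * (V y i j * psi y)))//.
    by rewrite RintegralZl.
  by apply/measurable_EFinP; exact: measurable_int _ (integrableZl measurableT e iV).
rewrite RE -Eij.
transitivity (- \int[mu]_x ((fun y => e * L (u y *m (grad psi y)^T) i j) (homothety e h x))).
  congr (- _); apply: eq_Rintegral => x _ /=.
  rewrite -[e * _](_ : (e *: L (u (H x) *m (grad psi (H x))^T)) i j = _); last by rewrite mxE.
  rewrite -linearZ; congr (L _ _ _); rewrite scalemxAr; congr (_ *m _).
  apply/matrixP => a b; rewrite !mxE {1}psiE.
  exact: partial_homothety.
rewrite (@Rintegral_homothety _ _ e h (fun y => e * L (u y *m (grad psi y)^T) i j))//; last first.
  apply/measurable_EFinP; exact: measurable_int _ (integrableZl measurableT e itens).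
by rewrite RintegralZl// !mulrN.
Qed.

End lploc.

End DL_lemmas.

Section DL_projection.
Context {R : realType} {m n : nat}.
Variable L : {linear 'M[R]_(m, n) -> 'M[R]_(m, n)}.
Hypothesis LL : forall A, L (L A) = L A.

Variables (p : R) (p1 : 1 <= p).

(** Apply [L] to both sides: it commutes with the integrals and fixes
    [L (u *m (grad phi)^T)]. *)
Lemma DL_idem (Om : set 'cV[R]_n) u V phi : in_Lploc p setT u -> in_Lploc p setT V ->
  test_function Om phi -> DL L Om u phi = distribution_of Om V phi ->
  DL L Om u phi = distribution_of Om (fun x => L (V x)) phi.
Proof.
move=> lu lV tphi; have tphi' := test_sub (@subsetT _ _) tphi.
rewrite (DL_setT _ _ tphi) !(distribution_setT _ tphi) => E.
transitivity (L (DL L setT u phi)).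
  apply/matrixP => i j; rewrite linear_entry mxE.
  under eq_Rintegral do rewrite -LL linear_entry.
  rewrite Rintegral_bigsum; last first.
    move=> c; have := integrableZl measurableT (L (delta_mx c.1 c.2) i j)
      (integrable_Ltensor L p1 c.1 c.2 lu tphi').
    by apply: eq_integrable => // x _ /=; rewrite -EFinM mulrC.
  rewrite -sumrN; apply: eq_bigr => c _; rewrite RintegralZr//.
    by rewrite mxE mulNr.
  exact: (integrable_Ltensor L p1 c.1 c.2 lu tphi').
rewrite E; apply/matrixP => i j; rewrite linear_entry mxE.
under [RHS]eq_Rintegral do rewrite linear_entry mulr_suml.
rewrite [RHS]Rintegral_bigsum; last first.
  move=> c; have := integrableZl measurableT (L (delta_mx c.1 c.2) i j)
    (integrable_Vphi p1 c.1 c.2 lV tphi').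
  by apply: eq_integrable => // x _ /=; rewrite -EFinM mulrCA mulrA.
apply: eq_bigr => c _; rewrite mxE -RintegralZr//; last exact: (integrable_Vphi p1 c.1 c.2 lV tphi').
by apply: eq_Rintegral => x _; rewrite mulrAC.
Qed.

(** Against a test function only the values of [V] on its compact support
    matter. *)
Lemma DL_eq_idem (Om : set 'cV[R]_n) u V : in_Lploc p setT u -> in_Lploc p Om V ->
  DL_eq L Om u V -> DL_eq L Om u (fun x => L (V x)).
Proof.
move=> lu lV uV phi tphi; have [_ cS SO] := tphi.
have mS := mx_compact_measurable cS; have [mV Voo] := lV _ cS SO.
have lVS : in_Lploc p setT (zext (supp phi) V).
  by apply: pmass_setT_Lploc; [exact: measurable_zext|rewrite pmass_zext//; exact: lt_le_trans p1].
have distE (W W' : 'cV[R]_n -> 'M[R]_(m, n)) : (forall x, supp phi x -> W x = W' x) ->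
    distribution_of Om W phi = distribution_of Om W' phi.
  move=> WW'; apply/matrixP => i j; rewrite !mxE; apply: eq_Rintegral => x _.
  by have [/WW' -> //|/supp0 ->] := pselect (supp phi x); rewrite !mulr0.
have zV x : supp phi x -> V x = zext (supp phi) V x by move=> Sx; rewrite zextE.
rewrite (distE (fun x => L (V x)) (fun x => L (zext (supp phi) V x))); last by move=> x /zV <-.
by apply: DL_idem => //; rewrite (uV _ tphi); exact: distE.
Qed.

End DL_projection.

(** * Packings by copies of the reference set *)

Section esum_lemmas.
Context {R : realType} {T : choiceType}.
Implicit Types (A B F : set T) (w : T -> \bar R).
Local Open Scope ereal_scope.

Lemma ereal_sup_add_le (X Y : set (\bar R)) z : X !=set0 -> Y !=set0 ->
  (forall x, X x -> 0 <= x) -> (forall y, Y y -> 0 <= y) ->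
  (forall x y, X x -> Y y -> x + y <= z) -> ereal_sup X + ereal_sup Y <= z.
Proof.
move=> [x0 Xx0] [y0 Yy0] X0 Y0 XY.
have [->|] := eqVneq z +oo; first by rewrite leey.
rewrite -ltey => zoo; have z0 : 0 <= z by apply: le_trans (XY _ _ Xx0 Yy0); apply: adde_ge0; [exact: X0|exact: Y0].
have Yfin y : Y y -> y \is a fin_num.
  move=> Yy; rewrite ge0_fin_numE ?Y0//; apply: le_lt_trans zoo.
  by rewrite (le_trans _ (XY _ _ Xx0 Yy))// leeDr// X0.
have supX y : Y y -> ereal_sup X <= z - y.
  move=> Yy; apply: ge_ereal_sup => x Xx; rewrite leeBrDr; last exact: Yfin.
  exact: XY.
have sX0 : 0 <= ereal_sup X by rewrite (le_trans (X0 _ Xx0))// ereal_sup_ubound.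
have Xfin : ereal_sup X \is a fin_num.
  rewrite ge0_fin_numE//; apply: le_lt_trans (supX _ Yy0) _.
  by rewrite (le_lt_trans _ zoo)// leeBlDr ?Yfin// leeDl// Y0.
rewrite addeC -leeBrDr//; apply: ge_ereal_sup => y Yy.
by rewrite leeBrDr// addeC -leeBrDr ?supX// Yfin.
Qed.

Lemma esum_subset A B w : (forall i, B i -> 0 <= w i) -> A `<=` B ->
  esum A w <= esum B w.
Proof.
move=> w0 AB; rewrite (esumID A B)// (setIidr AB) leeDl//.
by apply: esum_ge0 => x [/w0].
Qed.

Lemma esum_setU A B w : (forall i, A i -> 0 <= w i) -> (forall i, B i -> 0 <= w i) ->
  A `&` B = set0 -> esum (A `|` B) w = esum A w + esum B w.
Proof.
move=> A0 B0 AB; rewrite (esumID A) => [|i [/A0//|/B0//]].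
have -> : (A `|` B) `&` A = A by apply/seteqP; split=> [x []|x Ax]//; split=> //; left.
have -> // : (A `|` B) `&` ~` A = B.
apply/seteqP; split=> [x [[]//]|x Bx]; split; first by right.
by move=> Ax; have : (A `&` B) x by []; rewrite AB.
Qed.

(** An overlap of the [B i] only increases the right-hand side. *)
Lemma esum_cover (I : Type) (s : seq I) (B : I -> set T) F w :
  (forall i, F i -> 0 <= w i) ->
  esum F w <= \sum_(i <- s) esum (F `&` B i) w
    + esum (F `&` [set x | forall b, List.In b s -> ~ B b x]) w.
Proof.
move=> w0; elim: s F w0 => [|a s IH] F w0.
  rewrite big_nil add0e (_ : F `&` _ = F)//; apply/seteqP; split=> [x []//|x Fx].
  by split=> // b [].
rewrite big_cons (esumID (B a))// -addeA leeD2l//.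
apply: le_trans (IH _ _) _ => [x [/w0]//|].
apply: leeD.
  by apply: lee_sum => i _; apply: esum_subset => [x [/w0]//|x [[]]].
apply: esum_subset => [x [/w0]//|x [[Fx Bx] sB]]; split=> // b /= [<-//|]; exact: sB.
Qed.

Lemma esumZ (c : R) F w : (0 <= c)%R -> (forall i, F i -> 0 <= w i) ->
  \esum_(i in F) (c%:E * w i) = c%:E * esum F w.
Proof.
move=> c0 w0.
have dist X : finite_set X -> X `<=` F ->
    \sum_(x \in X) (c%:E * w x) = c%:E * \sum_(x \in X) w x.
  move=> fX XF; rewrite !fsbig_finite//= big_seq [in RHS]big_seq ge0_sume_distrr//.
  by move=> i; rewrite in_fset_set// inE => /XF /w0.
rewrite /esum -ereal_supZl//.
  congr ereal_sup; apply/seteqP; split.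
    move=> _ [X [fX XF] <-]; exists (\sum_(x \in X) w x); first by exists X.
    by rewrite dist.
  by move=> _ [_ [X [fX XF] <-] <-]; exists X; rewrite ?dist.
by apply/set0P; exists 0, set0; [exact: fsets_set0|rewrite fsbig_set0].
Qed.

End esum_lemmas.

Section disjoint_integral.
Context {R : realType} {n : nat}.
Local Notation mu := (lebesgue_rn n).
Local Open Scope ereal_scope.

(** Disjointness turns a finite sum of integrals over members of [F] into an
    integral over their union. *)
Lemma esum_integral_le (F : set (set 'cV[R]_n)) Om (g : 'cV[R]_n -> \bar R) :
  measurable Om -> (forall E, F E -> measurable E /\ E `<=` Om) -> trivIset F id ->
  measurable_fun Om g -> (forall x, 0 <= g x) ->
  \esum_(E in F) \int[mu]_(x in E) g x <= \int[mu]_(x in Om) g x.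
Proof.
move=> mOm FO tF mg g0; apply: ge_ereal_sup => _ [X [fX XF] <-].
rewrite fsbig_finite//= big_seq.
pose h (E : set 'cV[R]_n) := if E \in X then E else set0.
have hE (E : set 'cV[R]_n) : E \in fset_set X -> h E = E by rewrite in_fset_set// /h => ->.
have mh E : measurable (h E).
  by rewrite /h; case: ifPn => //; rewrite inE => /XF/FO[].
rewrite (eq_bigr (fun E => \int[mu]_(x in h E) g x)) => [|E EX]; last by rewrite hE.
rewrite -big_seq -(@ge0_integral_bigsetU _ _ _ mu _ h g (fset_set X))//.
- apply: ge0_subset_integral => //; first exact: bigsetU_measurable.
  rewrite -bigcup_seq => x [E /= EX]; rewrite hE// => Ex.
  by move: EX; rewrite in_fset_set// inE => /XF/FO[_]; apply.
- exact: fset_uniq.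
- move=> E E' /= EX E'X; rewrite !hE// => EE'.
  by apply: tF => //; apply: XF; apply/set_mem; rewrite -in_fset_set.
- apply: measurable_funS mg => //.
  rewrite -bigcup_seq => x [E /= EX]; rewrite hE// => Ex.
  by move: EX; rewrite in_fset_set// inE => /XF/FO[_]; apply.
Qed.

End disjoint_integral.

Section packings.
Context {R : realType} {n : nat}.
Local Notation mu := (lebesgue_rn n).
Variable D : set 'cV[R]_n.
Hypotheses (D0 : D !=set0) (oD : open D).
Implicit Types (E Om A B : set 'cV[R]_n) (w : set 'cV[R]_n -> \bar R) (e r : R).

(** For [w = alpha u] this is [G] up to a power of [e]; for [w = 1] it is the
    largest number of disjoint copies of [e D] in [Om]. *)
Definition packsup w e Om : \bar R :=
  ereal_sup [set \esum_(E in F) w E | F in disjoint_families D e Om].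

Lemma copies_atP e Om E : copies_at D e Om E -> 0 < e -> open E /\ E !=set0.
Proof.
move=> [EO [h Eh]] e0; rewrite Eh; split; first exact: open_homothety.
by have [x Dx] := D0; exists (homothety e h x); exists x.
Qed.

Lemma copies_at_mono e A B E : A `<=` B -> copies_at D e A E -> copies_at D e B E.
Proof. by move=> AB [EA h]; split=> //; exact: subset_trans AB. Qed.

Lemma disjoint_families0 e Om : disjoint_families D e Om set0.
Proof. by split. Qed.

Lemma disjoint_familiesI e Om F (B : set (set 'cV[R]_n)) :
  disjoint_families D e Om F -> disjoint_families D e Om (F `&` B).
Proof.
move=> [FO tF]; split; first by move=> E [/FO].
exact: sub_trivIset tF.
Qed.

Local Open Scope ereal_scope.

Lemma packsup_ge0 w e Om : 0 <= packsup w e Om.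
Proof.
apply: ereal_sup_ubound; exists set0; first exact: disjoint_families0.
exact: esum_set0.
Qed.

Lemma packsup_ub w e Om F : disjoint_families D e Om F ->
  \esum_(E in F) w E <= packsup w e Om.
Proof. by move=> dF; apply: ereal_sup_ubound; exists F. Qed.

Lemma packsup_mono w e A B : A `<=` B -> packsup w e A <= packsup w e B.
Proof.
move=> AB; apply: ge_ereal_sup => _ [F [FA tF] <-]; apply: packsup_ub.
by split=> // E /FA; exact: copies_at_mono.
Qed.

Lemma packsupZ w (c : R) e Om : (0 <= c)%R ->
  (forall E, copies_at D e Om E -> 0 <= w E) ->
  packsup (fun E => c%:E * w E) e Om = c%:E * packsup w e Om.
Proof.
move=> c0 w0; rewrite /packsup -ereal_supZl//.
  congr ereal_sup; apply/seteqP; split.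
    move=> _ [F dF <-]; exists (\esum_(E in F) w E); first by exists F.
    by rewrite esumZ// => E EF; apply: w0; case: dF => + _; exact.
  move=> _ [_ [F dF <-] <-]; exists F => //.
  by rewrite esumZ// => E EF; apply: w0; case: dF => + _; exact.
by apply/set0P; exists (esum set0 w), set0 => //; exact: disjoint_families0.
Qed.

Lemma eq_packsup w w' e Om : (forall E, copies_at D e Om E -> w E = w' E) ->
  packsup w e Om = packsup w' e Om.
Proof.
move=> ww'; congr ereal_sup; apply/seteqP; split=> _ [F dF <-]; exists F => //;
by apply: eq_esum => E EF; rewrite ww'//; case: dF => + _; exact.
Qed.

(** A packing of [A] and one of [B] have no common member, as copies are not
    empty; so the sum over their union is the sum of the two sums. *)
Lemma packsup_setU w e A B Om : (0 < e)%R ->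
  (forall E, copies_at D e Om E -> 0 <= w E) ->
  A `<=` Om -> B `<=` Om -> A `&` B = set0 ->
  packsup w e A + packsup w e B <= packsup w e Om.
Proof.
move=> e0 w0 AO BO AB.
have wA E : copies_at D e A E -> 0 <= w E by move=> /(copies_at_mono AO)/w0.
have wB E : copies_at D e B E -> 0 <= w E by move=> /(copies_at_mono BO)/w0.
apply: ereal_sup_add_le.
- by exists (esum set0 w), set0 => //; exact: disjoint_families0.
- by exists (esum set0 w), set0 => //; exact: disjoint_families0.
- by move=> _ [F [FA _] <-]; apply: esum_ge0 => E /FA/wA.
- by move=> _ [F [FB _] <-]; apply: esum_ge0 => E /FB/wB.
move=> _ _ [F [FA tF] <-] [F' [FB tF'] <-].
have FF' E E' : F E -> F' E' -> E `&` E' = set0.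
  move=> /FA[EA _] /FB[EB _]; rewrite -subset0 => x [/EA Ax /EB Bx].
  by rewrite -AB.
rewrite -esum_setU; last 3 first.
- by move=> E /FA/wA.
- by move=> E /FB/wB.
- rewrite -subset0 => E [FE F'E]; have [_ [x Ex]] := copies_atP (FA _ FE) e0.
  by have := FF' _ _ FE F'E; rewrite setIid => E0; move: Ex; rewrite E0.
apply: packsup_ub; split.
  by move=> E [/FA/(copies_at_mono AO)|/FB/(copies_at_mono BO)].
move=> E E' [FE|FE] [FE'|FE'] /=.
- exact: tF.
- by rewrite FF'// => -[].
- by rewrite setIC FF'// => -[].
- exact: tF'.
Qed.

Lemma packsup_superadd (I : eqType) (s : seq I) (q : I -> set 'cV[R]_n) w e Om :
  (0 < e)%R -> (forall E, copies_at D e Om E -> 0 <= w E) -> uniq s ->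
  (forall i, i \in s -> q i `<=` Om) ->
  (forall i j, i \in s -> j \in s -> i != j -> q i `&` q j = set0) ->
  \sum_(i <- s) packsup w e (q i) <= packsup w e Om.
Proof.
move=> e0; elim: s Om => [|a s IH] Om w0 us qO qq.
  by rewrite big_nil packsup_ge0.
rewrite big_cons; have /andP[as_ us'] := us.
pose U := \bigcup_(i in [set` s]) q i.
have UO : U `<=` Om by move=> x [i /= si]; apply: qO; rewrite inE si orbT.
have aO : q a `<=` Om by apply: qO; rewrite inE eqxx.
apply: le_trans (packsup_setU e0 w0 aO UO _).
  apply: leeD2l; apply: IH => //.
  - by move=> E /(copies_at_mono UO)/w0.
  - by move=> i si; exact: bigcup_sup.
  - by move=> i j si sj; apply: qq; rewrite inE ?si ?sj orbT.
rewrite -subset0 => x [qa [i /= si qi]].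
have E : q a `&` q i = set0.
  apply: qq; rewrite ?inE ?eqxx ?si ?orbT//.
  by apply: contraNneq as_ => ->.
by have : (q a `&` q i) x by []; rewrite E.
Qed.

Lemma packsup_homothety e r h Om : (0 < e)%R -> (0 < r)%R ->
  packsup (cst 1) (e * r) (homothety e h @` Om) = packsup (cst 1) r Om.
Proof.
move=> e0 r0.
have le e' h' r' Om' : (0 < e')%R ->
    packsup (cst 1) r' Om' <= packsup (cst 1) (e' * r') (homothety e' h' @` Om').
  move=> e'0; apply: ge_ereal_sup => _ [F [FO tF] <-].
  pose H (E : set 'cV[R]_n) := homothety e' h' @` E.
  have Hinj : injective H.
    by move=> E E' /(congr1 (preimage (homothety e' h'))); rewrite !homothety_preimage_image.
  have -> : \esum_(E in F) cst 1 E = \esum_(E in H @` F) cst 1 E :> \bar R.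
    by rewrite esum_image//; move=> ? ? _ _; exact: Hinj.
  apply: packsup_ub; split.
    move=> _ [E /FO[EO [c Ec]] <-]; rewrite /H; split; first exact: image_subset.
    by rewrite Ec; exists (e' *: c + h')%R; rewrite homothety_image_comp.
  move=> _ _ [E FE <-] [E' FE' <-] [_ [[x Ex <-] [y E'y /(can_inj (homothetyK h' e'0)) xy]]].
  by congr H; apply: tF => //; exists x; split=> //; rewrite -xy.
apply/eqP; rewrite eq_le le// andbT.
have := le e^-1%R (- (e^-1 *: h))%R (e * r)%R (homothety e h @` Om).
rewrite invr_gt0 => /(_ e0).
rewrite mulrA mulVf ?gt_eqF// mul1r homothety_image_comp mulVf ?gt_eqF//.
by rewrite subrr homothety10 image_id.
Qed.

(** Normalised so that it is invariant under simultaneous scaling of the copies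
    and of [Om], up to the volume of [Om] ([dens_cube]). *)
Definition dens e Om : \bar R := (e ^+ n)%:E * packsup (cst 1) e Om.

Lemma dens_cube e r c : (0 < e)%R -> (0 < r)%R ->
  dens e (cube r c) = (r ^+ n)%:E * dens (e / r) Q.
Proof.
move=> e0 r0; have re : (r * (e / r) = e)%R by rewrite mulrC divfK ?gt_eqF.
have := packsup_homothety c Q r0 (divr_gt0 e0 r0); rewrite re => Ec.
by rewrite /dens /cube Ec muleA -EFinM -exprMn re.
Qed.

End packings.

Section packing_density.
Context {R : realType} {n : nat}.
Local Notation mu := (lebesgue_rn n).
Variable D : set 'cV[R]_n.
Hypotheses (D0 : D !=set0) (oD : open D) (bD : bounded_set D).
Implicit Types (E Om A B : set 'cV[R]_n) (e r : R).

Lemma lebesgue_rn_copy e h : 0 < e -> mu (homothety e h @` D) = ((e ^+ n)%:E * mu D)%E.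
Proof.
move=> e0; rewrite homothety_image// lebesgue_rn_homothety ?invr_gt0//; last exact: mx_open_measurable.
by rewrite exprVn invrK.
Qed.

Let vol := fine (mu D).

Let mD : measurable D. Proof. exact: mx_open_measurable. Qed.

Let volE : mu D = vol%:E.
Proof.
rewrite fineK// ge0_fin_numE//; exact: bounded_lebesgue_rn_lty.
Qed.

Let vol0 : 0 < vol.
Proof. by rewrite -lte_fin -volE; exact: open_lebesgue_rn_gt0. Qed.

(** The disjoint copies have total volume at most one. *)
Lemma dens_le e : 0 < e -> (dens D e Q <= (vol^-1)%:E)%E.
Proof.
move=> e0; have en0 : 0 < e ^+ n * vol by rewrite mulr_gt0// exprn_gt0.
rewrite -(mul1r vol^-1) EFinM lee_pdivlMr// muleAC -EFinM.
rewrite -(packsupZ (ltW en0))//.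
rewrite [leRHS](_ : _ = mu (Q : set 'cV[R]_n)); last first.
  by rewrite Q_cube lebesgue_rn_cube// expr1n.
have mQ : measurable (Q : set 'cV[R]_n) by rewrite Q_cube; exact: measurable_cube.
apply: ge_ereal_sup => _ [F [FQ tF] <-].
have FO E : F E -> measurable E /\ E `<=` Q.
  by move=> /FQ EQ; split; [apply: mx_open_measurable; have [] := copies_atP D0 oD EQ e0|have [] := EQ].
have := @esum_integral_le R n F Q (cst 1%E) mQ FO tF (measurable_cst _) (fun=> lee01).
rewrite integral_cst// mul1e; apply: le_trans.
apply: le_esum => E FE; rewrite /= mule1.
rewrite (integral_cst mu (FO E FE).1) mul1e.
have [_ [h ->]] := FQ _ FE.
by rewrite [leRHS](lebesgue_rn_copy h e0) volE.
Qed.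

Lemma packsup1_fin e : 0 < e -> packsup D (cst 1%E) e Q \is a fin_num.
Proof.
move=> e0; rewrite ge0_fin_numE ?packsup_ge0//.
have := dens_le e0; rewrite /dens; case: packsup => [r| |]//=.
  by rewrite ltry.
by rewrite mulry gtr0_sg ?exprn_gt0// mul1e leye_eq.
Qed.

(** Scaled by [s = e / r], a packing of [Q] at scale [r] is repeated in each
    cell of a grid of [k ^ n] disjoint cubes of side [s], where
    [k = \lfloor 1 / s \rfloor]. *)
Lemma dens_tile e r : 0 < e -> e < r ->
  (((1 - e / r) ^+ n)%:E * dens D r Q <= dens D e Q)%E.
Proof.
move=> e0 er; have r0 : 0 < r := lt_trans e0 er.
pose s := e / r; have s0 : 0 < s by rewrite divr_gt0.
have s1 : s < 1 by rewrite ltr_pdivrMr// mul1r.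
pose k := Num.truncn s^-1.
have sk : s * k%:R <= 1.
  by rewrite -ler_pdivlMl// mulr1 truncn_le// invr_ge0 ltW.
have sk1 : 1 < s * k.+1%:R.
  by rewrite -ltr_pdivrMl// mulr1 truncnS_gt.
pose c (z : {ffun 'I_n -> 'I_k}) : 'cV[R]_n := \col_i (- 2^-1 + s * ((z i)%:R + 2^-1)).
have key : (\sum_(z <- index_enum {ffun 'I_n -> 'I_k}) packsup D (cst 1) e (cube s (c z)) <=
    packsup D (cst 1) e Q)%E.
  apply: packsup_superadd => //.
  - exact: index_enum_uniq.
  - move=> z _ x /(in_cube _ _ s0) xz i; have := xz i; rewrite mxE ltr_distl => /andP[].
    have zk : (z i)%:R + 1 <= k%:R :> R by rewrite natr1 ler_nat.
    have := ler_wpM2l (ltW s0) zk; have : 0 <= s * (z i)%:R by rewrite mulr_ge0// ltW.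
    by move=> h1 h2 h3 h4; apply/andP; split; lra.
  - move=> z z' _ _ zz'; rewrite -subset0 => x [/(in_cube _ _ s0) xz /(in_cube _ _ s0) xz'].
    case/eqP: zz'; apply/ffunP => i; apply: val_inj => /=.
    have : `|s * ((z i)%:R - (z' i)%:R)| < s.
      rewrite (_ : s * _ = (x i 0 - c z' i 0) - (x i 0 - c z i 0)); last by rewrite !mxE; ring.
      by rewrite (le_lt_trans (ler_normB _ _))// [ltRHS]splitr ltrD.
    rewrite normrM (gtr0_norm s0) -[ltRHS]mulr1 ltr_pM2l// ltr_norml => /andP[h1 h2].
    have h3 : (z i)%:R < (z' i).+1%:R :> R by rewrite -natr1; lra.
    have h4 : (z' i)%:R < (z i).+1%:R :> R by rewrite -natr1; lra.
    by move: h3 h4; rewrite !ltr_nat !ltnS => h3 h4; apply/eqP; rewrite eqn_leq h3 h4.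
have Ec z : packsup D (cst 1%E) e (cube s (c z)) = packsup D (cst 1%E) r Q.
  by rewrite -(packsup_homothety D (c z) Q s0 r0) /s divfK ?gt_eqF.
move: key; rewrite (eq_bigr _ (fun z _ => Ec z)) /dens.
rewrite -(fineK (packsup1_fin e0)) -(fineK (packsup1_fin r0)).
set Pr := fine _; set Pe := fine _.
have Pr0 : 0 <= Pr by rewrite fine_ge0// packsup_ge0.
rewrite sumEFin lee_fin sumr_const card_ffun !card_ord -!EFinM lee_fin => key.
rewrite mulrA -exprMn.
apply: (@le_trans _ _ (e ^+ n * (Pr *+ k ^ n))); last first.
  by apply: ler_wpM2l => //; rewrite exprn_ge0// ltW.
rewrite -mulr_natl natrX mulrA -exprMn ler_wpM2r// lerXn2r ?nnegrE//.
- by rewrite mulr_ge0 ?subr_ge0 ?ltW.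
- by rewrite mulr_ge0// ltW.
- rewrite -/s (_ : e * k%:R = s * k%:R * r); last by rewrite mulrAC /s divfK ?gt_eqF.
  rewrite ler_wpM2r ?(ltW r0)// lerBlDr (le_trans (ltW sk1))//.
  by rewrite -natr1 mulrDr mulr1.
Qed.

(** By [dens_tile] the densities at scales much smaller than [r] are almost
    bounded below by the density at scale [r]; so their supremum is the limit. *)
Lemma dens_cvg : exists2 c : R, 0 <= c & dens D e Q @[e --> 0^'+] --> c%:E.
Proof.
pose d e := fine (dens D e Q).
have dE e : 0 < e -> dens D e Q = (d e)%:E.
  by move=> e0; rewrite fineK// fin_numM// packsup1_fin.
have d0 e : 0 < e -> 0 <= d e.
  by move=> e0; rewrite fine_ge0// mule_ge0 ?packsup_ge0// lee_fin exprn_ge0// ltW.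
have dV e : 0 < e -> d e <= vol^-1 by move=> e0; rewrite -lee_fin -dE// dens_le.
have sd : has_sup [set d e | e in [set e | 0 < e]].
  split; first by exists (d 1), 1 => //=; exact: ltr01.
  by exists vol^-1 => _ [e /= e0 <-]; exact: dV.
exists (sup [set d e | e in [set e | 0 < e]]).
  apply: le_trans (d0 1 ltr01) _; apply: ub_le_sup; first by case: sd.
  by exists 1 => //=; exact: ltr01.
apply: cvg_EFin.
  near=> e; rewrite dE//; near: e; exact: nbhs_right_gt.
apply/cvgrPdist_lt => del del0.
have [_ [r /= r0 <-] dr] := sup_adherent del0 sd.
pose g e := (1 - e / r) ^+ n * d r.
have gc : {for 0, continuous g}.
  apply: continuousM; last exact: cst_continuous.
  apply: (@continuous_comp _ _ _ (fun e => 1 - e / r) (fun x => x ^+ n)); last exact: exprn_continuous.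
  apply: (@continuousB R R R (cst 1) (fun e => e / r)); first exact: cst_continuous.
  by apply: continuousM; [exact: cvg_id|exact: cst_continuous].
have g0 : g 0 = d r by rewrite /g mul0r subr0 expr1n mul1r.
have gr : \forall e \near 0^'+, sup [set d e | e in [set e | 0 < e]] - del < g e.
  have : g @ 0^'+ --> g 0 by apply: cvg_at_right_filter; exact: gc.
  by move=> /cvgr_gt; apply; rewrite g0.
near=> e.
have e0 : 0 < e by near: e; exact: nbhs_right_gt.
have er : e < r by near: e; exact: nbhs_right_lt.
have de : d e <= sup [set d e | e in [set e | 0 < e]].
  by apply: ub_le_sup; [case: sd|exists e].
have ge : g e <= d e by have := dens_tile e0 er; rewrite !dE// -EFinM lee_fin.
have gs : sup [set d e | e in [set e | 0 < e]] - del < g e by near: e; exact: gr.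
rewrite /= ger0_norm ?subr_ge0// ltrBlDr addrC -ltrBlDr.
exact: lt_le_trans gs ge.
Unshelve. all: by end_near. Qed.

End packing_density.

(** * Core functionals *)

(** The bound in the definition of strong functionals, on every copy of [D]; the
    power of [e] is dictated by scaling. *)
Definition energy_bound {R : realType} {n m} p D (alpha : @functional R n m) L (c : R) :=
  forall u V e h, 0 < e -> in_Lploc p setT u -> in_Lploc p setT V ->
  DL_eq L (homothety e h @` D) u V ->
  ((alpha u (homothety e h @` D))%:E <=
    (c * e `^ (p - n%:R))%:E * pmass p (homothety e h @` D) V)%E.

Definition quasi_subadditive {R : realType} {n m} p D (alpha : @functional R n m) (y C : R) :=
  forall u v E, in_Lploc p setT u -> in_Lploc p setT v -> copies D setT E ->
  alpha (fun x => u x + v x) E <= y * alpha u E + C * alpha v E.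

Section core_functionals.
Context {R : realType} {n m : nat}.
Local Notation mu := (lebesgue_rn n).
Variables (p : R) (D : set 'cV[R]_n) (alpha : @functional R n m).
Hypotheses (p1 : 1 <= p) (core : p_core p D alpha).
Implicit Types (u v : 'cV[R]_n -> 'cV[R]_m) (V : 'cV[R]_n -> 'M[R]_(m, n))
  (A B : 'M[R]_(m, n)) (E Om : set 'cV[R]_n) (e r y : R) (h c : 'cV[R]_n).

Let p0 : 0 <= p. Proof. exact: le_trans p1. Qed.
Let pgt0 : 0 < p. Proof. exact: lt_le_trans p1. Qed.

Lemma copies_homothety e h : 0 < e -> copies D setT (homothety e h @` D).
Proof. by move=> e0; exists e => //; split => //; exists h. Qed.

Lemma copies_self : copies D setT D.
Proof.
by have := copies_homothety 0 ltr01; rewrite homothety10 image_id.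
Qed.

Lemma copies_at_copies e Om E : 0 < e -> copies_at D e Om E -> copies D setT E.
Proof. by move=> e0 [_ Eh]; exists e => //; split. Qed.

(** Convexity and [p]-homogeneity at
    [u + v = s (s^-1 u) + (1 - s) ((1 - s)^-1 v)], with [s ^ (- p) = y]. *)
Lemma core_split y : 1 < y -> exists2 C, 0 <= C & quasi_subadditive p D alpha y C.
Proof.
move=> y1; have y0 : 0 < y := lt_trans ltr01 y1.
pose sg := y `^ p^-1; have sg1 : 1 < sg.
  have := @gt0_ltr_powR R p^-1 _ 1 y; rewrite invr_gt0 powR1; apply => //.
    by rewrite nnegrE.
  by rewrite nnegrE ltW.
have sg0 : 0 < sg := lt_trans ltr01 sg1.
pose s := sg^-1; have s0 : 0 < s by rewrite invr_gt0.
have s1 : s < 1 by rewrite invf_lt1.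
have t0 : 0 < 1 - s by rewrite subr_gt0.
have syE : `|s^-1| `^ p = y.
  by rewrite invrK (gtr0_norm sg0) -powRrM mulVf ?powRr1 ?(ltW y0)// gt_eqF.
exists ((1 - s) * `|(1 - s)^-1| `^ p); first by rewrite mulr_ge0 ?powR_ge0// ltW.
move=> u v E lu lv cE.
have E1 : (fun x => u x + v x) = (fun x => s *: (s^-1 *: u x) + (1 - s) *: ((1 - s)^-1 *: v x)).
  by apply/funext => x; rewrite !scalerA !mulfV ?gt_eqF// !scale1r.
rewrite E1.
have s01 : 0 <= s <= 1 by rewrite !ltW.
apply: le_trans (core_convex core (LplocZ s^-1 p0 lu) (LplocZ (1 - s)^-1 p0 lv) cE s01) _.
rewrite !(core_homogeneous core)// syE (mulrA (1 - s)) lerD2r ler_piMl//; last exact: ltW.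
by rewrite mulr_ge0 ?(ltW y0)// (core_ge0 core).
Qed.

Definition lin A := alpha (mulmx A) D.

Lemma lin_ge0 A : 0 <= lin A.
Proof. by apply: (core_ge0 core); [exact: Lploc_mulmx|exact: copies_self]. Qed.

(** A homothety turns [l^A] into [e l^A] plus a constant. *)
Lemma core_lin A e h : 0 < e ->
  alpha (mulmx A) (homothety e h @` D) = e `^ p * lin A.
Proof.
move=> e0; rewrite -(core_equivariant core)//; [|exact: Lploc_mulmx|exact: copies_self].
have -> : mulmx A \o homothety e h = (fun x => e *: (A *m x) + A *m h).
  by apply/funext => x; rewrite /homothety/= mulmxDr scalemxAr.
rewrite (core_translation core); [|exact: LplocZ (Lploc_mulmx p1 A)|exact: copies_self].
by rewrite (core_homogeneous core) ?(gtr0_norm e0)//; [exact: Lploc_mulmx|exact: copies_self].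
Qed.

Lemma linZ (t : R) A : lin (t *: A) = `|t| `^ p * lin A.
Proof.
rewrite /lin -(core_homogeneous core)//; [|exact: Lploc_mulmx|exact: copies_self].
by congr (alpha _ _); apply/funext => x; rewrite -scalemxAl.
Qed.

Lemma G_packsup e u Om :
  G p D alpha e u Om = ((e `^ (n%:R - p))%:E * packsup D (fun E => (alpha u E)%:E) e Om)%E.
Proof. by []. Qed.

Lemma G_mono e u Om Om' : Om `<=` Om' -> (G p D alpha e u Om <= G p D alpha e u Om')%E.
Proof.
move=> OO'; rewrite !G_packsup lee_wpmul2l ?lee_fin ?powR_ge0//; exact: packsup_mono.
Qed.

Lemma G_lin A e Om : 0 < e ->
  G p D alpha e (mulmx A) Om = ((lin A)%:E * dens D e Om)%E.
Proof.
move=> e0; rewrite G_packsup.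
rewrite (@eq_packsup _ _ _ _ (fun E => (e `^ p * lin A)%:E * cst 1 E)%E); last first.
  by move=> E [_ [h ->]]; rewrite core_lin// mule1.
rewrite packsupZ//; last by rewrite mulr_ge0 ?powR_ge0// lin_ge0.
rewrite /dens !muleA -!EFinM mulrA -powRD; last by apply/implyP => _; rewrite gt_eqF.
by rewrite subrK powR_mulrn ?(ltW e0)// mulrC.
Qed.

Section density.
Variables (del : R) (del0 : 0 <= del)
  (del_cvg : dens D e Q @[e --> 0^'+] --> del%:E).

(** With [del] the limit density, this is [psi A] ([psiE]). *)
Definition lim_lin A : R := lin A * del.

Lemma lim_lin_ge0 A : 0 <= lim_lin A.
Proof. by rewrite mulr_ge0// lin_ge0. Qed.

Lemma lim_linZ (t : R) A : lim_lin (t *: A) = `|t| `^ p * lim_lin A.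
Proof. by rewrite /lim_lin linZ mulrA. Qed.

(** Packings of a cube of side [r] at scale [e] are those of [Q] at scale
    [e / r]. *)
Lemma G_cube_cvg A r c : 0 < r ->
  G p D alpha e (mulmx A) (cube r c) @[e --> 0^'+] --> (lim_lin A * r ^+ n)%:E.
Proof.
move=> r0.
have scale_cvg : (fun e => e / r) @ 0^'+ --> (0 : R)^'+.
  move=> A' A0; have B0 : nbhs (0 : R) (fun y => 0 < y -> A' y) := A0.
  have cr : {for 0, continuous (fun a : R => a / r)}.
    by apply: continuousM; [exact: cvg_id|exact: cst_continuous].
  have B1 : nbhs (0 / r) (fun y : R => 0 < y -> A' y) by rewrite mul0r.
  have B : nbhs (0 : R) (fun a => 0 < a / r -> A' (a / r)) := cr _ B1.
  apply: (@filterS _ (nbhs (0 : R)) _ _ _ _ B) => a Ara a0.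
  by apply: Ara; rewrite divr_gt0.
have dc : dens D (e / r) Q @[e --> 0^'+] --> del%:E.
  exact: cvg_trans (cvg_app (fun e => dens D e Q) scale_cvg) del_cvg.
have dc' : ((lin A * r ^+ n)%:E * dens D (e / r) Q)%E @[e --> 0^'+] --> (lim_lin A * r ^+ n)%:E.
  have fl : (lin A * r ^+ n)%:E \is a fin_num by [].
  by rewrite /lim_lin mulrAC EFinM; exact: (cvgeZl fl dc).
have nE : {near 0^'+, (fun e => (lin A * r ^+ n)%:E * dens D (e / r) Q)%E =1
    (fun e => G p D alpha e (mulmx A) (cube r c))}.
  near=> e; have e0 : 0 < e by near: e; exact: nbhs_right_gt.
  rewrite G_lin// dens_cube//. rewrite [RHS]muleA; congr (_ * _)%E.
exact: cvg_trans (near_eq_cvg nE) dc'.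
Unshelve. all: by end_near. Qed.

Lemma psiE A : psi p D alpha A = (lim_lin A)%:E.
Proof.
have := @G_cube_cvg A 1 0 ltr01; rewrite -Q_cube expr1n mulr1.
by move=> /cvg_lim; exact.
Qed.

End density.

End core_functionals.

Section strong_core.
Context {R : realType} {n m : nat}.
Local Notation mu := (lebesgue_rn n).
Variables (p : R) (D : set 'cV[R]_n) (alpha : @functional R n m)
  (P N : {vspace 'M[R]_(m, n)}).
Hypotheses (p1 : 1 <= p) (oD : open D) (bD : bounded_set D)
  (strong : strong_p_core_with p D alpha P N).
Implicit Types (u v : 'cV[R]_n -> 'cV[R]_m) (V : 'cV[R]_n -> 'M[R]_(m, n))
  (A B : 'M[R]_(m, n)) (E Om : set 'cV[R]_n) (e r y : R) (h c : 'cV[R]_n).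

Let p0 : 0 <= p. Proof. exact: le_trans p1. Qed.
Let pgt0 : 0 < p. Proof. exact: lt_le_trans p1. Qed.
Let core : p_core p D alpha. Proof. by case: strong. Qed.
Let mD : measurable D. Proof. exact: mx_open_measurable. Qed.

Local Notation pi := (daddv_pi P N).

Lemma pi_idem A : pi (pi A) = pi A.
Proof.
by case: strong => _ _ _ PN _; exact: daddv_pi_proj.
Qed.

Lemma sub_pi_mem A : A - pi A \in N.
Proof.
case: strong => _ _ PNf PN _.
have AE : pi A + daddv_pi N P A = A by apply: daddv_pi_add; rewrite ?PNf ?memvf.
by rewrite -{1}AE addrAC subrr add0r memv_pi.
Qed.

(** The bound of the definition, transported from [D] to its copies by
    [DL_eq_homothety]. *)
Lemma core_energy : exists2 c3, 0 <= c3 & energy_bound p D alpha pi c3.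
Proof.
case: strong => _ _ _ _ [c3 c30 bound]; exists c3; first exact: ltW.
move=> u V e h e0 lu lV uV; have mV := Lploc_measurable lV.
have luh := Lploc_homothety h e0 lu.
have lVh : in_Lploc p setT (fun x => e *: V (homothety e h x)).
  exact: (LplocZ e p0 (Lploc_homothety h e0 lV)).
rewrite -(core_equivariant core _ _ (copies_self D))//.
have := bound _ (fun x => e *: V (homothety e h x)) luh.
have inW : in_WLp pi p D (u \o homothety e h) (fun x => e *: V (homothety e h x)).
  split.
  - by split; [exact: measurable_funTS (Lploc_measurable luh)|exact: (Lploc_pmass luh bD mD)].
  - by split; [exact: measurable_funTS (Lploc_measurable lVh)|exact: (Lploc_pmass lVh bD mD)].
  - exact: (DL_eq_homothety p1 e0 lu lV uV).
move=> /(_ inW) /le_trans; apply.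
have le1 : (pmass p D (fun x => e *: V (homothety e h x))%R <=
    (e `^ p)%:E * pmass p D (V \o homothety e h))%E.
  apply: pmass_le => //; first exact: ltW.
  - exact: measurable_funTS (Lploc_measurable lVh).
  - exact: measurable_funTS (measurableT_comp mV (measurable_homothety e h)).
  - by move=> x _; rewrite opnormZ gtr0_norm.
rewrite EFinM -muleA; apply: lee_wpmul2l; first by rewrite lee_fin ltW.
have Ee : e `^ p * e ^- n = e `^ (p - n%:R).
  by rewrite powRB ?powR_mulrn ?(ltW e0)//; apply/implyP => _; rewrite gt_eqF.
apply: (le_trans le1); rewrite (pmass_homothety p h e0 mD mV) muleA -EFinM Ee.
exact: lexx.
Qed.

Lemma lin_split y : 1 < y -> exists2 C, 0 <= C & forall A B,
  lin D alpha (A + B) <= y * lin D alpha A + C * lin D alpha B.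
Proof.
move=> y1; have [C C0 split] := core_split p1 core y1; exists C => // A B.
have := split _ _ D (Lploc_mulmx p1 A) (Lploc_mulmx p1 B) (copies_self D).
by apply: le_trans; rewrite le_eqVlt; apply/orP; left; apply/eqP; congr (alpha _ _);
  apply/funext => x; rewrite mulmxDl.
Qed.

(** [D_pi (l^A)] is the constant [pi A]. *)
Lemma lin_bound : exists2 K, 0 <= K & forall A, lin D alpha A <= K * opnorm A `^ p.
Proof.
have [c3 c30 energy] := core_energy.
have [k k0 kb] := linear_opnorm_bound pi.
have muD : mu D \is a fin_num by rewrite ge0_fin_numE//; exact: bounded_lebesgue_rn_lty.
exists (c3 * (k `^ p * fine (mu D))).
  by rewrite !mulr_ge0 ?powR_ge0// fine_ge0.
move=> A.
have dl : DL_eq pi (homothety 1 0 @` D) (mulmx A) (fun=> pi A).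
  move=> phi tphi; rewrite (DL_setT _ _ tphi) (distribution_setT _ tphi).
  by apply: (DL_mulmx _ p1); exact: test_sub tphi.
have := energy _ _ 1 0 ltr01 (Lploc_mulmx p1 A) (Lploc_cst p1 (pi A)) dl.
rewrite homothety10 image_id powR1 mulr1 -lee_fin => /le_trans; apply.
rewrite -mulrA EFinM lee_wpmul2l ?lee_fin//.
have := @pmass_bounded R n m n p D (fun=> pi A) (k * opnorm A) p0 mD (measurable_cst _) (fun x _ => kb A).
move=> /le_trans; apply.
rewrite -{1}(fineK muD) -EFinM lee_fin powRM ?opnorm_ge0//.
by rewrite mulrAC.
Qed.

Section density.
Variables (del : R) (del0 : 0 <= del)
  (del_cvg : dens D e Q @[e --> 0^'+] --> del%:E).

Local Notation F := (lim_lin D alpha del).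

Let F0 A : 0 <= F A. Proof. exact: (lim_lin_ge0 p1 core del0). Qed.

Lemma lim_lin_split y : 1 < y -> exists2 C, 0 <= C & forall A B, F (A + B) <= y * F A + C * F B.
Proof.
move=> /lin_split[C C0 split]; exists C => // A B.
by rewrite /lim_lin !mulrA -mulrDl ler_wpM2r.
Qed.

Lemma lim_lin_bound : exists2 K, 0 <= K & forall A, F A <= K * opnorm A `^ p.
Proof.
have [K K0 bK] := lin_bound; exists (K * del); first exact: mulr_ge0.
by move=> A; rewrite /lim_lin mulrAC ler_wpM2r.
Qed.

Lemma lim_lin_eq0 A : F A = 0 <-> A \in N.
Proof.
case: strong => _ NE _ _ _; rewrite NE (psiE p1 core del_cvg).
by split=> [->//|[]].
Qed.

Lemma le_of_scale (a b : R) : 0 <= b -> (forall y, 1 < y -> a <= y * b) -> a <= b.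
Proof.
rewrite le_eqVlt => /predU1P[<- h|b0 h]; first by have := h 2 (ltr1n _ 2); rewrite mulr0.
rewrite leNgt; apply/negP => ba; have := h ((a + b) / (2 * b)).
rewrite ltr_pdivlMr ?mulr_gt0// mul1r => /(_ _).
have -> : (a + b) / (2 * b) * b = (a + b) / 2 by field; rewrite gt_eqF.
by have -> : 2 * b < a + b by [lra]; move=> /(_ isT); lra.
Qed.

(** [A - pi A] is in [N], where [F] vanishes; let [y] tend to [1] in
    [lim_lin_split]. *)
Lemma lim_lin_pi A : F (pi A) = F A.
Proof.
have N1 := sub_pi_mem A; have /lim_lin_eq0 F1 := N1.
have N2 : pi A - A \in N by rewrite -opprB rpredN.
have /lim_lin_eq0 F2 := N2.
apply/eqP; rewrite eq_le; apply/andP; split; apply: le_of_scale => // y y1.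
  have [C C0 split] := lim_lin_split y1.
  by have := split A (pi A - A); rewrite F2 mulr0 addr0 addrC subrK.
have [C C0 split] := lim_lin_split y1.
by have := split (pi A) (A - pi A); rewrite F1 mulr0 addr0 addrC subrK.
Qed.

(** By [lim_lin_split] and [lim_lin_bound] the difference of [F A] and [F B] is
    controlled by [(y - 1) * F A] and [C * K * opnorm (A - B) ^ p]; choose [y]
    first, then the distance. *)
Lemma lim_lin_continuous : continuous F.
Proof.
have [K K0 bK] := lim_lin_bound.
move=> A; suff close del' : 0 < del' -> exists2 t, 0 < t &
    forall B, opnorm (A - B) < t -> `|F A - F B| < del'.
  move=> s /= /(nbhs_ballP (F A)) [e /= e0 es].
  have [t t0 tF] := close e e0.
  apply/nbhs_ballP; exists (t / ((m * n)%:R + 1)); first by rewrite /= divr_gt0.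
  move=> B /= AB; apply: es; rewrite /ball_ /=; apply: tF; apply: (le_lt_trans (opnorm_le_norm _)).
  move: AB; rewrite -ball_normE /ball_ /= ltr_pdivlMr// => AB; apply: le_lt_trans AB.
  by rewrite mulrC ler_wpM2l// lerDl.
move=> d0; pose y := 1 + del' / (2 * (F A + 1)).
have FA1 : 0 < F A + 1 by rewrite ltr_wpDl.
have y1 : 1 < y by rewrite ltrDl divr_gt0// mulr_gt0.
have [C C0 split] := lim_lin_split y1.
have CK0 : 0 <= C * K by rewrite mulr_ge0.
have CK1 : 0 < C * K + 1 by rewrite ltr_wpDl.
exists (Num.min 1 (del' / (2 * (C * K + 1)))).
  by rewrite lt_min ltr01 divr_gt0// mulr_gt0.
move=> B; rewrite lt_min => /andP[AB1 ABt].
have X1 : opnorm (A - B) `^ p <= opnorm (A - B).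
  by apply: (powR_le_id p1); [exact: opnorm_ge0|exact: ltW].
have X2 : C * K * opnorm (A - B) `^ p < del' / 2.
  apply: (@le_lt_trans _ _ ((C * K + 1) * opnorm (A - B))).
    by apply: ler_pM; rewrite ?powR_ge0// lerDl.
  by rewrite mulrC -ltr_pdivlMr// -mulrA -invfM.
have X3 : (y - 1) * F A < del' / 2.
  rewrite /y addrAC subrr add0r.
  have -> : del' / (2 * (F A + 1)) * F A = del' / 2 * (F A / (F A + 1)) by rewrite invfM; ring.
  by rewrite gtr_pMr ?divr_gt0// ltr_pdivrMr// mul1r ltrDl.
have F1 : F A <= y * F B + C * K * opnorm (A - B) `^ p.
  have := split B (A - B); rewrite addrC subrK => /le_trans; apply.
  by rewrite lerD2l -mulrA ler_wpM2l.
have F2 : F B <= y * F A + C * K * opnorm (A - B) `^ p.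
  have := split A (B - A); rewrite addrC subrK => /le_trans; apply.
  by rewrite -(opnormN (A - B)) opprB lerD2l -mulrA ler_wpM2l.
have y0 : 0 < y := lt_trans ltr01 y1.
rewrite ltr_norml; apply/andP; split; first by nra.
rewrite ltNge; apply/negP => h.
have FBA : F B <= F A - del' by lra.
have : F A <= y * (F A - del') + C * K * opnorm (A - B) `^ p.
  by apply: le_trans F1 _; rewrite lerD2r ler_pM2l.
nra.
Qed.

(** By homogeneity it suffices to bound [F] from below on the compact set of
    matrices of norm one in [P], where it is continuous and positive. *)
Lemma lim_lin_coercive : exists2 k, 0 < k & forall A, k * opnorm (pi A) `^ p <= F A.
Proof.
pose S : set 'M[R]_(m, n) := [set A | `|A| = 1 /\ pi A = A].
have cpi : continuous (fun A : 'M[R]_(m, n) => pi A) by exact: linear_mx_continuous.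
have cS : compact S.
  apply: mx_bounded_closed_compact.
    by exists 1; split; [exact: num_real|move=> M M1 A [A1 _]; rewrite /= A1; exact: ltW].
  have -> : S = (fun A : 'M[R]_(m, n) => `|A|) @^-1` [set 1] `&`
      (fun A : 'M[R]_(m, n) => `|pi A - A|) @^-1` [set 0].
    apply/seteqP; split=> A /= [A1 A2]; split=> //; first by rewrite A2 subrr normr0.
    by move/eqP: A2; rewrite normr_eq0 subr_eq0 => /eqP.
  apply: closedI; apply: closed_comp => [A _|]; try exact: closed_eq.
    exact: norm_continuous.
  apply: (@continuous_comp _ _ _ (fun A : 'M[R]_(m, n) => pi A - A) Num.norm).
    apply: (@continuousB R 'M[R]_(m, n) 'M[R]_(m, n) (fun A => pi A) id); first exact: cpi.
    exact: cvg_id.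
  exact: norm_continuous.
have [k k0 kS] : exists2 k, 0 < k & forall A, S A -> k <= F A.
  have cFS : closed (F @` S).
    apply: compact_closed; first exact: Rhausdorff.
    exact: continuous_compact (continuous_subspaceT lim_lin_continuous) cS.
  have n0 : (~` (F @` S)) 0.
    move=> [A [A1 A2]] /lim_lin_eq0 AN.
    case: strong => _ _ _ PN _.
    have : A \in (P :&: N)%VS by rewrite memv_cap AN andbT -A2 memv_pi.
    by rewrite PN memv0 => /eqP A0; move: A1; rewrite A0 normr0 => /eqP; rewrite eq_sym oner_eq0.
  have : nbhs 0 (~` (F @` S)) by apply: open_nbhs_nbhs; split=> //; rewrite openC.
  move=> /nbhs_ballP[e /= e0 eS]; exists e => // A SA; rewrite leNgt; apply/negP => FAe.
  by apply: (eS (F A)); [rewrite /ball/= sub0r normrN ger0_norm|exists A].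
pose M := (m * n)%:R + 1 : R; have M0 : 0 < M by rewrite ltr_wpDl.
have Mp0 : 0 < M `^ p by rewrite powR_gt0.
exists (k / M `^ p); first by rewrite divr_gt0.
move=> A; rewrite -lim_lin_pi; set B := pi A.
have piB : pi B = B by exact: pi_idem.
have [->|B0] := eqVneq B 0; first by rewrite opnorm0 powR0 ?mulr0// gt_eqF.
have nB0 : 0 < `|B| by rewrite normr_gt0.
have SB : S (`|B|^-1 *: B).
  split; last by rewrite linearZ/= piB.
  by rewrite normrZ normfV normr_id mulVf// gt_eqF.
have := kS _ SB; rewrite (lim_linZ p1 core) normfV normr_id => kB.
have BF : k * `|B| `^ p <= F B.
  have pB : 0 < `|B| `^ p by rewrite powR_gt0.
  have E1 : `|B|^-1 `^ p = (`|B| `^ p)^-1.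
    apply: (mulIf (lt0r_neq0 pB)); rewrite mulVf ?gt_eqF// -powRM ?invr_ge0 ?ltW//.
    by rewrite mulVf ?gt_eqF// powR1.
  by rewrite -ler_pdivlMr ?powR_gt0// mulrC -E1.
apply: le_trans BF; rewrite -mulrA ler_pM2l// ler_pdivrMl//.
rewrite -powRM ?(ltW M0) ?normr_ge0//; apply: ge0_ler_powR; rewrite ?nnegrE ?opnorm_ge0 ?mulr_ge0 ?(ltW M0)//.
by apply: (le_trans (opnorm_le_norm B)); rewrite ler_wpM2r// lerDl.
Qed.

End density.

End strong_core.

(** * Approximation by step functions on dyadic cubes *)

Section tails.
Context {R : realType} {n : nat}.
Local Notation mu := (lebesgue_rn n).

(** Dominated convergence: the restrictions of [g] to the [S j] tend to zero
    almost everywhere. *)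
Lemma tail_small (g : 'cV[R]_n -> \bar R) (S : nat -> set 'cV[R]_n) (e : R) :
  measurable_fun setT g -> (forall x, 0 <= g x)%E -> (\int[mu]_x g x < +oo)%E ->
  (forall j, measurable (S j)) ->
  {ae mu, forall x, exists k, forall j, (k <= j)%N -> ~ S j x} ->
  0 < e -> exists j, (\int[mu]_(x in S j) g x < e%:E)%E.
Proof.
move=> mg g0 goo mS Sae e0.
have ig : mu.-integrable setT g.
  by apply/integrableP; split=> //; under eq_integral do rewrite gee0_abs//.
have mSg j : measurable_fun setT (g \_ (S j)).
  by apply: (measurable_restrictT _ (mS j)).1; exact: measurable_funTS.
have Sg : {ae mu, forall x, setT x -> (g \_ (S j)) x @[j --> \oo] --> cst 0%E x}.
  apply: filterS Sae => x [k kS] _.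
  apply: cvg_near_cst; exists k => // j /= kj.
  by rewrite patchE; case: ifPn => //; rewrite inE => /(kS j kj).
have Sle : {ae mu, forall x j, setT x -> (`|(g \_ (S j)) x| <= g x)%E}.
  apply: aeW => x j _; rewrite patchE; case: ifPn => _; last by rewrite abse0.
  by rewrite gee0_abs.
have [_ _] := dominated_convergence measurableT mSg (measurable_cst _) Sg ig Sle.
rewrite integral0 => cv.
have : nbhs (0%E : \bar R) [set y | (y < e%:E)%E].
  by apply: open_nbhs_nbhs; split; [exact: open_ereal_lt_ereal|rewrite /= lte_fin].
move=> /cv [j _ /(_ j (leqnn j)) /= h]; exists j.
by rewrite integral_mkcond.
Qed.

Lemma tail_small_measure (X : set 'cV[R]_n) (S : nat -> set 'cV[R]_n) (e : R) :
  measurable X -> (mu X < +oo)%E -> (forall j, measurable (S j)) ->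
  (forall x, exists k, forall j, (k <= j)%N -> ~ S j x) ->
  0 < e -> exists j, (mu (X `&` S j) < e%:E)%E.
Proof.
move=> mX Xoo mS Sx e0.
have mI : measurable_fun setT (fun x => (\1_X x)%:E : \bar R).
  by apply/measurable_EFinP; exact: measurable_indic.
have I0 x : (0 <= (\1_X x)%:E :> \bar R)%E by rewrite lee_fin.
have Ioo : (\int[mu]_x (\1_X x)%:E < +oo)%E by rewrite integral_indic// setIT.
have [j jl] := tail_small mI I0 Ioo mS (aeW _ Sx) e0.
by exists j; move: jl; rewrite integral_indic.
Qed.

Lemma pmass_split {k l} p (f : 'cV[R]_n -> 'M[R]_(k, l)) X S :
  measurable X -> measurable S -> measurable_fun setT f ->
  pmass p X f = (pmass p (X `&` S) f + pmass p (X `\` S) f)%E.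
Proof.
move=> mX mS mf; rewrite /pmass -{1}(setUIDK X S) ge0_integral_setU//.
- exact: measurableI.
- exact: measurableD.
- by rewrite setUIDK; apply: measurable_pmass => //; exact: measurable_funTS.
- by move=> x _; rewrite lee_fin powR_ge0.
- by apply/disj_setPS => x [[_ Sx] [_ nSx]].
Qed.

End tails.

Section dyadic.
Context {R : realType} {n : nat}.
Local Notation mu := (lebesgue_rn n).
Implicit Types (x y : 'cV[R]_n) (k : nat).

Definition dyadic_index k x : {ffun 'I_n -> int} := [ffun i => Num.floor (2 ^+ k * x i 0)].

Definition dyadic {T} k (f : 'cV[R]_n -> T) :=
  forall x y, dyadic_index k x = dyadic_index k y -> f x = f y.

Lemma dyadic_indexS k x y :
  dyadic_index k.+1 x = dyadic_index k.+1 y -> dyadic_index k x = dyadic_index k y.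
Proof.
move=> /ffunP xy; apply/ffunP => i; rewrite !ffunE.
have half (t : R) (z : int) : (z <= Num.floor t) = (2 * z <= Num.floor (2 * t)).
  by rewrite !floor_ge_int intrM ler_pM2l.
have := xy i; rewrite !ffunE !exprS -!mulrA => E.
apply/eqP; rewrite eq_le; apply/andP; split; first by rewrite half -E -half.
by rewrite half E -half.
Qed.

Lemma dyadic_index_le k k' x y : (k <= k')%N ->
  dyadic_index k' x = dyadic_index k' y -> dyadic_index k x = dyadic_index k y.
Proof.
move=> /subnK <-; elim: (k' - k)%N => [//|j IH]; rewrite addSn => /dyadic_indexS; exact: IH.
Qed.

Lemma dyadic_le {T} k k' (f : 'cV[R]_n -> T) : (k <= k')%N -> dyadic k f -> dyadic k' f.
Proof. by move=> kk' df x y /(dyadic_index_le kk')/df. Qed.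

Lemma dyadic_comp {T U} k (f : 'cV[R]_n -> T) (g : T -> U) : dyadic k f -> dyadic k (g \o f).
Proof. by move=> df x y /df /= ->. Qed.

Lemma dyadic_comp2 {T T' U} k (f : 'cV[R]_n -> T) (f' : 'cV[R]_n -> T') (g : T -> T' -> U) :
  dyadic k f -> dyadic k f' -> dyadic k (fun x => g (f x) (f' x)).
Proof. by move=> df df' x y xy; rewrite (df _ _ xy) (df' _ _ xy). Qed.

(** The half-open dyadic cubes. *)
Definition cell k (z : {ffun 'I_n -> int}) : set 'cV[R]_n := [set x | dyadic_index k x = z].

Lemma measurable_cell k z : measurable (cell k z).
Proof.
rewrite (_ : cell k z = box (fun i => `[(2 ^- k * (z i)%:~R), (2 ^- k * (z i + 1)%:~R)[%classic)).
  by apply: measurable_box.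
have k0 : 0 < 2 ^+ k :> R by rewrite exprn_gt0.
apply/seteqP; split=> [x <- i|x xz].
  rewrite /= in_itv/= ffunE ler_pdivrMl// ltr_pdivlMl//; exact: floor_itv.
apply/ffunP => i; rewrite ffunE; apply: floor_def.
by have := xz i; rewrite /= in_itv/= ler_pdivrMl// ltr_pdivlMl.
Qed.

Lemma dyadic_measurable_set k (U : set 'cV[R]_n) : dyadic k U -> measurable U.
Proof.
move=> dU; have -> : U = \bigcup_z (if `[< cell k z `<=` U >] then cell k z else set0).
  apply/seteqP; split=> [x Ux|x [z _]].
    exists (dyadic_index k x) => //; rewrite asboolT//.
    by move=> y yx; rewrite (dU y x yx).
  by case: asboolP => // zU; exact: zU.
apply: countable_bigcupT_measurable => [|z]; first exact: countableP.
case: ifP => // _; exact: measurable_cell.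
Qed.

Lemma dyadic_measurable {d} {T : measurableType d} k (f : 'cV[R]_n -> T) :
  dyadic k f -> measurable_fun setT f.
Proof.
move=> df _ Y mY; rewrite setTI; apply: (@dyadic_measurable_set k).
by move=> x y xy; rewrite /preimage /= (df _ _ xy).
Qed.

(** Measurability is included so that these sets form a sigma-algebra. *)
Definition dyadic_approx (X A : set 'cV[R]_n) := measurable A /\
  forall e, 0 < e -> exists k U, [/\ dyadic k U,
    (mu (X `&` (A `\` U)) < e%:E)%E & (mu (X `&` (U `\` A)) < e%:E)%E].

Section approx_sets.
Variables (X : set 'cV[R]_n) (mX : measurable X) (Xoo : (mu X < +oo)%E).

Lemma measure_setI_lt S S1 S2 (e : R) : measurable S -> measurable S1 -> measurable S2 ->
  S `<=` S1 `|` S2 -> (mu (X `&` S1) < (e / 2)%:E)%E -> (mu (X `&` S2) < (e / 2)%:E)%E ->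
  (mu (X `&` S) < e%:E)%E.
Proof.
move=> mS m1 m2 SS S1e S2e.
apply: (@le_lt_trans _ _ (mu (X `&` S1) + mu (X `&` S2))%E); last first.
  by rewrite [e]splitr EFinD lteD.
apply: le_trans (measureU2 _ (measurableI _ _ mX m1) (measurableI _ _ mX m2)).
rewrite -setIUr; apply: le_measure; rewrite ?inE.
- exact: measurableI.
- by apply: measurableI => //; exact: measurableU.
- exact: setIS.
Qed.

Lemma dyadic_approxC A : dyadic_approx X A -> dyadic_approx X (~` A).
Proof.
move=> [mA aA]; split; first exact: measurableC.
move=> e /aA[k [U [dU AU UA]]]; exists k, (~` U); split.
- exact: (dyadic_comp not dU).
- by rewrite (_ : ~` A `\` ~` U = U `\` A)// !setDE setCK setIC.
- by rewrite (_ : ~` U `\` ~` A = A `\` U)// !setDE setCK setIC.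
Qed.

Lemma dyadic_approxU A B : dyadic_approx X A -> dyadic_approx X B -> dyadic_approx X (A `|` B).
Proof.
move=> [mA aA] [mB aB]; split; first exact: measurableU.
move=> e e0; have e20 : 0 < e / 2 by rewrite divr_gt0.
have [k [U [dU AU UA]]] := aA _ e20; have [k' [U' [dU' BU' U'B]]] := aB _ e20.
have mU := dyadic_measurable_set dU; have mU' := dyadic_measurable_set dU'.
exists (maxn k k'), (U `|` U'); split.
- exact: (dyadic_comp2 or (dyadic_le (leq_maxl _ _) dU) (dyadic_le (leq_maxr _ _) dU')).
- apply: measure_setI_lt AU BU'.
  + by apply: measurableD; exact: measurableU.
  + exact: measurableD.
  + exact: measurableD.
  + by move=> x [[Ax|Bx] nU]; [left|right]; split=> // Ux; apply: nU; [left|right].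
- apply: measure_setI_lt UA U'B.
  + by apply: measurableD; exact: measurableU.
  + exact: measurableD.
  + exact: measurableD.
  + by move=> x [[Ax|Bx] nU]; [left|right]; split=> // Ux; apply: nU; [left|right].
Qed.

Lemma dyadic_approx0 : dyadic_approx X set0.
Proof.
split=> // e e0; exists 0%N, set0; split=> //; rewrite setD0 setI0 measure0 lte_fin//.
Qed.

(** As [X] has finite measure, [F j] fills the union up to a small measure for
    some [j]. *)
Lemma dyadic_approx_lim (F : nat -> set 'cV[R]_n) : (forall j, dyadic_approx X (F j)) ->
  (forall j k, (j <= k)%N -> F j `<=` F k) -> dyadic_approx X (\bigcup_j F j).
Proof.
move=> aF ndF; have mF j : measurable (F j) by case: (aF j).
have mU : measurable (\bigcup_j F j) by exact: bigcup_measurable.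
split=> // e e0; have e20 : 0 < e / 2 by rewrite divr_gt0.
have ev x : exists k, forall j, (k <= j)%N -> ~ ((\bigcup_j F j) `\` F j) x.
  have [[k _ Fx]|nU] := pselect ((\bigcup_j F j) x); last by exists 0%N => j _ [].
  by exists k => j kj [_]; apply; exact: ndF kj _ Fx.
have [j jl] := tail_small_measure mX Xoo (fun j => measurableD mU (mF j)) ev e20.
have [_ /(_ _ e20)[k [U [dU FU UF]]]] := aF j.
have mU' := dyadic_measurable_set dU.
exists k, U; split=> //.
- apply: measure_setI_lt jl FU; [exact: measurableD|exact: measurableD|exact: measurableD|].
  by move=> x [Fx nU]; have [Fj|nFj] := pselect (F j x); [right|left].
- apply: (@le_lt_trans _ _ (mu (X `&` (U `\` F j)))); last first.
    by apply: lt_trans UF _; rewrite lte_fin ltr_pdivrMr// ltr_pMr// ltr1n.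
  apply: le_measure; rewrite ?inE.
  + by apply: measurableI => //; exact: measurableD.
  + by apply: measurableI => //; exact: measurableD.
  + by move=> x [Xx [Ux nF]]; split=> //; split=> // Fx; apply: nF; exists j.
Qed.

Lemma cell_small k x y i : dyadic_index k x = dyadic_index k y -> `|x i 0 - y i 0| < 2 ^- k.
Proof.
move=> /ffunP/(_ i); rewrite !ffunE => E.
have k0 : 0 < 2 ^+ k :> R by rewrite exprn_gt0.
have /andP[x1 x2] := floor_itv (2 ^+ k * x i 0); have /andP[y1 y2] := floor_itv (2 ^+ k * y i 0).
rewrite -(ltr_pM2l k0) mulfV ?gt_eqF// -{1}(gtr0_norm k0) -normrM mulrBr ltr_norml.
move: x1 x2 y1 y2; rewrite E !intrD; set f := (Num.floor _)%:~R => x1 x2 y1 y2.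
by apply/andP; split; lra.
Qed.

(** The union of the dyadic cubes of level [k] contained in [O]. *)
Definition dyadic_core k (O : set 'cV[R]_n) : set 'cV[R]_n :=
  [set x | forall y, dyadic_index k y = dyadic_index k x -> O y].

Lemma dyadic_dyadic_core k O : dyadic k (dyadic_core k O).
Proof. by move=> x y xy; rewrite /dyadic_core /= xy. Qed.

Lemma dyadic_core_sub k O : dyadic_core k O `<=` O.
Proof. by move=> x; exact. Qed.

Lemma dyadic_core_nd O k k' : (k <= k')%N -> dyadic_core k O `<=` dyadic_core k' O.
Proof. by move=> kk' x Ox y /(dyadic_index_le kk')/Ox. Qed.

Lemma dyadic_core_open O x : open O -> O x -> exists k, dyadic_core k O x.
Proof.
move=> oO Ox; have [e e0 eO] := open_cube_sub oO Ox.
have [k ke] : exists k : nat, 2 ^- k < e / 2.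
  exists (Num.truncn (e / 2)^-1); rewrite -[ltRHS]invrK ltf_pV2 ?posrE ?invr_gt0 ?divr_gt0 ?exprn_gt0//.
  by rewrite (lt_le_trans (truncnS_gt _))// -natrX ler_nat ltn_expl.
exists k => y yx; apply: eO; apply/in_cube => // i.
by apply: lt_trans (cell_small i yx) ke.
Qed.

Lemma dyadic_approx_open O : open O -> dyadic_approx X O.
Proof.
move=> oO; have -> : O = \bigcup_k dyadic_core k O.
  apply/seteqP; split=> [x Ox|x [k _]]; last exact: dyadic_core_sub.
  by have [k kx] := dyadic_core_open oO Ox; exists k.
apply: dyadic_approx_lim => [k|]; last exact: dyadic_core_nd.
split; first exact: (@dyadic_measurable_set k _ (@dyadic_dyadic_core k O)).
move=> e e0; exists k, (dyadic_core k O); split; first exact: dyadic_dyadic_core.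
- by rewrite setDv setI0 measure0 lte_fin.
- by rewrite setDv setI0 measure0 lte_fin.
Qed.

(** The approximable sets form a sigma-algebra containing the open sets. *)
Lemma measurable_dyadic_approx A : measurable A -> dyadic_approx X A.
Proof.
suff : @measurable _ 'cV[R]_n `<=` dyadic_approx X by apply.
apply: smallest_sub; last by move=> O; exact: dyadic_approx_open.
split; first exact: dyadic_approx0.
- by move=> B aB; rewrite setTD; exact: dyadic_approxC.
- move=> F aF.
  have -> : \bigcup_k F k = \bigcup_k (\big[setU/set0]_(i < k.+1) F i).
    by rewrite -bigcup_bigsetU_bigcup.
  apply: dyadic_approx_lim => [k|j k jk].
    elim: k.+1 => [|j IH]; first by rewrite big_ord0; exact: dyadic_approx0.
    by rewrite big_ord_recr; exact: dyadic_approxU.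
  by apply: subset_bigsetU.
Qed.

End approx_sets.

End dyadic.

Section field_approx.
Context {R : realType} {m n : nat}.
Local Notation mu := (lebesgue_rn n).
Variables (p : R) (p1 : 1 <= p) (X : set 'cV[R]_n) (mX : measurable X)
  (Xoo : (mu X < +oo)%E).
Implicit Types (V W : 'cV[R]_n -> 'M[R]_(m, n)) (A : set 'cV[R]_n) (M : 'M[R]_(m, n)).

Let p0 : 0 <= p. Proof. exact: le_trans p1. Qed.
Let pgt0 : 0 < p. Proof. exact: lt_le_trans p1. Qed.

Definition field_approx V := measurable_fun setT V /\
  forall e, 0 < e -> exists k W, dyadic k W /\ (pmass p X (fun x => V x - W x)%R < e%:E)%E.

Lemma measurable_mxB V W : measurable_fun setT V -> measurable_fun setT W ->
  measurable_fun setT (fun x => V x - W x).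
Proof.
move=> mV mW; apply: measurable_mxD => //.
have := measurable_mxZ (-1) mW; congr measurable_fun; apply/funext => x.
by rewrite scaleN1r.
Qed.

Lemma field_approx_indic A M : measurable A -> field_approx (fun x => \1_A x *: M).
Proof.
have mI B : measurable B -> measurable_fun setT (fun x : 'cV[R]_n => \1_B x *: M).
  move=> mB; apply: measurable_fun_mxE => i j; under eq_fun do rewrite mxE.
  by apply: measurable_funM => //; exact: measurable_indic.
move=> mA; split; first exact: mI.
move=> e e0; pose c := opnorm M `^ p + 1.
have c0 : 0 < c by rewrite ltr_wpDl// powR_ge0.
have e'0 : 0 < e / (2 * c) by rewrite divr_gt0// mulr_gt0.
have [_ /(_ _ e'0)[k [U [dU AU UA]]]] := measurable_dyadic_approx mX Xoo mA.
have mU := dyadic_measurable_set dU.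
exists k, (fun x => \1_U x *: M); split.
  move=> x y xy; rewrite !indicE; congr (_%:R *: M); congr nat_of_bool.
  by apply/idP/idP => /set_mem h; apply/mem_set; [rewrite -(dU _ _ xy)|rewrite (dU _ _ xy)].
pose S := (A `\` U) `|` (U `\` A).
have mS : measurable S by apply: measurableU; exact: measurableD.
have mV := measurable_mxB (mI _ mA) (mI _ mU).
have VS x : opnorm (\1_A x *: M - \1_U x *: M) <= opnorm M.
  rewrite -scalerBl opnormZ ler_piMl ?opnorm_ge0//.
  by rewrite !indicE; case: (_ \in _); case: (_ \in _); rewrite ?subrr ?subr0 ?sub0r ?normrN ?normr0 ?normr1.
have V0 x : (X `\` S) x -> opnorm (\1_A x *: M - \1_U x *: M) <= 0.
  move=> [_ nS]; have -> : \1_A x = \1_U x :> R.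
    rewrite !indicE; congr (_%:R); congr nat_of_bool.
    by apply/idP/idP => /set_mem h; apply/mem_set; apply: contrapT => h'; apply: nS; [left|right].
  by rewrite subrr opnorm0.
rewrite (pmass_split _ mX mS mV).
have mXS : measurable (X `&` S) by exact: measurableI.
have mXDS : measurable (X `\` S) by exact: measurableD.
have le1 := pmass_bounded p0 mXS (measurable_funTS mV) (fun x _ => VS x).
have le2 := pmass_bounded p0 mXDS (measurable_funTS mV) V0.
rewrite powR0 ?gt_eqF// mul0e in le2.
have le3 : (mu (X `&` S) <= (e / c)%:E)%E.
  rewrite /S setIUr (_ : e / c = e / (2 * c) + e / (2 * c)); last first.
    by field; rewrite gt_eqF.
  rewrite EFinD; apply: le_trans (measureU2 _ _ _) _.
  - by apply: measurableI => //; exact: measurableD.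
  - by apply: measurableI => //; exact: measurableD.
  - by apply: leeD; exact: ltW.
have le4 : ((opnorm M `^ p)%:E * mu (X `&` S) <= (opnorm M `^ p * (e / c))%:E)%E.
  by rewrite EFinM; apply: lee_wpmul2l => //; rewrite lee_fin powR_ge0.
apply: (@le_lt_trans _ _ ((opnorm M `^ p * (e / c))%:E + 0)%E).
  by apply: leeD => //; exact: le_trans le1 le4.
rewrite adde0 lte_fin mulrCA gtr_pMr// ltr_pdivrMr// mul1r.
by rewrite /c ltrDl ltr01.
Qed.

Lemma pmassD_lt V W e : measurable_fun setT V -> measurable_fun setT W ->
  (pmass p X V < (e / (2 * 2 `^ p))%:E)%E -> (pmass p X W < (e / (2 * 2 `^ p))%:E)%E ->
  (pmass p X (fun x => V x + W x)%R < e%:E)%E.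
Proof.
move=> mV mW Ve We; pose c : R := 2 `^ p; have c0 : 0 < c by rewrite powR_gt0.
apply: (le_lt_trans (pmassD p0 mX mV mW)).
rewrite -/c (_ : e%:E = c%:E * ((e / (2 * c))%:E + (e / (2 * c))%:E))%E; last first.
  rewrite -EFinD -EFinM; congr EFin; field.
  by rewrite gt_eqF.
have cf : c%:E \is a fin_num by [].
have cp : (0 < c%:E)%E by rewrite lte_fin.
rewrite (lte_pmul2l cf cp).
exact: (lteD Ve We).
Qed.

Lemma field_approxD V V' : field_approx V -> field_approx V' ->
  field_approx (fun x => V x + V' x).
Proof.
move=> [mV aV] [mV' aV']; split; first exact: measurable_mxD.
move=> e e0; have e'0 : 0 < e / (2 * 2 `^ p) by rewrite divr_gt0// mulr_gt0// powR_gt0.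
have [k [W [dW VW]]] := aV _ e'0; have [k' [W' [dW' VW']]] := aV' _ e'0.
have mW := dyadic_measurable dW; have mW' := dyadic_measurable dW'.
exists (maxn k k'), (fun x => W x + W' x); split.
  exact: (dyadic_comp2 +%R (dyadic_le (leq_maxl _ _) dW) (dyadic_le (leq_maxr _ _) dW')).
rewrite (_ : (fun x => _) = (fun x => (V x - W x) + (V' x - W' x))); last first.
  by apply/funext => x; rewrite opprD addrACA.
exact: (pmassD_lt (measurable_mxB mV mW) (measurable_mxB mV' mW') VW VW').
Qed.

Lemma field_approx_lim V : measurable_fun setT V ->
  (forall e, 0 < e -> exists2 V', field_approx V' & (pmass p X (fun x => V x - V' x)%R < e%:E)%E) ->
  field_approx V.
Proof.
move=> mV aV; split=> // e e0; have e'0 : 0 < e / (2 * 2 `^ p) by rewrite divr_gt0// mulr_gt0// powR_gt0.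
have [V' [mV' /(_ _ e'0)[k [W [dW VW]]]] VV'] := aV _ e'0.
have mW := dyadic_measurable dW.
exists k, W; split=> //.
rewrite (_ : (fun x => _) = (fun x => (V x - V' x) + (V' x - W x))); last first.
  by apply/funext => x; rewrite addrA subrK.
exact: (pmassD_lt (measurable_mxB mV mV') (measurable_mxB mV' mW) VV' VW).
Qed.

Lemma field_approx_sum (I : Type) (s : seq I) (F : I -> 'cV[R]_n -> 'M[R]_(m, n)) :
  (forall i, field_approx (F i)) -> field_approx (fun x => \sum_(i <- s) F i x).
Proof.
move=> aF; elim: s => [|i s IH].
  have := field_approx_indic 0 measurable0.
  by congr field_approx; apply/funext => x; rewrite big_nil scaler0.
have := field_approxD (aF i) IH.
by congr field_approx; apply/funext => x; rewrite big_cons.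
Qed.

Section quantize.
Variables (V : 'cV[R]_n -> 'M[R]_(m, n)) (mV : measurable_fun setT V) (N : nat).
(* the number of intervals of length [1 / (N + 1)] in [-(N + 1), N + 1[ *)
Let K := (2 * N.+1 * N.+1)%N.
Local Notation NR := (N.+1%:R : R).

Definition level (z : {ffun 'I_m * 'I_n -> 'I_K}) : 'M[R]_(m, n) :=
  \matrix_(i, j) ((z (i, j))%:R / NR - NR).

Definition level_set (z : {ffun 'I_m * 'I_n -> 'I_K}) : set 'cV[R]_n :=
  [set x | forall c : 'I_m * 'I_n, (z c)%:R / NR - NR <= V x c.1 c.2 < (z c)%:R / NR - NR + NR^-1].

(** Rounding down of the entries to multiples of [1 / (N + 1)] where they all
    lie in [-(N + 1), N + 1[, and zero elsewhere. *)
Definition quantize x := \sum_z \1_(level_set z) x *: level z.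

Definition overflow : set 'cV[R]_n := [set x | exists c : 'I_m * 'I_n, ~ (- NR <= V x c.1 c.2 < NR)].

Let NR0 : 0 < NR. Proof. by []. Qed.

Lemma measurable_entry_itv c (a b : R) : measurable [set x | a <= V x c.1 c.2 < b].
Proof.
have -> : [set x | a <= V x c.1 c.2 < b] = (fun x => V x c.1 c.2) @^-1` `[a, b[.
  by apply/seteqP; split=> x /=; rewrite in_itv.
rewrite -[X in measurable X]setTI; apply: (measurable_fun_entry c.1 c.2 measurableT mV) => //.
Qed.

Lemma measurable_level_set z : measurable (level_set z).
Proof.
rewrite (_ : level_set z = \bigcap_(c in [set: 'I_m * 'I_n])
  [set x | (z c)%:R / NR - NR <= V x c.1 c.2 < (z c)%:R / NR - NR + NR^-1]); last first.
  by apply/seteqP; split=> [x xz c _|x xz c]; [exact: xz|exact: (xz c)].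
by apply: fin_bigcap_measurable => [|c _]; [exact: finite_finset|exact: measurable_entry_itv].
Qed.

Lemma measurable_overflow : measurable overflow.
Proof.
rewrite (_ : overflow = \bigcup_(c in [set: 'I_m * 'I_n]) ~` [set x | - NR <= V x c.1 c.2 < NR]).
  apply: fin_bigcup_measurable => [|c _]; first exact: finite_finset.
  by apply: measurableC; exact: measurable_entry_itv.
by apply/seteqP; split=> [x [c xc]|x [c _ xc]]; exists c.
Qed.

Lemma field_approx_quantize : field_approx quantize.
Proof.
by apply: field_approx_sum => z; apply: field_approx_indic; exact: measurable_level_set.
Qed.

Lemma quantize_overflow x : overflow x -> quantize x = 0.
Proof.
move=> [c xc]; rewrite /quantize big1// => z _; rewrite indicE memNset ?scale0r//.
move=> /(_ c) /andP[z1 z2]; apply: xc; apply/andP; split.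
  by apply: le_trans z1; rewrite lerBrDr addrC subrr divr_ge0.
apply: (lt_le_trans z2).
have zK : (z c)%:R + 1 <= 2 * NR * NR by rewrite natr1 -!natrM ler_nat; exact: ltn_ord.
have -> : (z c)%:R / NR - NR + NR^-1 = ((z c)%:R + 1) / NR - NR by rewrite mulrDl mul1r addrAC.
by rewrite lerBlDr ler_pdivrMr// -mulr2n -[_ *+ 2]mulr_natl.
Qed.

Lemma quantize_close x : ~ overflow x -> opnorm (V x - quantize x) <= (m * n)%:R / NR.
Proof.
move=> nx; have Vx (c : 'I_m * 'I_n) : - NR <= V x c.1 c.2 < NR.
  by apply: contrapT => h; apply: nx; exists c.
have zK (c : 'I_m * 'I_n) : (Num.truncn (NR * (V x c.1 c.2 + NR)) < K)%N.
  have /andP[v1 v2] := Vx c.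
  rewrite -(ltr_nat R); apply: (@le_lt_trans _ _ (NR * (V x c.1 c.2 + NR))).
    by rewrite truncn_le// mulr_ge0// -lerBlDr sub0r.
  have -> : K%:R = NR * (NR + NR) by rewrite /K !natrM; ring.
  by rewrite ltr_pM2l// ltrD2r.
pose z : {ffun 'I_m * 'I_n -> 'I_K} := [ffun c => Ordinal (zK c)].
have xz : level_set z x.
  move=> c; rewrite ffunE /=; have /andP[v1 v2] := Vx c.
  have w0 : 0 <= NR * (V x c.1 c.2 + NR) by rewrite mulr_ge0// -lerBlDr sub0r.
  have := truncn_itv w0; set t := Num.truncn _ => /andP[t1 t2].
  apply/andP; split; first by rewrite lerBlDr ler_pdivrMr// mulrC.
  have -> : t%:R / NR - NR + NR^-1 = (t%:R + 1) / NR - NR by rewrite mulrDl mul1r addrAC.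
  by rewrite ltrBrDr ltr_pdivlMr// mulrC natr1.
have uniq_z z' : level_set z' x -> z' = z.
  move=> xz'; apply/ffunP => c; apply: val_inj => /=.
  have /andP[a1 a2] := xz c; have /andP[b1 b2] := xz' c.
  have h1 : (z c)%:R < (z' c).+1%:R :> R.
    have := le_lt_trans a1 b2; rewrite [ltRHS]addrAC ltrD2r.
    by rewrite -[X in _ + X]mul1r -mulrDl ltr_pM2r ?invr_gt0// natr1.
  have h2 : (z' c)%:R < (z c).+1%:R :> R.
    have := le_lt_trans b1 a2; rewrite [ltRHS]addrAC ltrD2r.
    by rewrite -[X in _ + X]mul1r -mulrDl ltr_pM2r ?invr_gt0// natr1.
  by move: h1 h2; rewrite !ltr_nat !ltnS => h1 h2; apply/eqP; rewrite eqn_leq h1 h2.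
have -> : quantize x = level z.
  rewrite /quantize (bigD1 z)//= indicE mem_set// scale1r big1 ?addr0// => z' z'z.
  by rewrite indicE memNset ?scale0r// => /uniq_z /eqP; apply/negP.
apply: (le_trans (opnorm_le_sum _)).
have le1 i j : `|(V x - level z) i j| <= NR^-1.
  rewrite !mxE; have /andP[a1 a2] := xz (i, j); rewrite ger0_norm ?subr_ge0//.
  by rewrite lerBlDr addrC ltW.
apply: (@le_trans _ _ (\sum_(i < m) \sum_(j < n) NR^-1)).
  by apply: ler_sum => i _; apply: ler_sum => j _; exact: le1.
by rewrite !sumr_const !card_ord -mulrnA -[leLHS]mulr_natl mulnC.
Qed.

End quantize.

Lemma overflow_nd V N N' : (N <= N')%N -> overflow V N' `<=` overflow V N.
Proof.
move=> NN' x [c xc]; exists c => /andP[v1 v2]; apply: xc; apply/andP; split.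
  by apply: le_trans v1; rewrite lerN2 ler_nat.
by apply: lt_le_trans v2 _; rewrite ler_nat.
Qed.

(** Rounding down the entries creates an error of at most a multiple of
    [1 / (N + 1)] where the entries are below [N + 1]; the rest is a tail of the
    energy. *)
Lemma field_approxP V : measurable_fun setT V -> (pmass p X V < +oo)%E -> field_approx V.
Proof.
move=> mV Voo; apply: field_approx_lim => // e e0.
have e20 : 0 < e / 2 by rewrite divr_gt0.
have muX : mu X \is a fin_num by rewrite ge0_fin_numE.
have muX0 : 0 <= fine (mu X) by rewrite fine_ge0.
have mOv j : measurable (overflow V j) by exact: measurable_overflow.
have mXOv j : measurable (X `&` overflow V j) by exact: measurableI.
have ev x : exists k, forall j, (k <= j)%N -> ~ (X `&` overflow V j) x.
  exists (Num.truncn `|V x|) => j kj [_ [c]]; apply.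
  have : `|V x c.1 c.2| < j.+1%:R.
    apply: le_lt_trans (entry_le_norm _ _ _) _; apply: lt_le_trans (truncnS_gt _) _.
    by rewrite ler_nat ltnS.
  by rewrite ltr_norml => /andP[/ltW -> ->].
pose g (x : 'cV[R]_n) := ((fun x => (opnorm (V x) `^ p)%:E) \_ X) x.
have mg : measurable_fun setT g.
  apply: (measurable_restrictT _ mX).1; apply: measurable_pmass => //; exact: measurable_funTS.
have g0 x : (0 <= g x)%E by rewrite /g patchE; case: ifP => _ //; rewrite lee_fin powR_ge0.
have goo : (\int[mu]_x g x < +oo)%E by rewrite -integral_mkcond.
have [j jl] := tail_small mg g0 goo mXOv (aeW _ ev) e20.
(* [B < N + 1] makes the rounding error at most one, and its total mass at
   most [e / 2] *)
pose r : R := (m * n)%:R; pose B : R := r + 2 * r * (fine (mu X) + 1) / e.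
pose N := maxn j (Num.truncn B).
have BN : B < N.+1%:R.
  by apply: lt_le_trans (truncnS_gt _) _; rewrite ler_nat ltnS leq_maxr.
have r0 : 0 <= r by [].
have m10 : 0 < fine (mu X) + 1 by rewrite ltr_wpDl.
have B2 : 0 <= 2 * r * (fine (mu X) + 1) / e by rewrite divr_ge0 ?(ltW e0)// mulr_ge0 ?(ltW m10)// mulr_ge0.
have rN1 : r / N.+1%:R <= 1 by rewrite ler_pdivrMr// mul1r; apply: ltW; apply: le_lt_trans BN; rewrite lerDl.
have rN2 : r / N.+1%:R * fine (mu X) <= e / 2.
  have h : 2 * r * (fine (mu X) + 1) / e <= N.+1%:R by apply: ltW; apply: le_lt_trans BN; rewrite lerDr.
  rewrite ler_pdivrMr// in h; rewrite mulrAC ler_pdivrMr//; nra.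
exists (quantize V N); first exact: field_approx_quantize.
have [mq _] := field_approx_quantize mV N.
have mVq := measurable_mxB mV mq.
have mXD : measurable (X `\` overflow V N) by exact: measurableD.
rewrite (pmass_split _ mX (mOv N) mVq) [e]splitr EFinD.
have le1 := pmass_bounded p0 mXD (measurable_funTS mVq)
    (fun x (h : (X `\` overflow V N) x) => quantize_close h.2).
have le2 : (((r / N.+1%:R) `^ p)%:E * mu (X `\` overflow V N) <= (e / 2)%:E)%E.
  apply: (@le_trans _ _ ((r / N.+1%:R)%:E * mu X)%E).
    apply: lee_pmul => //; first by rewrite lee_fin powR_ge0.
      by rewrite lee_fin (powR_le_id p1)// divr_ge0.
    by apply: le_measure; rewrite ?inE// => x [].
  by rewrite -(fineK muX) -EFinM lee_fin.
have le3 : (pmass p (X `&` overflow V N) (fun x => V x - quantize V N x)%R < (e / 2)%:E)%E.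
  apply: le_lt_trans jl.
  rewrite (_ : pmass _ _ _ = pmass p (X `&` overflow V N) V); last first.
    apply: eq_integral => x; rewrite inE => -[_ ox].
    by rewrite (quantize_overflow ox) subr0.
  rewrite (_ : (\int[mu]_(x in _) g x)%E = pmass p (X `&` overflow V j) V); last first.
    by apply: eq_integral => x; rewrite inE => -[Xx _]; rewrite /g patchE mem_set.
  apply: (subset_pmass p (mXOv N) (mXOv j)); first exact: measurable_funTS.
  move=> x [Xx ox]; split=> //; apply: overflow_nd ox; exact: leq_maxl.
apply: lte_leD; [|exact: le3|exact: le_trans le1 le2].
rewrite ge0_fin_numE; last exact: pmass_ge0.
apply: le_lt_trans le1 _.
by apply: le_lt_trans le2 _; rewrite ltry.
Qed.

End field_approx.

Section step_approximation.
Context {R : realType} {m n : nat}.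
Local Notation mu := (lebesgue_rn n).
Implicit Types (x c : 'cV[R]_n) (k : nat) (z : {ffun 'I_n -> int}).

Lemma sum_integral_le (s : seq 'cV[R]_n) (q : 'cV[R]_n -> set 'cV[R]_n) X
    (g : 'cV[R]_n -> \bar R) : uniq s -> (forall c, measurable (q c)) ->
  measurable X -> (forall c, c \in s -> q c `<=` X) ->
  (forall c c', c \in s -> c' \in s -> c != c' -> q c `&` q c' = set0) ->
  measurable_fun X g -> (forall x, 0 <= g x)%E ->
  (\sum_(c <- s) \int[mu]_(x in q c) g x <= \int[mu]_(x in X) g x)%E.
Proof.
move=> us mq mX qX qq mg g0.
have sX : \big[setU/set0]_(c <- s) q c `<=` X.
  by rewrite -bigcup_seq => x [c /= cs]; exact: qX.
rewrite -(@ge0_integral_bigsetU _ _ _ mu _ q g s)//.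
- by apply: ge0_subset_integral => //; exact: bigsetU_measurable.
- move=> c c' /= cs c's [x [qx q'x]]; apply: contrapT => /eqP cc'.
  by have := qq _ _ cs c's cc'; rewrite -subset0 => /(_ x); exact.
- exact: measurable_funS mg.
Qed.

Definition center k z : 'cV[R]_n := \col_i (2 ^- k * ((z i)%:~R + 2^-1)).

Let p2_gt0 k : 0 < 2 ^+ k :> R. Proof. by rewrite exprn_gt0. Qed.
Let m2_gt0 k : 0 < 2 ^- k :> R. Proof. by rewrite invr_gt0. Qed.

Lemma cube_center k z x : cube (2 ^- k) (center k z) x <->
  forall i, (z i)%:~R < 2 ^+ k * x i 0 < (z i)%:~R + 1.
Proof.
have E i : (`|x i 0 - center k z i 0| < 2 ^- k / 2) = ((z i)%:~R < 2 ^+ k * x i 0 < (z i)%:~R + 1).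
  rewrite mxE -(ltr_pM2l (p2_gt0 k)) -{1}(gtr0_norm (p2_gt0 k)) -normrM mulrBr !mulrA.
  rewrite mulfV ?gt_eqF// !mul1r ltr_distl.
  by congr (_ && _); apply/idP/idP => h; lra.
split=> [/(in_cube _ _ (m2_gt0 k)) xz i|xz]; first by rewrite -E.
by apply/in_cube => // i; rewrite E.
Qed.

Lemma cube_center_cell k z : cube (2 ^- k) (center k z) `<=` cell k z.
Proof.
move=> x /cube_center xz; apply/ffunP => i; rewrite ffunE; apply: floor_def.
by have /andP[/ltW -> ] := xz i; rewrite intrD.
Qed.

Lemma center_cell k z : cell k z (center k z).
Proof. by apply: cube_center_cell; exact: center_cube. Qed.

Lemma center_inj k : injective (center k).
Proof. by move=> z z' zz'; have := center_cell k z; rewrite zz' /cell /= center_cell. Qed.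

(** The walls of the dyadic grid. *)
Definition grid k : set 'cV[R]_n := [set x | exists (i : 'I_n) (z : int), 2 ^+ k * x i 0 = z%:~R].

(** A countable union of hyperplanes. *)
Lemma grid_negligible k : mu.-negligible (grid k).
Proof.
pose H (N : nat) : set 'cV[R]_n := if (choice.unpickle N : option ('I_n * int)) is Some (i, z)
  then box (fun j => if j == i then [set 2 ^- k * z%:~R] else setT) else set0.
apply: (@negligibleS _ _ _ _ (\bigcup_N H N)).
  move=> x [i [z xz]]; exists (choice.pickle (i, z)) => //; rewrite /H choice.pickleK => j.
  case: eqP => // -> /=; rewrite -xz mulrA mulVf ?mul1r// gt_eqF//.
apply: negligible_bigcup => N; rewrite /H.
case: (choice.unpickle N) => [[i z]|]; last exact: negligible_set0.
have mB j : measurable (if j == i then [set 2 ^- k * z%:~R] else setT : set R).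
  by case: ifP => // _; exact: measurable_set1.
apply/negligibleP; first exact: measurable_box.
apply: (eq_trans (lebesgue_rn_box mB)).
by rewrite (bigD1 i)//= eqxx lebesgue_measure_set1 mul0e.
Qed.

Lemma bounded_finite_index k (X : set 'cV[R]_n) : bounded_set X ->
  finite_set (dyadic_index k @` X).
Proof.
move=> /bounded_cube_sub[e e0 Xe].
pose M := (Num.truncn (2 ^+ k * e)).+1; pose K := (2 * M)%N.
have MK : 2 ^+ k * e < M%:R by exact: truncnS_gt.
apply: (@sub_finite_set _ _ ((fun w : {ffun 'I_n -> 'I_K} => [ffun i => (w i)%:Z - M%:Z]) @` setT)); last first.
  by apply: finite_image; exact: finite_finset.
move=> _ [x Xx <-].
have xe i : `|x i 0| < e.
  have := (in_cube _ _ e0).1 (Xe _ Xx) i; rewrite mxE subr0 => /lt_trans; apply.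
  by rewrite ltr_pdivrMr// ltr_pMr// ltr1n.
have fl i : (- M%:Z <= dyadic_index k x i) && (dyadic_index k x i < M%:Z).
  rewrite ffunE; have xm : `|2 ^+ k * x i 0| < M%:R.
    by rewrite normrM gtr0_norm//; apply: lt_trans MK; rewrite ltr_pM2l.
  move: xm; rewrite ltr_norml => /andP[x1 x2]; apply/andP; split.
    by rewrite floor_ge_int intrN ltW.
  by rewrite floor_lt_int.
have lt i : (`|(dyadic_index k x i + M%:Z)%R|%N < K)%N.
  have /andP[f1 f2] := fl i.
  rewrite -ltz_nat gez0_abs; last by rewrite -lerBlDr sub0r.
  by rewrite /K mul2n -addnn PoszD ltrD2r.
exists [ffun i => Ordinal (lt i)] => //; apply/ffunP => i; rewrite [LHS]ffunE [in LHS]ffunE /=.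
rewrite gez0_abs ?addrK//.
by have /andP[f1 _] := fl i; rewrite -lerBlDr sub0r.
Qed.

(** Intersecting [Om] with bounded boxes makes the dyadic cubes of each level
    finite in number. *)
Lemma dyadic_exhaust (Om : set 'cV[R]_n) x : open Om -> Om x ->
  exists k0, forall k, (k0 <= k)%N -> dyadic_core k (Om `&` [set x | forall i, `|x i 0| < k%:R]) x.
Proof.
move=> oO Ox; have [k1 k1x] := dyadic_core_open oO Ox.
exists (maxn k1 (Num.truncn `|x|).+2) => k; rewrite geq_max => /andP[k1k xk] y yx.
split; first exact: (dyadic_core_nd k1k k1x).
move=> i; rewrite -[y i 0](subrK (x i 0)).
apply: (le_lt_trans (ler_normD _ _)).
have y1 : `|y i 0 - x i 0| < 1.
  apply: lt_le_trans (cell_small i yx) _; rewrite invf_le1// exprn_ege1//.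
  by rewrite ler1n.
have x1 : `|x i 0| < (Num.truncn `|x|).+1%:R.
  exact: le_lt_trans (entry_le_norm _ _ _) (truncnS_gt _).
have : (Num.truncn `|x|).+2%:R <= k%:R :> R by rewrite ler_nat.
by rewrite -natr1; lra.
Qed.

Variables (p : R) (p1 : 1 <= p).

(** Approximate [V] by a dyadic step field on a bounded union of dyadic cubes.
    The faces of the cubes are negligible, so shrinking the cubes by a factor
    [th] close to one costs little energy; the gap between a shrunk cube and
    the cube leaves room for the copies which meet the former. *)
Lemma step_approx (Om : set 'cV[R]_n) (V : 'cV[R]_n -> 'M[R]_(m, n)) e :
  open Om -> measurable_fun setT V -> (pmass p setT V < +oo)%E -> 0 < e ->
  exists r th (s : seq 'cV[R]_n) (W : 'cV[R]_n -> 'M[R]_(m, n)),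
  [/\ 0 < r, 0 < th < 1 & uniq s] /\
  [/\ forall c, c \in s -> cube r c `<=` Om,
      forall c c', c \in s -> c' \in s -> c != c' -> cube r c `&` cube r c' = set0,
      (\sum_(c <- s) pmass p (cube r c) (fun x => V x - W c)%R < e%:E)%E &
      (pmass p (Om `\` \bigcup_(c in [set` s]) cube (th * r) c) V < e%:E)%E].
Proof.
move=> oO mV Voo e0; have e20 : 0 < e / 2 by rewrite divr_gt0.
have mO := mx_open_measurable oO.
have mg := measurable_pmass p measurableT mV.
have g0 (x : 'cV[R]_n) : (0 <= (opnorm (V x) `^ p)%:E)%E by rewrite lee_fin powR_ge0.
pose B k : set 'cV[R]_n := [set x | forall i, `|x i 0| < k%:R].
pose Xk k := dyadic_core k (Om `&` B k).
have dX k : dyadic k (Xk k) by exact: dyadic_dyadic_core.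
have mX k : measurable (Xk k) by exact: (@dyadic_measurable_set _ _ k _ (dX k)).
have XO k : Xk k `<=` Om by move=> x /dyadic_core_sub[].
have bX k : bounded_set (Xk k).
  exists k%:R; split; first exact: num_real.
  move=> M kM x /dyadic_core_sub[_ xk] /=; apply: norm_le_entries.
    by apply: le_trans (ltW kM).
  by move=> i j; rewrite ord1; apply: ltW; apply: lt_trans (xk i) kM.
have [k0 k0l] : exists k0, (pmass p (Om `\` Xk k0) V < (e / 2)%:E)%E.
  apply: (tail_small mg g0 Voo _ _ e20) => [k|]; first exact: measurableD.
  apply: aeW => x; have [Ox|nO] := pselect (Om x); last by exists 0%N => j _ [].
  have [k0 kx] := dyadic_exhaust oO Ox.
  by exists k0 => j kj [_]; apply; exact: kx.
pose X := Xk k0; have mX0 : measurable X by exact: mX.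
have Xoo : (mu X < +oo)%E by apply: bounded_lebesgue_rn_lty; [exact: mX|exact: bX].
have VX : (pmass p X V < +oo)%E by apply: le_lt_trans Voo; exact: subset_pmass.
have [_ /(_ _ e0)[k1 [W [dW1 VW]]]] := field_approxP p1 mX0 Xoo mV VX.
pose k := maxn k0 k1.
have dW : dyadic k W by exact: dyadic_le (leq_maxr _ _) dW1.
have dXk : dyadic k X by exact: dyadic_le (leq_maxl _ _) (dX k0).
pose Z := dyadic_index k @` X.
have fZ : finite_set Z by apply: bounded_finite_index; exact: bX.
pose s := [seq center k z | z <- fset_set Z].
have sP c : c \in s -> exists2 z, Z z & c = center k z.
  by move=> /mapP[z zZ ->]; exists z => //; move: zZ; rewrite in_fset_set// inE.
have cX c : c \in s -> cube (2 ^- k) c `<=` X.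
  move=> /sP[z [x Xx xz] ->] y /cube_center_cell yz.
  by rewrite (dXk y x)// yz xz.
have disj c c' : c \in s -> c' \in s -> c != c' -> cube (2 ^- k) c `&` cube (2 ^- k) c' = set0.
  move=> /sP[z _ ->] /sP[z' _ ->] cc'; rewrite -subset0 => x [/cube_center_cell xz /cube_center_cell xz'].
  by move/eqP: cc'; apply; rewrite -xz -xz'.
have us : uniq s by rewrite map_inj_uniq ?fset_uniq//; exact: center_inj.
(* off the faces, a point of a cube is in the shrunk cube for large [j] *)
pose th j : R := 1 - j.+2%:R^-1.
have th01 j : 0 < th j < 1.
  by rewrite subr_gt0 invf_lt1// ltr1n/= ltrBlDr ltrDl invr_gt0.
have thr j : 0 < th j * 2 ^- k by have /andP[t0 _] := th01 j; rewrite mulr_gt0.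
pose S j := X `\` \bigcup_(c in [set` s]) cube (th j * 2 ^- k) c.
have mU j : measurable (\bigcup_(c in [set` s]) cube (th j * 2 ^- k) c).
  by apply: fin_bigcup_measurable => [|c _]; [exact: finite_seq|exact: measurable_cube].
have mS j : measurable (S j) by exact: measurableD.
have [j jl] : exists j, (pmass p (S j) V < (e / 2)%:E)%E.
  apply: (tail_small mg g0 Voo mS _ e20).
  apply: (@negligibleS _ _ _ _ (grid k)); last exact: grid_negligible.
  move=> x /= nev; apply: contrapT => ng; apply: nev.
  have [Xx|nX] := pselect (X x); last by exists 0%N => j _ [].
  pose z := dyadic_index k x.
  have xc : cube (2 ^- k) (center k z) x.
    apply/cube_center => i; have /andP[x1 x2] := floor_itv (2 ^+ k * x i 0).
    rewrite ffunE -[X in _ + X]/(1%:~R) -intrD x2 andbT lt_neqAle x1 andbT.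
    by apply/eqP => E; apply: ng; exists i, (Num.floor (2 ^+ k * x i 0)).
  have zs : center k z \in s by apply: map_f; rewrite in_fset_set// inE; exists x.
  have nx : `|center k z - x| < 2 ^- k / 2.
    have bc : ball (center k z) (2 ^- k / 2) = cube (2 ^- k) (center k z).
      by rewrite ball_cube ?divr_gt0//; congr cube; rewrite mulrCA mulfV ?mulr1.
    by move: xc; rewrite -bc -ball_normE.
  pose eta := 1 - `|center k z - x| / (2 ^- k / 2).
  have eta0 : 0 < eta by rewrite subr_gt0 ltr_pdivrMr// mul1r.
  exists (Num.truncn eta^-1) => j etaj [_]; apply; exists (center k z) => //.
  apply/in_cube => // i; apply: (@le_lt_trans _ _ `|center k z - x|).
    by rewrite distrC; apply: le_trans (entry_le_norm (center k z - x) i 0); rewrite !mxE.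
  have je : j.+2%:R^-1 < eta.
    rewrite -[ltRHS]invrK ltf_pV2 ?posrE ?invr_gt0//.
    by apply: lt_le_trans (truncnS_gt _) _; rewrite ler_nat ltnS (leq_trans etaj).
  have : `|center k z - x| / (2 ^- k / 2) < th j by rewrite /th ltrBrDr addrC -ltrBrDr.
  by rewrite ltr_pdivrMr// mulrA.
exists (2 ^- k), (th j), s, W; split; first by split.
split.
- by move=> c cs; apply: subset_trans (cX c cs) (XO k0).
- exact: disj.
- apply: le_lt_trans VW.
  rewrite big_seq (eq_bigr (fun c => pmass p (cube (2 ^- k) c) (fun x => V x - W x)%R)); last first.
    move=> c /sP[z _ ->]; apply: eq_integral => x; rewrite inE => /cube_center_cell xz.
    by rewrite (dW (center k z) x)// center_cell.
  rewrite -big_seq; apply: (sum_integral_le us _ mX0 cX disj).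
  - by move=> c; exact: measurable_cube.
  - apply: measurable_funTS; apply: (measurable_pmass p measurableT).
    apply: (measurable_mxB mV); exact: (@dyadic_measurable _ _ _ _ k).
  - by move=> x; rewrite lee_fin powR_ge0.
- have mOU : measurable (Om `\` \bigcup_(c in [set` s]) cube (th j * 2 ^- k) c).
    exact: measurableD.
  rewrite (pmass_split p mOU mX0 mV) [e]splitr EFinD; apply: lteD.
    apply: le_lt_trans jl; apply: subset_pmass.
    + exact: measurableI.
    + exact: mS.
    + exact: measurable_funTS.
    + by move=> x [[Ox nU] Xx].
  apply: le_lt_trans k0l; apply: subset_pmass.
  + exact: measurableD.
  + exact: measurableD.
  + exact: measurable_funTS.
  + by move=> x [[Ox nU] nX].
Qed.

End step_approximation.

(** * Estimates of the seminorm *)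

Lemma mem_In (T : eqType) (x : T) (s : seq T) : x \in s -> List.In x s.
Proof.
by elim: s => [//|a s IH]; rewrite inE => /predU1P[->|/IH xs]; [left|right].
Qed.

Section G_estimates.
Context {R : realType} {n m : nat}.
Local Notation mu := (lebesgue_rn n).
Variables (p : R) (D : set 'cV[R]_n) (alpha : @functional R n m).
Hypotheses (p1 : 1 <= p) (oD : open D) (bD : bounded_set D) (D0 : D !=set0)
  (core : p_core p D alpha).
Implicit Types (u v : 'cV[R]_n -> 'cV[R]_m) (V : 'cV[R]_n -> 'M[R]_(m, n))
  (A : 'M[R]_(m, n)) (E Om X : set 'cV[R]_n) (e r y : R) (h c : 'cV[R]_n).

Let p0 : 0 <= p. Proof. exact: le_trans p1. Qed.

Lemma alpha_ge0 u e Om E : 0 < e -> in_Lploc p setT u -> copies_at D e Om E ->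
  (0 <= (alpha u E)%:E)%E.
Proof.
by move=> e0 lu cE; rewrite lee_fin (core_ge0 core)//; exact: copies_at_copies cE.
Qed.

Lemma G_ge0 e u Om : (0 <= G p D alpha e u Om)%E.
Proof. by rewrite G_packsup mule_ge0 ?packsup_ge0// lee_fin powR_ge0. Qed.

Lemma G_le_scale e u Om (z : \bar R) : 0 < e ->
  (packsup D (fun E => (alpha u E)%:E) e Om <= (e `^ (p - n%:R))%:E * z)%E ->
  (G p D alpha e u Om <= z)%E.
Proof.
move=> e0 h; rewrite G_packsup.
have -> : z = ((e `^ (n%:R - p))%:E * ((e `^ (p - n%:R))%:E * z))%E.
  rewrite muleA -EFinM -powRD; last by apply/implyP => _; rewrite gt_eqF.
  by rewrite addrA subrK subrr powRr0 mul1e.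
by apply: lee_wpmul2l h; rewrite lee_fin powR_ge0.
Qed.

Lemma G_split y C : 0 <= y -> 0 <= C -> quasi_subadditive p D alpha y C ->
  forall e u v Om, 0 < e -> in_Lploc p setT u -> in_Lploc p setT v ->
  (G p D alpha e (fun x => u x + v x)%R Om <=
    y%:E * G p D alpha e u Om + C%:E * G p D alpha e v Om)%E.
Proof.
move=> y0 C0 split e u v Om e0 lu lv; rewrite !G_packsup.
rewrite (muleCA y%:E) (muleCA C%:E) -ge0_muleDr ?mule_ge0 ?packsup_ge0 ?lee_fin//.
apply: lee_wpmul2l; first by rewrite lee_fin powR_ge0.
apply: ge_ereal_sup => _ [F dF <-]; have [FO tF] := dF.
have au E : F E -> (0 <= (alpha u E)%:E)%E by move=> /FO; exact: alpha_ge0.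
have av E : F E -> (0 <= (alpha v E)%:E)%E by move=> /FO; exact: alpha_ge0.
apply: (@le_trans _ _ (\esum_(E in F) (y%:E * (alpha u E)%:E + C%:E * (alpha v E)%:E))%E).
  apply: le_esum => E FE; rewrite -!EFinM -EFinD lee_fin; apply: split => //.
  exact: copies_at_copies (FO _ FE).
rewrite esumD => [|E FE|E FE]; last 2 first.
- by rewrite mule_ge0 ?lee_fin//; exact: au.
- by rewrite mule_ge0 ?lee_fin//; exact: av.
rewrite !esumZ//; apply: leeD; apply: lee_wpmul2l; rewrite ?lee_fin//; exact: packsup_ub.
Qed.

Lemma G_opp e u Om : 0 < e -> in_Lploc p setT u ->
  G p D alpha e (fun x => (-1) *: u x) Om = G p D alpha e u Om.
Proof.
move=> e0 lu; rewrite !G_packsup; congr (_ * _)%E; apply: eq_packsup => E cE.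
rewrite (core_homogeneous core)//; last exact: copies_at_copies cE.
by rewrite normrN1 powR1 mul1r.
Qed.

(** Packings of disjoint sets combine. *)
Lemma G_superadd (s : seq 'cV[R]_n) (q : 'cV[R]_n -> set 'cV[R]_n) e u Om :
  0 < e -> in_Lploc p setT u -> uniq s -> (forall c, c \in s -> q c `<=` Om) ->
  (forall c c', c \in s -> c' \in s -> c != c' -> q c `&` q c' = set0) ->
  (\sum_(c <- s) G p D alpha e u (q c) <= G p D alpha e u Om)%E.
Proof.
move=> e0 lu us qO qq.
rewrite (eq_bigr (fun c => (e `^ (n%:R - p))%:E * packsup D (fun E => (alpha u E)%:E) e (q c))%E) => [|c _]; last by rewrite G_packsup.
rewrite -ge0_sume_distrr => [|c _]; last exact: packsup_ge0.
rewrite G_packsup; apply: lee_wpmul2l; first by rewrite lee_fin powR_ge0.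
apply: (packsup_superadd D0 oD) => // E; exact: alpha_ge0.
Qed.

Section energy.
Variables (L : {linear 'M[R]_(m, n) -> 'M[R]_(m, n)}) (c3 : R) (c30 : 0 <= c3).
Hypothesis energy : energy_bound p D alpha L c3.

Lemma esum_energy e u V Om X (F : set (set 'cV[R]_n)) : 0 < e ->
  in_Lploc p setT u -> in_Lploc p setT V -> DL_eq L Om u V ->
  disjoint_families D e Om F -> measurable X -> (forall E, F E -> E `<=` X) ->
  (\esum_(E in F) (alpha u E)%:E <= (e `^ (p - n%:R))%:E * (c3%:E * pmass p X V))%E.
Proof.
move=> e0 lu lV uV [FO tF] mX FX; have mV := Lploc_measurable lV.
have ce0 : 0 <= c3 * e `^ (p - n%:R) by rewrite mulr_ge0 ?powR_ge0.
apply: (@le_trans _ _ (\esum_(E in F) ((c3 * e `^ (p - n%:R))%:E * pmass p E V))%E).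
  apply: le_esum => E /FO[EO [h Eh]]; rewrite Eh; apply: energy => //.
  by apply: DL_eq_sub_dom uV; rewrite -Eh.
rewrite esumZ => [|//|E _]; last exact: pmass_ge0.
rewrite muleA -EFinM [(e `^ _ * _)%R]mulrC; apply: lee_wpmul2l; first by rewrite lee_fin.
apply: esum_integral_le => //.
- move=> E FE; split; last exact: FX.
  by apply: mx_open_measurable; have [] := copies_atP D0 oD (FO _ FE) e0.
- by apply: measurable_pmass => //; exact: measurable_funTS.
- by move=> x; rewrite lee_fin powR_ge0.
Qed.

(** Summed over a packing, the powers of [e] in [energy] and in [G] cancel. *)
Lemma G_energy e u V Om : 0 < e -> open Om ->
  in_Lploc p setT u -> in_Lploc p setT V -> DL_eq L Om u V ->
  (G p D alpha e u Om <= c3%:E * pmass p Om V)%E.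
Proof.
move=> e0 oO lu lV uV; apply: G_le_scale => //; apply: ge_ereal_sup => _ [F dF <-].
apply: (esum_energy e0 lu lV uV dF); first exact: mx_open_measurable.
by case: dF => FO _ E /FO[].
Qed.

(** A copy which meets one of the smaller cubes lies in the larger one, when
    [e] is small; the others carry little energy. *)
Lemma G_cover (s : seq 'cV[R]_n) r th u V Om : 0 < r -> 0 < th < 1 -> open Om ->
  in_Lploc p setT u -> in_Lploc p setT V -> DL_eq L Om u V ->
  \forall e \near 0^'+,
  (G p D alpha e u Om <= \sum_(c <- s) G p D alpha e u (cube r c) +
    c3%:E * pmass p (Om `\` \bigcup_(c in [set` s]) cube (th * r) c) V)%E.
Proof.
move=> r0 /andP[th0 th1] oO lu lV uV; have [l l0 Dl] := bounded_cube_sub bD.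
have thr0 : 0 < th * r by rewrite mulr_gt0.
have e0P : 0 < (1 - th) * r / (2 * l).
  by rewrite divr_gt0 ?mulr_gt0// subr_gt0.
near=> e; have e0 : 0 < e by near: e; exact: nbhs_right_gt.
have el : e < (1 - th) * r / (2 * l) by near: e; exact: nbhs_right_lt.
(* in each coordinate, two points of a copy are at distance less than [e * l],
   which is less than half the difference of the sides of the two cubes *)
have geo E c x : copies_at D e Om E -> E x -> cube (th * r) c x -> E `<=` cube r c.
  move=> [_ [h Eh]]; rewrite Eh => -[a Da <-] xc _ [b Db <-].
  apply/in_cube => // i.
  have := (in_cube c _ thr0).1 xc i; rewrite !homothetyE => h1.
  have a1 : `|a i 0| < l / 2 by have := (in_cube _ _ l0).1 (Dl _ Da) i; rewrite mxE subr0.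
  have b1 : `|b i 0| < l / 2 by have := (in_cube _ _ l0).1 (Dl _ Db) i; rewrite mxE subr0.
  have ab : `|b i 0 - a i 0| < l by rewrite (le_lt_trans (ler_normB _ _))// [ltRHS]splitr ltrD.
  have -> : e * b i 0 + h i 0 - c i 0 = e * (b i 0 - a i 0) + (e * a i 0 + h i 0 - c i 0) by ring.
  apply: (le_lt_trans (ler_normD _ _)); rewrite normrM (gtr0_norm e0).
  have h2 : e * `|b i 0 - a i 0| < e * l by rewrite ltr_pM2l.
  have h3 : e * (2 * l) < (1 - th) * r by rewrite -ltr_pdivlMr// mulr_gt0.
  by move: h1 h2 h3; set t1 := `|_|; set t2 := e * `|_| => h1 h2 h3; lra.
apply: G_le_scale => //; apply: ge_ereal_sup => _ [F dF <-]; have [FO tF] := dF.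
pose B c : set (set 'cV[R]_n) := [set E | E `<=` cube r c].
apply: (le_trans (esum_cover s B (fun E (FE : F E) => alpha_ge0 e0 lu (FO _ FE)))).
rewrite ge0_muleDr; last 2 first.
- by apply: sume_ge0 => c _; exact: G_ge0.
- by rewrite mule_ge0 ?lee_fin ?pmass_ge0.
apply: leeD; last first.
  apply: (esum_energy e0 lu lV uV (disjoint_familiesI _ dF)).
    apply: measurableD; first exact: mx_open_measurable.
    apply: fin_bigcup_measurable => [|c _]; [exact: finite_seq|exact: measurable_cube].
  move=> E [FE nE] x Ex; split; first by have [EO _] := FO _ FE; exact: EO.
  move=> [c /= cs xc]; apply: (nE c); last exact: geo (FO _ FE) Ex xc.
  exact: mem_In.
rewrite ge0_sume_distrr => [|c _]; last exact: G_ge0.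
apply: lee_sum => c _; rewrite G_packsup muleA -EFinM -powRD; last by apply/implyP => _; rewrite gt_eqF.
rewrite addrA subrK subrr powRr0 mul1e; apply: packsup_ub.
split; last by apply: sub_trivIset tF; exact: subIsetl.
by move=> E [/FO[_ Eh] Ec]; split.
Unshelve. all: by end_near. Qed.

End energy.

End G_estimates.

(** * Convergence and exhaustion *)

(** The limit follows by letting [y] tend to [1] and [t] to [0]. *)
Lemma cvg_of_bounds {R : realType} (g : R -> \bar R) (I : R) : 0 <= I ->
  (\forall e \near 0^'+, 0 <= g e)%E ->
  (forall y t, 1 < y -> 0 < t -> \forall e \near 0^'+,
    (g e <= (y ^+ 2 * I + t)%:E)%E /\ (I%:E <= (y ^+ 2)%:E * g e + t%:E)%E) ->
  g e @[e --> 0^'+] --> I%:E.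
Proof.
move=> I0 g0 gI.
have bounds (eta : R) : 0 < eta -> \forall e \near 0^'+,
    ((I - eta)%:E <= g e)%E /\ (g e <= (I + eta)%:E)%E.
  (* so that [d <= 1] and [3 * d * I <= eta / 2] *)
  move=> eta0; pose d := eta / (eta + 6 * (I + 1)).
  have den0 : 0 < eta + 6 * (I + 1) by lra.
  have d0 : 0 < d by rewrite divr_gt0.
  have dE : d * (eta + 6 * (I + 1)) = eta by rewrite divfK// gt_eqF.
  have y2 : (1 + d) ^+ 2 <= 1 + 3 * d by rewrite sqrrD expr1n !mul1r; nra.
  have y20 : 1 <= (1 + d) ^+ 2 by nra.
  have := gI (1 + d) (eta / 2) ltac:(lra) ltac:(lra).
  move: y2 y20; set q := (1 + d) ^+ 2 => y2 y20 gI'.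
  near=> e; have [gu gl] : ((g e <= (q * I + eta / 2)%:E) /\ (I%:E <= q%:E * g e + (eta / 2)%:E))%E.
    by near: e.
  have ge0 : (0 <= g e)%E by near: e.
  move: (g e) ge0 gu gl => [z||] ge0 gu gl; [|by []|by []].
  rewrite !lee_fin; rewrite -EFinM -EFinD !lee_fin in ge0 gu gl; nra.
apply/fine_cvgP; split.
  have := bounds 1 ltr01; apply: filterS => e [a b].
  by rewrite fin_numE; move: a b; case: (g e).
apply/cvgrPdist_le => eta eta0; have := bounds _ eta0; apply: filterS => e /= [].
case: (g e) => [z| |]//=; rewrite !lee_fin ler_distl => a b.
by apply/andP; split; lra.
Unshelve. all: by end_near. Qed.

Lemma cvg_near_bounds {R : realType} (g : R -> \bar R) (I t : R) : 0 < t ->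
  g e @[e --> 0^'+] --> I%:E ->
  \forall e \near 0^'+, ((I - t)%:E <= g e <= (I + t)%:E)%E.
Proof.
move=> t0 /fine_cvgP[gfin /cvgrPdist_le/(_ _ t0)].
apply: filterS2 gfin => e /=; case: (g e) => [z| |]//= _.
by rewrite ler_distl !lee_fin => /andP[a b]; apply/andP; split; lra.
Qed.

Section errors.
Variables (R : realType) (y I S K C C' c3 d t : R).
Hypotheses (y0 : 0 <= y) (K0 : 0 <= K) (C0 : 0 <= C) (C'0 : 0 <= C') (c30 : 0 <= c3)
  (d0 : 0 <= d).
Local Notation M := (y * (C' * K) + y + C * c3 + c3 + y * (C * c3) + C' * K + K).

(** The two bounds of [strong_limit], with [S] the Riemann sum and [d] the
    common size of all errors; [M] dominates the factors which they acquire. *)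
Lemma error_upper : S <= y * I + C' * K * d -> M * d <= t ->
  y * (S + d) + C * c3 * d + c3 * d <= y ^+ 2 * I + t.
Proof.
move=> SI Md; apply: (@le_trans _ _ (y ^+ 2 * I + M * d)); last by rewrite lerD2l.
have h1 : y * S <= y * (y * I + C' * K * d) by exact: ler_wpM2l.
have h2 : 0 <= K * d by exact: mulr_ge0.
have h3 : 0 <= C' * (K * d) by exact: mulr_ge0.
have h4 : 0 <= y * (C * (c3 * d)) by rewrite !mulr_ge0.
suff : y * (S + d) + C * c3 * d + c3 * d + (y * (y * I + C' * K * d) - y * S)
    + K * d + C' * (K * d) + y * (C * (c3 * d)) = y ^+ 2 * I + M * d by lra.
ring.
Qed.

Lemma error_lower g : I <= y * S + C' * K * d + K * d -> S - d <= y * g + C * c3 * d ->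
  M * d <= t -> I <= y ^+ 2 * g + t.
Proof.
move=> IS Sg Md; apply: (@le_trans _ _ (y ^+ 2 * g + M * d)); last by rewrite lerD2l.
have h1 : y * (S - d) <= y * (y * g + C * c3 * d) by exact: ler_wpM2l.
have h2 : 0 <= C * (c3 * d) by rewrite !mulr_ge0.
have h3 : 0 <= c3 * d by exact: mulr_ge0.
have h4 : 0 <= y * (C' * (K * d)) by rewrite !mulr_ge0.
suff : y * S + C' * K * d + K * d + (y * (y * g + C * c3 * d) - y * (S - d))
    + C * (c3 * d) + c3 * d + y * (C' * (K * d)) = y ^+ 2 * g + M * d by lra.
ring.
Qed.

End errors.

Section exhaustion.
Context {R : realType} {n : nat}.
Implicit Types (Om : set 'cV[R]_n).

(** Compact sets whose interiors exhaust [Om]. *)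
Definition compact_core Om (k : nat) : set 'cV[R]_n :=
  [set x | `|x| <= k%:R /\ forall z, ~ Om z -> k.+1%:R^-1 <= `|x - z|].

Lemma compact_core_sub Om k : compact_core Om k `<=` Om.
Proof.
move=> x [_ xO]; apply: contrapT => /xO; rewrite subrr normr0 leNgt.
by rewrite invr_gt0 ltr0Sn.
Qed.

Lemma compact_core_mono Om : {homo compact_core Om : i j / (i <= j)%N >-> i `<=` j}.
Proof.
move=> i j ij x [xi xO]; split; first by rewrite (le_trans xi)// ler_nat.
by move=> z /xO; apply: le_trans; rewrite lef_pV2 ?posrE// ler_nat.
Qed.

Lemma compact_core_compact Om k : compact (compact_core Om k).
Proof.
apply: mx_bounded_closed_compact.
  exists k%:R; split=> [|M kM x [xk _]]; first exact: num_real.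
  by rewrite /= (le_trans xk)// ltW.
have -> : compact_core Om k = [set x | `|x| <= k%:R] `&`
    \bigcap_(z in ~` Om) [set x | k.+1%:R^-1 <= `|x - z|].
  by apply/seteqP; split=> x [xk xO]; split=> // z; exact: xO.
apply: closedI.
  apply: (@preimage_closed _ _ (fun x : 'cV[R]_n => `|x|) [set y | y <= k%:R]); last exact: closed_le.
  by move=> x _; exact: norm_continuous.
apply: closed_bigI => z _.
apply: (@preimage_closed _ _ (fun x : 'cV[R]_n => `|x - z|) [set y | k.+1%:R^-1 <= y]); last exact: closed_ge.
move=> x _; apply: (@continuous_comp _ _ _ (fun x : 'cV[R]_n => x - z) (fun y => `|y|)); last exact: norm_continuous.
by apply: (@continuousB _ _ _ id (cst z) x); [exact: cvg_id|exact: cst_continuous].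
Qed.

Lemma bigcup_compact_core Om : open Om -> \bigcup_k (compact_core Om k)^° = Om.
Proof.
move=> oO; apply/seteqP; split=> [x [k _ /interior_subset]|x Ox]; first exact: compact_core_sub.
have /nbhs_ballP[e /= e0 eO] : nbhs x Om by exact: open_nbhs_nbhs.
have e20 : 0 < e / 2 by rewrite divr_gt0.
pose k := maxn (Num.truncn (`|x| + e / 2)).+1 (Num.truncn (e / 2)^-1).
have xk : `|x| + e / 2 <= k%:R.
  by rewrite (le_trans (ltW (truncnS_gt _)))// ler_nat leq_maxl.
have ke : k.+1%:R^-1 <= e / 2.
  rewrite -[leRHS]invrK lef_pV2 ?posrE ?invr_gt0//.
  by rewrite (le_trans (ltW (truncnS_gt _)))// ler_nat ltnS leq_maxr.
exists k => //; apply/nbhs_ballP; exists (e / 2) => // y.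
rewrite -ball_normE /= => xy; split.
  rewrite -[y](subrK x) (le_trans (ler_normD _ _))// addrC (le_trans _ xk)// lerD2l.
  by rewrite distrC ltW.
move=> z Oz; apply: (le_trans ke); rewrite leNgt; apply/negP => yz; apply: Oz.
by apply: eO; rewrite -ball_normE /= (le_lt_trans (ler_distD y _ _))// [ltRHS]splitr ltrD.
Qed.

End exhaustion.

(** * The limit on an open set *)

Section open_set_limit.
Context {R : realType} {n m : nat}.
Local Notation mu := (lebesgue_rn n).
Implicit Types (u v : 'cV[R]_n -> 'cV[R]_m) (V : 'cV[R]_n -> 'M[R]_(m, n))
  (A : 'M[R]_(m, n)) (E Om X : set 'cV[R]_n) (e r y t : R) (h c : 'cV[R]_n).
Variables (p : R) (D : set 'cV[R]_n) (alpha : @functional R n m)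
  (P N : {vspace 'M[R]_(m, n)}).
Hypotheses (p1 : 1 <= p) (oD : open D) (bD : bounded_set D)
  (strong : strong_p_core_with p D alpha P N).
Variables (del : R) (del0 : 0 <= del).

Let p0 : 0 <= p. Proof. exact: le_trans p1. Qed.
Let pgt0 : 0 < p. Proof. exact: lt_le_trans p1. Qed.
Let core : p_core p D alpha. Proof. by case: strong. Qed.
Local Notation pi := (daddv_pi P N).
Local Notation F := (lim_lin D alpha del).
Let F0 A : (0 <= (F A)%:E)%E. Proof. by rewrite lee_fin; exact: (lim_lin_ge0 p1 core). Qed.

Lemma measurable_lim_lin V : measurable_fun setT V ->
  measurable_fun setT (fun x => (F (V x))%:E).
Proof.
move=> mV; apply/measurable_EFinP; apply: measurableT_comp mV.
by apply: continuous_measurable_mxR; exact: (@lim_lin_continuous _ _ _ _ _ _ _ _ p1 oD bD strong).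
Qed.

Lemma integral_lim_lin_le V K X : measurable X -> measurable_fun setT V -> 0 <= K ->
  (forall A, F A <= K * opnorm A `^ p) ->
  (\int[mu]_(x in X) (F (V x))%:E <= K%:E * pmass p X V)%E.
Proof.
move=> mX mV K0 FK; have mVX : measurable_fun X V by exact: measurable_funTS.
have mP := measurable_pmass p mX mVX.
have P0 x : (0 <= (opnorm (V x) `^ p)%:E)%E by rewrite lee_fin powR_ge0.
rewrite /pmass -(ge0_integralZl_EFin mu mX (fun x _ => P0 x) mP K0).
apply: (ge0_le_integral mu mX).
- by move=> x _; exact: F0.
- exact: measurable_funTS (measurable_lim_lin mV).
- by apply: measurable_funeM.
- by move=> x _; rewrite -EFinM lee_fin; exact: FK.
Qed.

Lemma integral_lim_lin_cst A r c : 0 < r ->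
  (\int[mu]_(x in cube r c) (F A)%:E = (F A * r ^+ n)%:E)%E.
Proof.
move=> r0; rewrite integral_cst; last exact: measurable_cube.
by rewrite [X in (_ * X)%E](lebesgue_rn_cube c r0) EFinM.
Qed.

(** Pointwise, [F (V x)] is at most [y * F (W x) + C * F (V x - W x)]. *)
Lemma integral_lim_lin_split V W K y C X : measurable X ->
  measurable_fun setT V -> measurable_fun setT W -> 0 <= K -> 0 <= y -> 0 <= C ->
  (forall A, F A <= K * opnorm A `^ p) ->
  (forall A B, F (A + B) <= y * F A + C * F B) ->
  (\int[mu]_(x in X) (F (V x))%:E <=
    y%:E * \int[mu]_(x in X) (F (W x))%:E + (C * K)%:E * pmass p X (fun x => (V x - W x)%R))%E.
Proof.
move=> mX mV mW K0 y0 C0 FK Fs.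
have mVW : measurable_fun setT (fun x => V x - W x) by exact: measurable_mxB.
have mFW : measurable_fun X (fun x => (F (W x))%:E) by exact: measurable_funTS (measurable_lim_lin mW).
have mFD : measurable_fun X (fun x => (F (V x - W x))%:E) by exact: measurable_funTS (measurable_lim_lin mVW).
rewrite EFinM -muleA.
apply: (@le_trans _ _ (y%:E * \int[mu]_(x in X) (F (W x))%:E
    + C%:E * \int[mu]_(x in X) (F (V x - W x))%:E)%E); last first.
  apply: leeD; first exact: lexx.
  by apply: lee_wpmul2l; [rewrite lee_fin|exact: integral_lim_lin_le].
rewrite -(ge0_integralZl_EFin mu mX (fun x _ => F0 (W x)) mFW y0).
rewrite -(ge0_integralZl_EFin mu mX (fun x _ => F0 (V x - W x)) mFD C0).
rewrite -ge0_integralD//; last 4 first.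
- by move=> x _; rewrite mule_ge0.
- by apply: measurable_funeM.
- by move=> x _; rewrite mule_ge0.
- by apply: measurable_funeM.
apply: (ge0_le_integral mu mX).
- by move=> x _; exact: F0.
- exact: measurable_funTS (measurable_lim_lin mV).
- by apply: emeasurable_funD; apply: measurable_funeM.
- move=> x _; rewrite -!EFinM -EFinD lee_fin.
  by rewrite -{1}(subrK (W x) (V x)) addrC; exact: Fs.
Qed.

(** Since [V] takes its values in [P], so can the step function, at the price
    of the norm of the projection. *)
Lemma step_approx_proj Om V t : open Om -> measurable_fun setT V ->
  (pmass p setT V < +oo)%E -> (forall x, pi (V x) = V x) -> 0 < t ->
  exists r th (s : seq 'cV[R]_n) (A : 'cV[R]_n -> 'M[R]_(m, n)),
  [/\ 0 < r, 0 < th < 1 & uniq s] /\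
  [/\ forall c, c \in s -> cube r c `<=` Om,
      forall c c', c \in s -> c' \in s -> c != c' -> cube r c `&` cube r c' = set0,
      (\sum_(c <- s) pmass p (cube r c) (fun x => V x - A c)%R <= t%:E)%E,
      (pmass p (Om `\` \bigcup_(c in [set` s]) cube (th * r) c) V <= t%:E)%E
    & forall c, pi (A c) = A c].
Proof.
move=> oO mV Voo piV t0; have [K K0 piK] := linear_opnorm_bound pi.
have Kp0 : 0 <= K `^ p by exact: powR_ge0.
pose d := t / (K `^ p + 1).
have den0 : 0 < K `^ p + 1 by lra.
have d0 : 0 < d by rewrite divr_gt0.
have dt : d <= t by rewrite ler_pdivrMr//; nra.
have Kdt : K `^ p * d <= t by rewrite mulrCA -[leRHS]mulr1 ler_wpM2l ?(ltW t0)// ler_pdivrMr// mul1r; lra.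
have [r [th [s [W [h1 [cO cc sW rest]]]]]] := step_approx p1 oO mV Voo d0.
have [r0 _ _] := h1; exists r, th, s, (fun c => pi (W c)); split; first exact: h1.
split; [exact: cO|exact: cc| | |].
- apply: (@le_trans _ _ ((K `^ p)%:E * d%:E)%E); last by rewrite -EFinM lee_fin.
  apply: le_trans (lee_wpmul2l _ (ltW sW)); last by rewrite lee_fin.
  rewrite ge0_sume_distrr; last by move=> c _; exact: pmass_ge0.
  apply: lee_sum => c _.
  have mVc (B : 'M[R]_(m, n)) : measurable_fun (cube r c) (fun x => V x - B).
    have mB : measurable_fun setT (fun _ : 'cV[R]_n => B) by exact: measurable_cst.
    exact: (measurable_funTS (measurable_mxB mV mB)).
  apply: (pmass_le p0 K0 (measurable_cube _ r0) (mVc _) (mVc _)) => x _.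
  by rewrite -{1}piV -linearB; exact: piK.
- by apply: (le_trans (ltW rest)); rewrite lee_fin.
- by move=> c; exact: pi_idem strong _.
Qed.

(** With [sum_cubes_le], compares the integral of [F \o V] and its Riemann sum
    over the cubes. *)
Lemma integral_bigcup_cubes_le (s : seq 'cV[R]_n) r th V Om K y C (A : 'cV[R]_n -> 'M[R]_(m, n)) :
  0 < r -> 0 < th < 1 -> uniq s -> open Om -> measurable_fun setT V ->
  (forall c, c \in s -> cube r c `<=` Om) ->
  (forall c c', c \in s -> c' \in s -> c != c' -> cube r c `&` cube r c' = set0) ->
  0 <= K -> 0 <= y -> 0 <= C ->
  (forall B, F B <= K * opnorm B `^ p) ->
  (forall A B, F (A + B) <= y * F A + C * F B) ->
  (\int[mu]_(x in Om) (F (V x))%:E <= y%:E * (\sum_(c <- s) F (A c) * r ^+ n)%:E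
   + (C * K)%:E * \sum_(c <- s) pmass p (cube r c) (fun x => V x - A c)%R
   + K%:E * pmass p (Om `\` \bigcup_(c in [set` s]) cube (th * r) c) V)%E.
Proof.
move=> r0 /andP[th0 th1] us oO mV cO cc K0 y0 C0 FK Fs.
have thr0 : 0 < th * r by rewrite mulr_gt0.
have mO := mx_open_measurable oO; have mFV := measurable_lim_lin mV.
pose U := \big[setU/set0]_(c <- s) cube r c.
have mU : measurable U by apply: bigsetU_measurable => c _; exact: measurable_cube.
have UO : U `<=` Om by rewrite /U -bigcup_seq => x [c /= cs]; exact: cO.
have mrest : measurable (Om `\` \bigcup_(c in [set` s]) cube (th * r) c).
  apply: measurableD => //; apply: fin_bigcup_measurable => [|c _]; first exact: finite_seq.
  exact: measurable_cube.
have OE : Om = U `|` (Om `\` U) by rewrite setDUK.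
have mOU : measurable (Om `\` U) by exact: measurableD.
have FV0 X x : X x -> (0 <= (F (V x))%:E)%E by move=> _; exact: F0.
have dOU : [disjoint U & Om `\` U] by apply/disj_setPS => x [Ux [_ ]].
have mFO : measurable_fun (U `|` (Om `\` U)) (fun x => (F (V x))%:E) by exact: measurable_funTS.
rewrite {1}OE (ge0_integral_setU mu mU mOU mFO (FV0 _) dOU).
apply: leeD; last first.
  apply: le_trans (integral_lim_lin_le mrest mV K0 FK).
  apply: (ge0_subset_integral mu mOU mrest).
  - exact: measurable_funTS.
  - exact: FV0.
  - move=> x [Ox nU]; split=> // -[c /= cs xc]; apply: nU; rewrite /U -bigcup_seq.
    exists c => //=.
    apply/in_cube => // i; have := (in_cube c x thr0).1 xc i.
    by move/lt_le_trans; apply; rewrite ler_pM2r ?invr_gt0// ler_piMl ?ltW.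
rewrite (ge0_integral_bigsetU mu (fun c => measurable_cube c r0) us _ _ (FV0 _)); last 2 first.
- move=> c c' /= cs c's [x [qx q'x]]; apply: contrapT => /eqP ne.
  by have := cc _ _ cs c's ne; rewrite -subset0 => /(_ x); exact.
- exact: measurable_funTS.
rewrite -sumEFin ge0_sume_distrr; last first.
  by move=> c _; rewrite lee_fin mulr_ge0 ?exprn_ge0 ?(ltW r0)//; exact: (lim_lin_ge0 p1 core).
rewrite ge0_sume_distrr; last by move=> c _; exact: pmass_ge0.
rewrite -big_split /=; apply: lee_sum => c _; rewrite -(integral_lim_lin_cst _ c r0).
have mA : measurable_fun setT (fun _ : 'cV[R]_n => A c) by exact: measurable_cst.
exact: (integral_lim_lin_split (measurable_cube _ r0) mV mA K0 y0 C0 FK Fs).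
Qed.

Lemma sum_cubes_le (s : seq 'cV[R]_n) r V Om K y C (A : 'cV[R]_n -> 'M[R]_(m, n)) :
  0 < r -> uniq s -> open Om -> measurable_fun setT V ->
  (forall c, c \in s -> cube r c `<=` Om) ->
  (forall c c', c \in s -> c' \in s -> c != c' -> cube r c `&` cube r c' = set0) ->
  0 <= K -> 0 <= y -> 0 <= C ->
  (forall B, F B <= K * opnorm B `^ p) ->
  (forall A B, F (A + B) <= y * F A + C * F B) ->
  ((\sum_(c <- s) F (A c) * r ^+ n)%:E <= y%:E * \int[mu]_(x in Om) (F (V x))%:E
   + (C * K)%:E * \sum_(c <- s) pmass p (cube r c) (fun x => V x - A c)%R)%E.
Proof.
move=> r0 us oO mV cO cc K0 y0 C0 FK Fs.
have mO := mx_open_measurable oO; have mFV := measurable_lim_lin mV.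
apply: (@le_trans _ _ (y%:E * \sum_(c <- s) \int[mu]_(x in cube r c) (F (V x))%:E
   + (C * K)%:E * \sum_(c <- s) pmass p (cube r c) (fun x => V x - A c)%R)%E); last first.
  apply: leeD; last exact: lexx.
  apply: lee_wpmul2l; first by rewrite lee_fin.
  apply: (sum_integral_le us _ mO cO cc) => [c||x]; [exact: measurable_cube|exact: measurable_funTS|exact: F0].
rewrite -sumEFin ge0_sume_distrr; last by move=> c _; apply: integral_ge0 => x _; exact: F0.
rewrite ge0_sume_distrr; last by move=> c _; exact: pmass_ge0.
rewrite -big_split /=; apply: lee_sum => c _; rewrite -(integral_lim_lin_cst _ c r0).
have mA : measurable_fun setT (fun _ : 'cV[R]_n => A c) by exact: measurable_cst.
have -> : pmass p (cube r c) (fun x => V x - A c) = pmass p (cube r c) (fun x => A c - V x).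
  by rewrite /pmass; apply: eq_integral => x _; rewrite -opprB opnormN.
exact: (integral_lim_lin_split (measurable_cube _ r0) mA mV K0 y0 C0 FK Fs).
Qed.

Hypotheses (D0 : D !=set0) (del_cvg : dens D e Q @[e --> 0^'+] --> del%:E).

Section comparison.
Variables (y C c3 : R).
Hypotheses (y0 : 0 <= y) (C0 : 0 <= C) (c30 : 0 <= c3).
Hypothesis sp : quasi_subadditive p D alpha y C.
Hypothesis energy : energy_bound p D alpha pi c3.

(** Split [u] as [l^A + (u - l^A)], and [l^A] as [u - (u - l^A)]; the energy of
    [u - l^A] is that of [V - A]. *)
Lemma G_compare e u V A X : 0 < e -> open X -> pi A = A ->
  in_Lploc p setT u -> in_Lploc p setT V -> DL_eq pi X u V ->
  (G p D alpha e u X <= y%:E * G p D alpha e (mulmx A) X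
     + (C * c3)%:E * pmass p X (fun x => V x - A)%R)%E /\
  (G p D alpha e (mulmx A) X <= y%:E * G p D alpha e u X
     + (C * c3)%:E * pmass p X (fun x => V x - A)%R)%E.
Proof.
move=> e0 oX piA lu lV uV.
have lA : in_Lploc p setT (mulmx A : 'cV[R]_n -> 'cV[R]_m) := @Lploc_mulmx R n p p1 m A.
have lNA : in_Lploc p setT (mulmx (- A) : 'cV[R]_n -> 'cV[R]_m) := @Lploc_mulmx R n p p1 m (- A).
have lw : in_Lploc p setT (fun x => u x - A *m x).
  rewrite (_ : (fun x => _) = (fun x => u x + (- A) *m x)); first exact: LplocD.
  by apply/funext => x; rewrite mulNmx.
have lVA : in_Lploc p setT (fun x => V x - A) := LplocD p0 lV (@Lploc_cst R n p p1 m n (- A)).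
have uVA : DL_eq pi X (fun x => u x - A *m x) (fun x => V x - A).
  have -> : (fun x => V x - A) = (fun x => V x - pi A) by rewrite piA.
  exact: (@DL_eq_affine _ _ _ _ p p1 X u V A lu lV uV).
have GE := G_energy oD D0 c30 energy e0 oX lw lVA uVA.
have GE' : (C%:E * G p D alpha e (fun x => u x - A *m x)%R X <=
    (C * c3)%:E * pmass p X (fun x => V x - A)%R)%E.
  by rewrite EFinM -muleA; apply: lee_wpmul2l GE; rewrite lee_fin.
split.
  have := G_split core y0 C0 sp X e0 lA lw.
  rewrite (_ : (fun x => _ + _) = u); last by apply/funext => x; rewrite addrC subrK.
  by move/le_trans; apply; apply: leeD GE'; exact: lexx.
have := G_split core y0 C0 sp X e0 lu (@LplocZ _ _ _ _ _ (-1) _ p0 lw).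
rewrite (G_opp core X e0 lw).
rewrite (_ : (fun x => _ + _) = mulmx A); last first.
  by apply/funext => x; rewrite scaleN1r opprB addrC subrK.
by move/le_trans; apply; apply: leeD GE'; exact: lexx.
Qed.

End comparison.

(** [G u] and the integral are both compared with the sum over the cubes of
    [step_approx_proj]: by [G_cover] and [G_superadd] for [G u], and by
    [integral_bigcup_cubes_le] and [sum_cubes_le] for the integral. *)
Lemma strong_limit u V Om : open Om -> in_Lploc p setT u ->
  measurable_fun setT V -> (pmass p setT V < +oo)%E -> (forall x, pi (V x) = V x) ->
  DL_eq pi Om u V ->
  G p D alpha e u Om @[e --> 0^'+] --> (\int[mu]_(x in Om) (F (V x))%:E)%E.
Proof.
move=> oO lu mV Voo piV uV; have lV := pmass_setT_Lploc mV Voo.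
have mO := mx_open_measurable oO.
have [c3 c30 energy] := core_energy p1 oD bD strong.
have [K K0 FK] := lim_lin_bound p1 oD bD strong del0.
have I0 : (0 <= \int[mu]_(x in Om) (F (V x))%:E)%E.
  by apply: integral_ge0 => x _; rewrite lee_fin; exact: (lim_lin_ge0 p1 core).
have Ioo : (\int[mu]_(x in Om) (F (V x))%:E < +oo)%E.
  apply: (le_lt_trans (integral_lim_lin_le mO mV K0 FK)).
  apply: lte_mul_pinfty; [by rewrite lee_fin|by []|].
  apply: le_lt_trans Voo; apply: subset_pmass => //; exact: measurable_funTS.
have [I IE] : exists I, (\int[mu]_(x in Om) (F (V x))%:E)%E = I%:E.
  by exists (fine (\int[mu]_(x in Om) (F (V x))%:E)%E); rewrite fineK// ge0_fin_numE.
rewrite IE; rewrite IE lee_fin in I0; apply: cvg_of_bounds => //.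
  by apply: nearW => e; exact: G_ge0.
move=> y t y1 t0; have y0 : 0 <= y by apply: ltW; exact: lt_trans y1.
have [C C0 sp] := core_split p1 core y1.
have [C' C'0 Fs] := lim_lin_split p1 strong del0 y1.
(* all errors produced below are multiples of [d], with total factor at most
   [M] *)
pose M := y * (C' * K) + y + C * c3 + c3 + y * (C * c3) + C' * K + K.
have a0 : 0 <= C' * K by rewrite mulr_ge0.
have b0 : 0 <= C * c3 by rewrite mulr_ge0.
have ya0 : 0 <= y * (C' * K) by rewrite mulr_ge0.
have yb0 : 0 <= y * (C * c3) by rewrite mulr_ge0.
have M0 : 0 < M + 1 by rewrite /M; lra.
pose d := t / (M + 1); have d0 : 0 < d by rewrite divr_gt0.
have Md : M * d <= t.
  by rewrite mulrCA -[leRHS]mulr1 ler_wpM2l ?(ltW t0)// ler_pdivrMr// mul1r; lra.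
have [r [th [s [A [[r0 th01 us] [cO cc sW rest piA]]]]]] :=
  step_approx_proj oO mV Voo piV d0.
pose S := \sum_(c <- s) F (A c) * r ^+ n.
have Icov := integral_bigcup_cubes_le A r0 th01 us oO mV cO cc K0 y0 C'0 FK Fs.
have Scov := sum_cubes_le A r0 us oO mV cO cc K0 y0 C'0 FK Fs.
have I_S : I <= y * S + C' * K * d + K * d.
  rewrite -lee_fin -IE !EFinD; apply: (le_trans Icov); rewrite !EFinM; apply: leeD; first apply: leeD.
  - by rewrite -EFinM.
  - by rewrite -EFinM; apply: lee_wpmul2l sW; rewrite lee_fin.
  - by apply: lee_wpmul2l rest; rewrite lee_fin.
have S_I : S <= y * I + C' * K * d.
  rewrite -lee_fin EFinD; apply: (le_trans Scov); rewrite IE -EFinM; apply: leeD; first exact: lexx.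
  by rewrite [leRHS]EFinM; apply: lee_wpmul2l sW; rewrite lee_fin.
have sG : (\sum_(c <- s) G p D alpha e (mulmx (A c)) (cube r c))%E @[e --> 0^'+] --> S%:E.
  rewrite /S -sumEFin; apply: cvg_nnesum => [c _|c _].
    by apply: nearW => e; exact: G_ge0.
  exact: (@G_cube_cvg _ _ _ _ _ _ p1 core).
have dge0 := ltW d0.
have sG' := cvg_near_bounds d0 sG.
have cov := G_cover oD bD D0 core c30 energy s r0 th01 oO lu lV uV.
near=> e; have e0 : 0 < e by near: e; exact: nbhs_right_gt.
have /andP[sl su] : ((S - d)%:E <= \sum_(c <- s) G p D alpha e (mulmx (A c)) (cube r c) <= (S + d)%:E)%E.
  by near: e.
have cov' : (G p D alpha e u Om <= \sum_(c <- s) G p D alpha e u (cube r c) +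
    c3%:E * pmass p (Om `\` \bigcup_(c in [set` s]) cube (th * r) c) V)%E.
  by near: e.
have cmp c (cs : c \in s) : (G p D alpha e u (cube r c) <=
    y%:E * G p D alpha e (mulmx (A c)) (cube r c)
     + (C * c3)%:E * pmass p (cube r c) (fun x => V x - A c)%R)%E /\
  (G p D alpha e (mulmx (A c)) (cube r c) <= y%:E * G p D alpha e u (cube r c)
     + (C * c3)%:E * pmass p (cube r c) (fun x => V x - A c)%R)%E.
  have uVc : DL_eq pi (cube r c) u V by exact: (@DL_eq_sub_dom _ _ _ _ _ _ _ _ (cO _ cs) uV).
  exact: (G_compare y0 C0 c30 sp energy e0 (@open_cube _ _ r c r0) (piA c) lu lV uVc).
have sum_energy : (\sum_(c <- s) (C * c3)%:E * pmass p (cube r c) (fun x => V x - A c)%R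
    <= (C * c3 * d)%:E)%E.
  rewrite -ge0_sume_distrr => [|c _]; last exact: pmass_ge0.
  by rewrite EFinM; apply: lee_wpmul2l sW; rewrite lee_fin.
have G0 c v : (0 <= G p D alpha e v (cube r c))%E by exact: G_ge0.
split.
  apply: (le_trans cov'); apply: (@le_trans _ _ ((y * (S + d) + C * c3 * d)%:E + (c3 * d)%:E)%E); last first.
    rewrite -EFinD lee_fin.
    exact: (error_upper y0 K0 C0 C'0 c30 dge0 S_I Md).
  apply: leeD; last by rewrite EFinM; apply: lee_wpmul2l rest; rewrite lee_fin.
  apply: (@le_trans _ _ (\sum_(c <- s) (y%:E * G p D alpha e (mulmx (A c)) (cube r c)
     + (C * c3)%:E * pmass p (cube r c) (fun x => V x - A c)%R))%E).
    rewrite big_seq [leRHS]big_seq; apply: lee_sum => c cs; exact: (cmp c cs).1.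
  rewrite big_split /= EFinD; apply: leeD; last exact: sum_energy.
  rewrite -ge0_sume_distrr => [|c _]; last exact: G0.
  by rewrite EFinM; apply: lee_wpmul2l su; rewrite lee_fin.
have low : ((S - d)%:E <= y%:E * G p D alpha e u Om + (C * c3 * d)%:E)%E.
  apply: (le_trans sl).
  apply: (@le_trans _ _ (\sum_(c <- s) (y%:E * G p D alpha e u (cube r c)
     + (C * c3)%:E * pmass p (cube r c) (fun x => V x - A c)%R))%E).
    rewrite big_seq [leRHS]big_seq; apply: lee_sum => c cs; exact: (cmp c cs).2.
  rewrite big_split /=; apply: leeD; last exact: sum_energy.
  rewrite -ge0_sume_distrr => [|c _]; last exact: G0.
  apply: lee_wpmul2l; first by rewrite lee_fin.
  exact: (G_superadd oD D0 core e0 lu us cO cc).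
have := @G_ge0 _ _ _ p D alpha e u Om.
move: (G p D alpha e u Om) low => [g| |] low; last by [].
  rewrite -!EFinM -!EFinD !lee_fin in low *; move=> g0.
  exact: (error_lower y0 K0 C0 C'0 c30 dge0 I_S low Md).
move=> _; rewrite gt0_muley ?lte_fin; last by rewrite exprn_gt0// (lt_trans ltr01).
by rewrite addye// leey.
Unshelve. all: by end_near. Qed.

(** [V] and [pi V] have the same [psi] and both represent [D_pi u], so [V] may
    be replaced by the extension of [pi V] by zero. *)
Lemma strong_limit_proj Om u V : open Om -> in_Lploc p setT u ->
  measurable_fun Om V -> in_Lploc p Om V -> (pmass p Om (fun x => pi (V x)) < +oo)%E ->
  DL_eq pi Om u V ->
  G p D alpha e u Om @[e --> 0^'+] --> (\int[mu]_(x in Om) (F (V x))%:E)%E.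
Proof.
move=> oO lu mV lV piVoo uV; have mO := mx_open_measurable oO.
pose W := zext Om (fun x => pi (V x)).
have mpiV : measurable_fun Om (fun x => pi (V x)) by exact: measurable_linear.
have mW : measurable_fun setT W by exact: measurable_zext.
have Woo : (pmass p setT W < +oo)%E by rewrite pmass_zext.
have piW x : pi (W x) = W x.
  by rewrite /W /zext; case: ifP => _; [exact: (pi_idem strong)|exact: linear0].
have uW : DL_eq pi Om u W.
  have uV' := @DL_eq_idem _ _ _ _ (pi_idem strong) _ p1 _ _ _ lu lV uV.
  by apply: (@DL_eq_ext _ _ _ _ _ _ _ _ _ uV') => x Ox; rewrite /W zextE.
rewrite (_ : (\int[mu]_(x in Om) _)%E = (\int[mu]_(x in Om) (F (W x))%:E)%E).
  exact: (strong_limit oO lu mW Woo piW uW).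
apply: eq_integral => x /[!inE] Ox.
by rewrite /W zextE// (lim_lin_pi p1 strong del0 del_cvg).
Qed.

Lemma strong_limit_Lp Om u V : open Om -> in_Lploc p setT u -> in_Lp p Om V ->
  DL_eq pi Om u V ->
  G p D alpha e u Om @[e --> 0^'+] --> (\int[mu]_(x in Om) (F (V x))%:E)%E.
Proof.
move=> oO lu [mV Voo] uV; have mO := mx_open_measurable oO.
have [K K0 piK] := linear_opnorm_bound pi.
have mpiV : measurable_fun Om (fun x => pi (V x)) by exact: measurable_linear.
have lV : in_Lploc p Om V.
  move=> C cC CO; have mC := mx_compact_measurable cC.
  split; first exact: measurable_funS mV.
  exact: le_lt_trans (subset_pmass _ mC mO mV CO) Voo.
have piVoo : (pmass p Om (fun x => pi (V x)) < +oo)%E.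
  apply: (le_lt_trans (pmass_le p0 K0 mO mpiV mV (fun x _ => piK (V x)))).
  by apply: lte_mul_pinfty Voo; [rewrite lee_fin powR_ge0|].
exact: strong_limit_proj oO lu mV lV piVoo uV.
Qed.

(** If the energy is finite, coercivity puts [pi V] in [L^p]; otherwise the
    energies of an exhaustion of [Om] are arbitrarily large. *)
Lemma strong_limit_loc Om u V : open Om -> in_Lploc p setT u -> in_Lploc p Om V ->
  DL_eq pi Om u V ->
  G p D alpha e u Om @[e --> 0^'+] --> (\int[mu]_(x in Om) (F (V x))%:E)%E.
Proof.
move=> oO lu lV uV; have mO := mx_open_measurable oO.
have mK k := mx_compact_measurable (@compact_core_compact R n Om k).
have lVK k := lV _ (@compact_core_compact R n Om k) (@compact_core_sub R n Om k).
pose O k := (compact_core Om k)^°.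
have oOk k : open (O k) by exact: open_interior.
have mOk k : measurable (O k) by exact: mx_open_measurable.
have OE : \bigcup_k O k = Om by exact: bigcup_compact_core.
have mVO k : measurable_fun (O k) V.
  exact: measurable_funS (mK k) (@interior_subset _ _) (lVK k).1.
have mV : measurable_fun Om V by rewrite -OE; apply/measurable_fun_bigcup.
have mpiV : measurable_fun Om (fun x => pi (V x)) by exact: measurable_linear.
have FV0 x : (0 <= (F (V x))%:E)%E := F0 (V x).
have mFV : measurable_fun Om (fun x => (F (V x))%:E).
  apply/measurable_EFinP; apply: measurableT_comp mV.
  by apply: continuous_measurable_mxR; exact: (@lim_lin_continuous _ _ _ _ _ _ _ _ p1 oD bD strong).
have [J|Joo] := ltP (\int[mu]_(x in Om) (F (V x))%:E)%E +oo%E.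
  have [k k0 Fk] := lim_lin_coercive p1 oD bD strong del0 del_cvg.
  suff piVoo : (pmass p Om (fun x => pi (V x)) < +oo)%E.
    exact: strong_limit_proj oO lu mV lV piVoo uV.
  have mP := measurable_pmass p mO mpiV.
  have : (k%:E * pmass p Om (fun x => pi (V x)) <= \int[mu]_(x in Om) (F (V x))%:E)%E.
    rewrite /pmass -(ge0_integralZl_EFin mu mO _ mP (ltW k0)); last first.
      by move=> x _; rewrite lee_fin powR_ge0.
    apply: (ge0_le_integral mu mO).
    - by move=> x _; rewrite mule_ge0 ?lee_fin ?powR_ge0// ltW.
    - exact: measurable_funeM.
    - exact: mFV.
    - by move=> x _; rewrite -EFinM lee_fin; exact: Fk.
  move=> /le_lt_trans/(_ J); rewrite !ltey; apply: contra_neq => ->.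
  by rewrite gt0_muley ?lte_fin.
have -> : (\int[mu]_(x in Om) (F (V x))%:E)%E = +oo%E by apply/eqP; rewrite eq_le leey.
apply/cvgeyPge => B.
have Jcvg : (\int[mu]_(x in O k) (F (V x))%:E)%E @[k --> \oo] --> +oo%E.
  have -> : +oo%E = (\int[mu]_(x in \bigcup_k O k) (F (V x))%:E)%E.
    by rewrite OE; apply: le_anti; rewrite Joo leey.
  apply: ge0_nondecreasing_set_cvg_integral => //.
  - move=> i j ij; apply/subsetPset; apply: interiorS; exact: compact_core_mono.
  - move=> k; apply: measurable_funS mFV => //.
    by apply: subset_trans (@interior_subset _ _) _; exact: compact_core_sub.
have [k _ /(_ k (leqnn k)) Bk] := (cvgeyPge _).1 Jcvg (B + 1).
have OkO : O k `<=` Om.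
  by apply: subset_trans (@interior_subset _ _) _; exact: compact_core_sub.
have Vk : in_Lp p (O k) V.
  split=> //; apply: le_lt_trans (lVK k).2; apply: subset_pmass => //.
    exact: (lVK k).1.
  exact: interior_subset.
have uVk : DL_eq pi (O k) u V by exact: (@DL_eq_sub_dom _ _ _ _ _ _ _ _ OkO uV).
have := strong_limit_Lp (oOk k) lu Vk uVk.
move: Bk; case: (\int[mu]_(x in O k) (F (V x))%:E)%E => [z| |//] /= Bk.
  move/(cvg_near_bounds ltr01); apply: filterS => e /andP[ze _].
  apply: (@le_trans _ _ (z - 1)%:E); first by rewrite lee_fin; rewrite lee_fin in Bk; lra.
  exact: le_trans ze (G_mono _ _ _ _ _ OkO).
move/cvgeyPge => /(_ B); apply: filterS => e Be.
exact: le_trans Be (G_mono _ _ _ _ _ OkO).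
Qed.

End open_set_limit.

Section empty_reference.
Context {R : realType} {n m : nat} (p : R) (alpha : @functional R n m).
Hypotheses (p1 : 1 <= p) (core : p_core p (set0 : set 'cV[R]_n) alpha).

(** Every function agrees with [0] on the empty set, so [alpha] vanishes by
    homogeneity. *)
Lemma G_set0 u Om e : 0 < e -> in_Lploc p setT u -> G p set0 alpha e u Om = 0%E.
Proof.
move=> e0 lu; rewrite G_packsup (@eq_packsup _ _ _ _ (fun E => 0%:E * (alpha u E)%:E)%E).
  rewrite packsupZ ?mul0e ?mule0// => E cE; exact: (alpha_ge0 core e0 lu cE).
move=> E cE; have cE' := copies_at_copies e0 cE; rewrite mul0e.
have E0 : E = set0 by case: cE => _ [h ->]; rewrite image_set0.
have l0 : in_Lploc p setT (fun x => 0 *: u x) by apply: LplocZ => //; exact: le_trans p1.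
rewrite (core_local core lu l0 cE') ?(core_homogeneous core)//.
  by rewrite normr0 powR0 ?mul0r// gt_eqF// (lt_le_trans ltr01).
by apply: aeW => x; rewrite E0.
Qed.

Lemma G_set0_cvg u Om : in_Lploc p setT u -> G p set0 alpha e u Om @[e --> 0^'+] --> 0%E.
Proof.
by move=> lu; apply: cvg_near_cst; near=> e; apply: G_set0.
Unshelve. all: by end_near. Qed.

Lemma psi_set0 A : psi p set0 alpha A = 0%E.
Proof. by apply: cvg_lim => //; apply: G_set0_cvg; exact: Lploc_mulmx. Qed.

End empty_reference.

Theorem theorem1p2 (R : realType) (n m : nat) (Omega D : set 'cV[R]_n) (p : R)
    (alpha : @functional R n m) (P N : {vspace 'M[R]_(m, n)})
    (u : 'cV[R]_n -> 'cV[R]_m) :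
  open Omega -> (0 < m)%N -> 1 <= p -> open D -> bounded_set D ->
  strong_p_core_with p D alpha P N ->
  in_Lploc p setT u ->
  (forall V : 'cV[R]_n -> 'M[R]_(m, n),
     in_Lp p Omega V -> DL_eq (daddv_pi P N) Omega u V ->
     G p D alpha e u Omega @[e --> 0^'+] -->
       (\int[lebesgue_rn n]_(x in Omega) psi p D alpha (V x))%E) /\
  (forall V : 'cV[R]_n -> 'M[R]_(m, n),
     in_WLploc (daddv_pi P N) p Omega u V ->
     (exists A, psi p D alpha A <> 0%E) ->
     G p D alpha e u Omega @[e --> 0^'+] -->
       (\int[lebesgue_rn n]_(x in Omega) psi p D alpha (V x))%E).
Proof.
move=> oO m0 p1 oD bD strong lu; have core : p_core p D alpha by case: strong.
have [D0|D0] := eqVneq D set0.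
  subst D; split=> V _ _; under eq_integral do rewrite (psi_set0 p1 core);
  by rewrite integral0; exact: G_set0_cvg.
have {}D0 : D !=set0 by apply/set0P.
have [del del0 del_cvg] := dens_cvg D0 oD bD.
split=> V.
  move=> lV uV; under eq_integral do rewrite (psiE p1 core del_cvg).
  exact: (strong_limit_Lp p1 oD bD strong del0 D0 del_cvg oO lu lV uV).
move=> [_ lV uV] _; under eq_integral do rewrite (psiE p1 core del_cvg).
exact: (strong_limit_loc p1 oD bD strong del0 D0 del_cvg oO lu lV uV).
Qed.
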